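(* Write $\alpha=i\sqrt2$. Every point $x\in\mathbf{H}^2_{\mathbb{C}}$ whose isotropy group in $\Gamma_2$ has $x$ as an isolated fixed point is in the $\Gamma_2$-orbit of exactly one of the following seven points $p$. Write $G$ for the isotropy group of $p$, $R_G$ for the subgroup of $G$ generated by complex reflections, and $(j_1,j_2,j_3)$ for the numbers of mirrors of complex reflections of $G$ that lie in the $\Gamma_2$-orbits of the mirrors polar to $(0,1,0)$, $(1,-1,0)$, $(1,0,1)$ respectively. (1) $p=(1,0,-1)$: $G=R_G$ has order $4$, generated by the reflections with polar vectors $(0,1,0)$, $(1,0,1)$, with braid length $2$; $(j_1,j_2,j_3)=(1,0,1)$. (2) $p=(-1-\alpha,\alpha,\alpha)$: $G=R_G$ has order $4$, generated by the reflections with polar vectors $(1,-1,0)$, $(1,-\alpha,-\alpha)$, with braid length $2$; $(j_1,j_2,j_3)=(0,1,1)$. (3) $p=(-2-\alpha,-1,\alpha)$: $G=R_G$ has order $6$, generated by the reflections with polar vectors $(1,-\alpha,0)$, $(1+\alpha,0,1)$, with braid length $3$; $(j_1,j_2,j_3)=(0,0,3)$. (4) $p=(1,-1,-1)$: $G=R_G$ has order $8$, generated by the reflections with polar vectors $(0,1,1)$, $(1,0,1)$, with braid length $4$; $(j_1,j_2,j_3)=(0,2,2)$. (5) $p=(-2-\alpha,-1+\alpha,\alpha)$: $G=R_G$ has order $48$, is isomorphic to the Shephard–Todd group $G_{12}$, and is generated by the reflections with polar vectors $(0,\alpha,1)$, $(1+\alpha,2,1-\alpha)$, $(1+\alpha,2-\alpha,-\alpha)$,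 with pairwise braid length $6$; $(j_1,j_2,j_3)=(0,0,12)$. (6) $p$ is the fixed point in $\mathbf{H}^2_{\mathbb{C}}$ of $M=\begin{pmatrix}1-\alpha&-2&\alpha\\-\alpha&-1&0\\-1&\alpha&1\end{pmatrix}$: $G$ is cyclic of order $8$, generated by $M$, and $R_G$ has order $2$, generated by the reflection with polar vector $(\alpha,1,0)$; $(j_1,j_2,j_3)=(1,0,0)$. (7) $p$ is the fixed point in $\mathbf{H}^2_{\mathbb{C}}$ of $M=\begin{pmatrix}1&2&-2-2\alpha\\-\alpha&-1-2\alpha&-2+2\alpha\\-1-\alpha&-2-\alpha&-1+2\alpha\end{pmatrix}$: $G$ is cyclic of order $4$, generated by $M$, and $R_G$ has order $2$, generated by the reflection with polar vector $(\alpha,1,1)$; $(j_1,j_2,j_3)=(0,1,0)$. In cases (6) and (7), $p$ has no representative with coordinates in $\mathbb{Q}(i\sqrt2)$.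
   Context: On $\mathbb{C}^3$ let $\langle v,w\rangle=w^*Jv$ with $J=\begin{pmatrix}0&0&1\\0&1&0\\1&0&0\end{pmatrix}$, $U(J)=\{A\in GL_3(\mathbb{C}):A^*JA=J\}$, and let $\Gamma_d=PU(J,\mathcal{O}_d)$ be the image in $PU(J)$ of $U(J)\cap GL_3(\mathcal{O}_d)$, with $\mathcal{O}_d$ the ring of integers of $\mathbb{Q}(i\sqrt d)$ ($\mathcal{O}_2=\mathbb{Z}[i\sqrt2]$). It acts on $\mathbf{H}^2_{\mathbb{C}}=\{\mathbb{C}v:\langle v,v\rangle<0\}$; a vector $v$ stands for the point $\mathbb{C}v$, and matrices stand for their classes in $PU(J)$. For $\langle w,w\rangle>0$, the mirror polar to $w$ is $\{\mathbb{C}v\in\mathbf{H}^2_{\mathbb{C}}:\langle v,w\rangle=0\}$; a complex reflection is a nontrivial finite-order element fixing such a mirror pointwise. ''The reflection with polar vector $w$'' is the involution $v\mapsto v-2\frac{\langle v,w\rangle}{\langle w,w\rangle}w$. The braid length of a pair $A,B$ is the smallest $n\ge2$ such that the alternating products $ABA\cdots$ and $BAB\cdots$ with $n$ factors are equal. $G_{12}$ is the finite complex reflection group of order $48$ in $GL_2(\mathbb{C})$ numbered 12 in the Shephard–Todd classification. *)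

(* Defs.v *)
From HB Require Import structures.
From mathcomp Require Import all_boot all_order all_algebra.
From mathcomp Require Import all_classical all_reals all_analysis.
From mathcomp Require Export complex.

Set Implicit Arguments.
Unset Strict Implicit.
Unset Printing Implicit Defensive.

Import Order.TTheory GRing.Theory Num.Theory.
Import numFieldNormedType.Exports.

Local Open Scope classical_set_scope.
Local Open Scope ring_scope.
Local Open Scope quotient_scope.
Local Open Scope card_scope.

Section Groups.
Variable gT : groupType.
Implicit Types (A : set gT) (x y : gT) (n : nat).

Definition subgroup A : Prop :=
  [/\ A 1%g, (forall x y, A x -> A y -> A (x * y)%g)
    & forall x, A x -> A (x^-1)%g].

Definition generated A : set gT := smallest subgroup A.

Fixpoint alternating n x y : gT :=
  if n is m.+1 then (x * alternating m y x)%g else 1%g.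

Definition has_braid_length x y n : Prop :=
  [/\ (2 <= n)%N, alternating n x y = alternating n y x
    & forall m, (2 <= m < n)%N -> alternating m x y <> alternating m y x].

End Groups.

Definition isomorphic_groups (gT hT : groupType) (A : set gT) (B : set hT) :=
  exists2 f : gT -> hT, set_bij A B f
    & forall x y, A x -> A y -> f (x * y)%g = (f x * f y)%g.

Section GeneralLinear.
Variables (C : numClosedFieldType) (n : nat).

Record GL := MkGL { glval :> 'M[C]_n; glvalP : glval \in unitmx }.

HB.instance Definition _ := [isSub for glval].
HB.instance Definition _ := [Choice of GL by <:].

Definition GL1 : GL := MkGL (unitmx1 C n).

Fact GLmul_subproof (A B : GL) : A *m B \in unitmx.
Proof. by rewrite unitmx_mul !glvalP. Qed.
Definition GLmul (A B : GL) : GL := MkGL (GLmul_subproof A B).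

Fact GLinv_subproof (A : GL) : invmx A \in unitmx.
Proof. by rewrite unitmx_inv glvalP. Qed.
Definition GLinv (A : GL) : GL := MkGL (GLinv_subproof A).

Fact GLmulA : associative GLmul.
Proof. by move=> A B D; apply: val_inj => /=; rewrite mulmxA. Qed.
Fact GLmul1 : left_id GL1 GLmul.
Proof. by move=> A; apply: val_inj => /=; rewrite mul1mx. Qed.
Fact GLmulr1 : right_id GL1 GLmul.
Proof. by move=> A; apply: val_inj => /=; rewrite mulmx1. Qed.
Fact GLmulV : left_inverse GL1 GLinv GLmul.
Proof. by move=> A; apply: val_inj => /=; rewrite mulVmx // glvalP. Qed.
Fact GLmulrV : right_inverse GL1 GLinv GLmul.
Proof. by move=> A; apply: val_inj => /=; rewrite mulmxV // glvalP. Qed.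

HB.instance Definition _ :=
  isGroup.Build GL GLmulA GLmul1 GLmulr1 GLmulV GLmulrV.

Definition proportional (A B : GL) : bool := is_scalar_mx (A *m invmx B).

Lemma proportionalP (A B : GL) :
  reflect (exists2 c : C, c \is a GRing.unit & glval A = c *: glval B)
          (proportional A B).
Proof.
apply: (iffP idP) => [/is_scalar_mxP[c AB]|[c _ AB]]; last first.
  by rewrite /proportional AB -scalemxAl mulmxV ?glvalP // scalemx1
             scalar_mx_is_scalar.
have AE : glval A = c *: glval B.
  by rewrite -[LHS](mulmxKV (glvalP B)) AB mul_scalar_mx.
have [c0|cn0] := eqVneq c 0; last by exists c; rewrite ?unitfE.
exists 1; first exact: unitr1.
have A0 : glval A = 0 by rewrite AE c0 scale0r.
have u0 : (0 : 'M[C]_n) \in unitmx by rewrite -A0 glvalP.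
rewrite scale1r A0.
have e1 : (1%:M : 'M[C]_n) = 0 by rewrite -(mulVmx u0) mulmx0.
by rewrite -[glval B]mul1mx e1 mul0mx.
Qed.

Fact proportional_refl : reflexive proportional.
Proof. by move=> A; apply/proportionalP; exists 1; rewrite ?unitr1 ?scale1r. Qed.
Fact proportional_sym : symmetric proportional.
Proof.
have h A B : proportional A B -> proportional B A.
  move=> /proportionalP[c cu AB]; apply/proportionalP.
  by exists c^-1; rewrite ?unitrV // AB scalerA mulVr // scale1r.
by move=> A B; apply/idP/idP; apply: h.
Qed.
Fact proportional_trans : transitive proportional.
Proof.
move=> B A D /proportionalP[c cu AB] /proportionalP[d du BD].
by apply/proportionalP; exists (c * d); rewrite ?unitrM ?cu // AB BD scalerA.
Qed.

Canonical proportional_equiv :=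
  EquivRel proportional proportional_refl proportional_sym proportional_trans.

Definition PGL := {eq_quot proportional}.

HB.instance Definition _ := Choice.on PGL.
HB.instance Definition _ := EqQuotient.on PGL.

Definition PGL1 : PGL := lift_cst PGL GL1.
Definition PGLmul := lift_op2 PGL GLmul.
Definition PGLinv := lift_op1 PGL GLinv.

Canonical pi_PGL1 := PiConst PGL1.

Fact pi_PGLmul : {morph \pi_PGL : A B / GLmul A B >-> PGLmul A B}.
Proof.
move=> A B; unlock PGLmul; apply/eqP; rewrite eqmodE; apply/proportionalP => /=.
have /eqP := reprK (\pi_PGL A); rewrite eqmodE => /proportionalP[a au Aa].
have /eqP := reprK (\pi_PGL B); rewrite eqmodE => /proportionalP[b bu Bb].
exists (a * b)^-1; first by rewrite unitrV unitrM au bu.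
by rewrite Aa Bb -scalemxAl -scalemxAr !scalerA -mulrA mulVr ?scale1r // unitrM au bu.
Qed.
Canonical pi_PGLmul_morph := PiMorph2 pi_PGLmul.

Fact pi_PGLinv : {morph \pi_PGL : A / GLinv A >-> PGLinv A}.
Proof.
move=> A; unlock PGLinv; apply/eqP; rewrite eqmodE; apply/proportionalP => /=.
have /eqP := reprK (\pi_PGL A); rewrite eqmodE => /proportionalP[a au Aa].
by exists a => //; rewrite Aa invmxZ -?Aa ?glvalP // scalerA mulrV // scale1r.
Qed.
Canonical pi_PGLinv_morph := PiMorph1 pi_PGLinv.

Fact PGLmulA : associative PGLmul.
Proof. by do 3![elim/quotW=> ?]; rewrite !piE GLmulA. Qed.
Fact PGLmul1 : left_id PGL1 PGLmul.
Proof. by elim/quotW=> ?; rewrite !piE GLmul1. Qed.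
Fact PGLmulr1 : right_id PGL1 PGLmul.
Proof. by elim/quotW=> ?; rewrite !piE GLmulr1. Qed.
Fact PGLmulV : left_inverse PGL1 PGLinv PGLmul.
Proof. by elim/quotW=> ?; rewrite !piE GLmulV. Qed.
Fact PGLmulrV : right_inverse PGL1 PGLinv PGLmul.
Proof. by elim/quotW=> ?; rewrite !piE GLmulrV. Qed.

HB.instance Definition _ :=
  isGroup.Build PGL PGLmulA PGLmul1 PGLmulr1 PGLmulV PGLmulrV.

(* [toGL A] and [cls A] are the identity element when A is not invertible. *)
Definition toGL (A : 'M[C]_n) : GL := insubd GL1 A.
Definition cls (A : 'M[C]_n) : PGL := \pi_PGL (toGL A).

End GeneralLinear.

Section ComplexHyperbolicPlane.
Variable C : numClosedFieldType.
Implicit Types (v w : 'cV[C]_3) (g : PGL C 3).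

Definition mx_of_rows n (rows : seq (seq C)) : 'M[C]_n :=
  \matrix_(i, j) nth 0 (nth [::] rows i) j.

Definition vec3 (a b c : C) : 'cV[C]_3 := \col_i nth 0 [:: a; b; c] i.

Definition adjoint m n (A : 'M[C]_(m, n)) : 'M[C]_(n, m) := map_mx Num.conj A^T.

Definition Jmx : 'M[C]_3 :=
  mx_of_rows 3 [:: [:: 0; 0; 1]; [:: 0; 1; 0]; [:: 1; 0; 0]].

Definition herm v w : C := (adjoint w *m Jmx *m v) 0 0.

(* Points of the projective plane are the lines of C^3, as subspaces. *)
Definition line_point := {vspace 'cV[C]_3}.
Definition line v : line_point := <[v]>%VS.

Definition act g (x : line_point) : line_point :=
  (linfun (mulmx (glval (repr g))) @: x)%VS.

Lemma act_pi (A : GL C 3) v : act (\pi_(PGL C 3) A) (line v) = line (A *m v).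
Proof.
have /eqP := reprK (\pi_(PGL C 3) A); rewrite eqmodE => /proportionalP[c cu Ac].
have c0 : c != 0 by rewrite -unitfE.
rewrite /act /line limg_line lfunE /= Ac -scalemxAl.
apply/eqP; rewrite eqEsubv -!memvE; apply/andP; split.
  by rewrite memvZ // memv_line.
by rewrite -[X in X \in _](scalerK c0) memvZ // memv_line.
Qed.

Definition H2 : set line_point := [set x | exists2 v, herm v v < 0 & x = line v].

Definition mirror w : set line_point :=
  [set x | exists v, [/\ herm v v < 0, x = line v & herm v w = 0]].

(* U(J), as a subset of GL_3(C); its image PU(J) is taken inside PGL_3(C). *)
Definition UJ : set (GL C 3) :=
  [set A | adjoint (glval A) *m Jmx *m glval A = Jmx].

Definition alpha : C := 'i * sqrtC 2.

Definition O2 : set C := [set z | exists m n : int, z = m%:~R + n%:~R * alpha].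

Definition Qalpha : set C :=
  [set z | exists q r : rat, z = ratr q + ratr r * alpha].

Definition GL3_O2 : set (GL C 3) :=
  [set A | forall i j, O2 (glval A i j) /\ O2 (glval (A^-1)%g i j)].

Definition Gamma2 : set (PGL C 3) :=
  [set \pi_(PGL C 3) A | A in UJ `&` GL3_O2].

Definition isotropy (x : line_point) : set (PGL C 3) :=
  [set g | Gamma2 g /\ act g x = x].

Definition orbit2 (x : line_point) : set line_point :=
  [set act g x | g in Gamma2].

(* The projection v |-> line v is open on nonzero vectors, so the images of the
   neighborhoods of v are the neighborhoods of line v in the projective plane. *)
Definition isolated_fixed_point (x : line_point) : Prop :=
  exists2 v, x = line v &
    \forall w \near v, H2 (line w) ->
      (forall g, isotropy x g -> act g (line w) = line w) -> line w = x.

Definition reflection_with_mirror g (m : set line_point) : Prop :=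
  [/\ g <> 1%g, (exists2 n, (0 < n)%N & (g ^+ n)%g = 1%g),
      (exists2 w, 0 < herm w w & m = mirror w)
    & forall x, m x -> act g x = x].

Definition complex_reflection g : Prop := exists m, reflection_with_mirror g m.

Definition reflection_subgroup (G : set (PGL C 3)) : set (PGL C 3) :=
  generated (G `&` complex_reflection).

Definition mirrors_in_orbit (G : set (PGL C 3)) w : set (set line_point) :=
  [set m | (exists2 g, G g & reflection_with_mirror g m) /\
           (exists2 g, Gamma2 g & m = act g @` mirror w)].

Definition mirror_counts (G : set (PGL C 3)) (j1 j2 j3 : nat) : Prop :=
  [/\ mirrors_in_orbit G (vec3 0 1 0) #= `I_j1,
      mirrors_in_orbit G (vec3 1 (-1) 0) #= `I_j2
    & mirrors_in_orbit G (vec3 1 0 1) #= `I_j3].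

Definition reflection_mx w : 'M[C]_3 :=
  1%:M - (2 / herm w w) *: (w *m (adjoint w *m Jmx)).

Lemma reflection_mxE w v :
  reflection_mx w *m v = v - (2 * (herm v w / herm w w)) *: w.
Proof.
rewrite mulmxBl mul1mx -scalemxAl -[w *m _ *m v]mulmxA.
rewrite [adjoint w *m Jmx *m v]mx11_scalar mul_mx_scalar scalerA -/(herm v w).
by rewrite mulrAC mulrA.
Qed.

Definition reflection w : PGL C 3 := cls (reflection_mx w).

(* Shephard-Todd G_12, on the order 2 generators r_3, r_3', r_3'' of Lehrer and
   Taylor: (Z - X)/sqrt 2, (Z + X)/sqrt 2, (X - Y)/sqrt 2, X, Y, Z being the Pauli
   matrices. Its twelve reflections are the matrices (+-P +- Q)/sqrt 2 with P <> Q
   among X, Y, Z. *)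
Definition G12 : set (GL C 2) :=
  generated [set toGL ((sqrtC 2)^-1 *: M) | M in
    [set mx_of_rows 2 [:: [:: 1; -1]; [:: -1; -1]];
         mx_of_rows 2 [:: [:: 1; 1]; [:: 1; -1]];
         mx_of_rows 2 [:: [:: 0; 1 + 'i]; [:: 1 - 'i; 0]]]].

End ComplexHyperbolicPlane.

Arguments vec3 {C}.
Arguments mx_of_rows {C}.
Arguments O2 {C}.
Arguments H2 {C}.
Arguments Gamma2 {C}.
Arguments G12 : clear implicits.
Arguments Qalpha : clear implicits.
Arguments alpha : clear implicits.

(* Main.v *)
(** If [x = C v] is an isolated fixed point, some isotropy element [A] of determinant
    1 has [v] as an eigenvector for a simple eigenvalue: otherwise the isotropy group
    has at most one nontrivial element, a reflection, and it fixes points near [x].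
    The eigenvalues of [A] have modulus 1, so its trace is an element of [O_2] inside
    the deltoid, which leaves 3, -1, 0, 1, 2 and -1 +- alpha.  After passing to a power,
    [A] has order 2, 3 or 4, and [v] or another eigenvector is proportional to a
    primitive lattice vector [w] with [<w, w>] dividing 2 or 3.  Reduction theory on the
    lattice orthogonal to [w], for [<., .>] itself if [w] is negative and for a positive
    definite form built from [A] if [w] is positive, leaves finitely many Gram matrices
    of lattice frames, and the Gram matrix determines the orbit of [x].

    The isotropy group of an explicit point [p] preserves the rational part of a positive
    definite majorant of [<., .>] at [p], so it is found by enumerating short vectors;
    all computations take place in Z[i, sqrt 2].  The numbers of mirrors in the three
    orbits separate the seven points. *)

From Stdlib Require Import ZArith.
Require Import Defs.
From mathcomp Require Import all_boot all_order all_algebra.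
From mathcomp Require Import all_classical all_reals all_analysis.
From mathcomp Require Import complex spectral.
From mathcomp Require Import ring zify ssrZ.

Set Implicit Arguments.
Unset Strict Implicit.
Unset Printing Implicit Defensive.

Import Order.TTheory GRing.Theory Num.Theory.

Local Open Scope classical_set_scope.
Local Open Scope ring_scope.
Local Open Scope card_scope.
Local Open Scope quotient_scope.
Delimit Scope Z_scope with bZ.

(** The units of O_2 are 1 and -1, and -1 has determinant -1 in dimension 3, so each class in the
    group has exactly one representative of determinant 1. Equality in PGL becomes equality of
    integer tuples, and a reflection is represented by its negative. O_2 is Euclidean, which yields
    primitive vectors, complements and reduced bases.

    The norm <w,w> divides 2 or 3 because A + 1, A^2 + 1 or A^2 + A + 1 is 2 or 3 times the
    orthogonal projector onto w and has integral entries.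

    The eigenvalue at v of the chosen power decides the case. If it is 1, then v is proportional to
    a lattice vector. Otherwise the eigenvector w for 1 is positive and <.,.> is indefinite on the
    lattice orthogonal to w; there A or 2A + 1 squares to a negative scalar, which supplies the
    definite form. For order 3 this case is contradictory; for order 4 it produces the points (6)
    and (7), whose coordinates force the passage from Q(i sqrt 2) to Q(i, sqrt 2). *)

(* [(m, n, p, q)] stands for [m + n i sqrt 2 + p sqrt 2 + q i]. *)
Definition zq := (Z * Z * Z * Z)%type.

Definition zadd (x y : zq) : zq :=
  let: (a, b, c, d) := x in let: (a', b', c', d') := y in
  (a + a', b + b', c + c', d + d')%bZ.
Definition zneg (x : zq) : zq :=
  let: (a, b, c, d) := x in (- a, - b, - c, - d)%bZ.
Definition zmul (x y : zq) : zq :=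
  let: (a, b, c, d) := x in let: (a', b', c', d') := y in
  (a * a' - 2 * (b * b') + 2 * (c * c') - d * d',
   a * b' + b * a' + c * d' + d * c',
   a * c' + c * a' - b * d' - d * b',
   a * d' + d * a' + 2 * (b * c' + c * b'))%bZ.
Definition zconj (x : zq) : zq :=
  let: (a, b, c, d) := x in (a, - b, c, - d)%bZ.
Definition zz (n : Z) : zq := (n, 0, 0, 0)%bZ.
Definition zo (m n : Z) : zq := (m, n, 0, 0)%bZ.
Definition zal : zq := zo 0 1.

(** * Evaluation of Z[i, sqrt 2] in the complex numbers *)

Section Eval.
Variable C : numClosedFieldType.
Notation a := (alpha C).
Notation s2 := (sqrtC 2 : C).

Definition zr (n : Z) : C := (int_of_Z n)%:~R.

Definition ev (x : zq) : C :=
  let: (m, n, p, q) := x in zr m + zr n * a + zr p * s2 + zr q * 'i.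

Lemma zrD m n : zr (m + n)%bZ = zr m + zr n.
Proof. by rewrite /zr -intrD; congr (_%:~R); lia. Qed.
Lemma zrN m : zr (- m)%bZ = - zr m.
Proof. by rewrite /zr -intrN; congr (_%:~R); lia. Qed.
Lemma zrB m n : zr (m - n)%bZ = zr m - zr n.
Proof. by rewrite -zrN -zrD. Qed.
Lemma zrM m n : zr (m * n)%bZ = zr m * zr n.
Proof. by rewrite /zr -intrM; congr (_%:~R); lia. Qed.
Lemma zr_inj : injective zr.
Proof. by move=> m n /intr_inj h; lia. Qed.
Lemma zr_real n : zr n \is Num.real.
Proof. exact: realz. Qed.
Lemma zr_conj n : (zr n)^* = zr n.
Proof. exact/CrealP/zr_real. Qed.

Lemma i2E : 'i * 'i = -1 :> C.
Proof. by rewrite -expr2 sqrCi. Qed.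
Lemma s2E : s2 * s2 = 2.
Proof. by rewrite -expr2 sqrtCK. Qed.
Lemma alphaE : a * a = - 2.
Proof. by rewrite /alpha mulrACA i2E s2E mulN1r. Qed.
Lemma s2_real : s2 \is Num.real.
Proof. by rewrite sqrtC_real ?ler0n. Qed.
Lemma s2_conj : s2^* = s2.
Proof. exact/CrealP/s2_real. Qed.
Lemma alpha_conj : a^* = - a.
Proof. by rewrite /alpha rmorphM /= conjCi s2_conj mulNr. Qed.
Lemma s2_gt0 : 0 < s2.
Proof. by rewrite sqrtC_gt0 ltr0n. Qed.
Lemma s2_neq0 : s2 != 0.
Proof. exact: lt0r_neq0 s2_gt0. Qed.
Lemma alpha_neq0 : a != 0.
Proof. by rewrite /alpha mulf_neq0 ?neq0Ci ?s2_neq0. Qed.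

Lemma evD x y : ev (zadd x y) = ev x + ev y.
Proof.
case: x => [[[m n] p] q]; case: y => [[[m' n'] p'] q'] /=.
by rewrite !zrD; ring.
Qed.

Lemma evN x : ev (zneg x) = - ev x.
Proof. by case: x => [[[m n] p] q] /=; rewrite !zrN; ring. Qed.

Lemma ev_mul x y : ev (zmul x y) = ev x * ev y.
Proof.
case: x => [[[m n] p] q]; case: y => [[[m' n'] p'] q'].
rewrite /zmul /ev !(zrD, zrB, zrM) /alpha.
have -> : zr 2%bZ = 2 by [].
have := i2E; have := s2E; set i := 'i; set s := s2 => s2 i2.
ring: s2 i2.
Qed.

Lemma evC x : ev (zconj x) = (ev x)^*.
Proof.
case: x => [[[m n] p] q] /=.
rewrite !rmorphD !(rmorphM _ (zr _)) /= !zr_conj alpha_conj s2_conj conjCi !zrN.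
by ring.
Qed.

Lemma ev_zz n : ev (zz n) = zr n.
Proof. by rewrite /ev /zz /= /zr /=; ring. Qed.

(** The 2-adic valuation of m^2 is even and that of 2 n^2 is odd. *)
Lemma s2_irr (m n : Z) : zr m + zr n * s2 = 0 -> m = 0%bZ /\ n = 0%bZ.
Proof.
move=> h.
have {}h : zr (m * m)%bZ = zr (2 * (n * n))%bZ.
  rewrite !zrM.
  have -> : zr m = - (zr n * s2) by apply/eqP; rewrite -addr_eq0 h.
  by rewrite mulrNN mulrACA s2E mulrC.
move/zr_inj: h => h.
suff n0 : n = 0%bZ by split=> //; move: h; rewrite n0; case: (m).
have [//|n0] := eqVneq n 0%bZ; exfalso.
have {}h : (`|int_of_Z m| ^ 2 = 2 * `|int_of_Z n| ^ 2)%N.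
  by rewrite !expnS !expn0 !muln1 -!abszM; nia.
have n0' : (0 < `|int_of_Z n|)%N by move/eqP: n0 => n0; lia.
have m0' : (0 < `|int_of_Z m|)%N.
  by rewrite -(@ltn_exp2r _ _ 2) // exp0n // h muln_gt0 expn_gt0 n0'.
move/(congr1 (odd \o logn 2)): h; rewrite /= lognX lognM ?expn_gt0 ?n0' // lognX.
by rewrite (@logn_prime 2 2) // oddD !oddM /=.
Qed.

(** Adding the complex conjugate separates the real part from the imaginary part, and each vanishes
    by the irrationality of sqrt 2. Identities between complex numbers thus become decidable
    identities between integers. *)
Lemma ev_inj : injective ev.
Proof.
suff h x : ev x = 0 -> x = zz 0.
  move=> x y xy; have /h : ev (zadd x (zneg y)) = 0 by rewrite evD evN xy subrr.
  case: x {xy} => [[[m n] p] q]; case: y => [[[m' n'] p'] q'] /= [].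
  move=> *; congr (_, _, _, _); lia.
case: x => [[[m n] p] q] h.
have hc : ev (m, - n, p, - q)%bZ = 0.
  by rewrite -[LHS]/(ev (zconj (m, n, p, q))) evC h rmorph0.
have [] : m = 0%bZ /\ p = 0%bZ.
  apply: s2_irr; apply: (mulfI (_ : 2 != 0 :> C)); first by rewrite pnatr_eq0.
  rewrite mulr0 -[RHS]addr0 -{1}h -hc /= !zrN; ring.
move=> m0 p0; have [] : q = 0%bZ /\ n = 0%bZ.
  apply: s2_irr; apply: (mulfI (neq0Ci C)); rewrite mulr0 -h m0 p0 /= /alpha.
  by rewrite /zr /=; ring.
by move=> -> ->; rewrite m0 p0.
Qed.

(** Tuples nest to the left: [x.1.2] is the coefficient of sqrt 2 and [x.2] that of i. *)
Definition inO (x : zq) : bool := (x.1.2 == 0%bZ) && (x.2 == 0%bZ).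

Lemma O2_ev z : O2 z <-> exists m n : Z, z = ev (zo m n).
Proof.
split=> [[m [n ->]]|[m [n ->]]].
  exists (Z_of_int m), (Z_of_int n).
  by rewrite /ev /zo /zr !Z_of_intK /=; ring.
by exists (int_of_Z m), (int_of_Z n); rewrite /ev /zo /zr /=; ring.
Qed.

Lemma O2_inO x : inO x -> O2 (ev x).
Proof.
case: x => [[[m n] p] q] /andP[/= /eqP -> /eqP ->].
by apply/O2_ev; exists m, n.
Qed.

End Eval.
Arguments ev C x : simpl never.
Arguments zr C n : simpl never.

(** * Classes in PU(J, O_2) *)

Section ProjectiveClasses.
Variable C : numClosedFieldType.

Section AnyDimension.
Variable n : nat.
Implicit Types A B : 'M[C]_n.

Lemma val_toGL A : A \in unitmx -> glval (toGL A) = A.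
Proof. by move=> uA; rewrite /toGL -[glval _]/(val _) insubdK. Qed.

Lemma toGL_mul A B : A \in unitmx -> B \in unitmx ->
  toGL (A *m B) = (toGL A * toGL B)%g.
Proof.
move=> uA uB; apply: val_inj => /=.
by rewrite -![val _]/(glval _) !val_toGL // unitmx_mul uA.
Qed.

Lemma cls_pi (A : GL C n) : \pi_(PGL C n) A = cls (glval A).
Proof.
rewrite /cls; congr (\pi_(PGL C n) _); apply: val_inj.
by rewrite -[RHS]/(glval _) val_toGL ?glvalP.
Qed.

Lemma clsM A B : A \in unitmx -> B \in unitmx -> cls (A *m B) = (cls A * cls B)%g.
Proof.
move=> uA uB; rewrite /cls toGL_mul //.
exact: pi_PGLmul.
Qed.

Lemma cls1 : cls (1%:M : 'M[C]_n) = 1%g.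
Proof. by rewrite -[X in cls X]/(glval (GL1 C n)) -cls_pi -[RHS]/(PGL1 C n) piE. Qed.

Lemma clsV A : A \in unitmx -> cls (invmx A) = (cls A)^-1%g.
Proof.
move=> uA; apply: (mulIg (cls A)); rewrite mulVg -clsM ?unitmx_inv //.
by rewrite mulVmx // cls1.
Qed.

Lemma eq_cls A B : A \in unitmx -> B \in unitmx ->
  cls A = cls B <-> exists2 c : C, c != 0 & A = c *: B.
Proof.
move=> uA uB; split.
  move/eqmodP => /proportionalP[c]; rewrite !val_toGL // unitfE => c0 ->.
  by exists c.
move=> [c c0 AB]; apply/eqmodP/proportionalP; exists c; first by rewrite unitfE.
by rewrite !val_toGL.
Qed.

End AnyDimension.

Lemma act_cls (A : 'M[C]_3) v : A \in unitmx ->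
  act (cls A) (line v) = line (A *m v).
Proof. by move=> uA; rewrite /cls act_pi val_toGL. Qed.

Lemma line_eq (v w : 'cV[C]_3) : w != 0 -> line v = line w -> exists2 c, c != 0 & v = c *: w.
Proof.
move=> w0 vw; have /vlineP[c wc] : v \in line w by rewrite -vw /line memv_line.
exists c => //; apply: contraNneq w0 => c0; move: wc; rewrite c0 scale0r => v0.
have : w \in line v by rewrite vw /line memv_line.
by rewrite v0 /line => /vlineP[k ->]; rewrite scaler0.
Qed.

Lemma lineZ c (v : 'cV[C]_3) : c != 0 -> line (c *: v) = line v.
Proof.
move=> c0; apply/eqP; rewrite eqEsubv -!memvE; apply/andP; split.
  by rewrite memvZ // memv_line.
by rewrite -[X in X \in _](scalerK c0) memvZ // memv_line.
Qed.

(** Integrality of the inverse, which [GL3_O2] asks for, follows from these two conditions, the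
    inverse being J A^* J. *)
Definition unitaryO (A : 'M[C]_3) : Prop :=
  adjoint A *m Jmx C *m A = Jmx C /\ forall i j, O2 (A i j).

Lemma Jmx_sq : Jmx C *m Jmx C = 1%:M.
Proof.
apply/matrixP => i j; rewrite !mxE !big_ord_recl big_ord0 !mxE /=.
by case: i => [[|[|[|]]]] // ?; case: j => [[|[|[|]]]] // ?; rewrite /= ?(mulr0, mul0r, mul1r, addr0, add0r).
Qed.

Lemma adjointM m n p (A : 'M[C]_(m, n)) (B : 'M[C]_(n, p)) :
  adjoint (A *m B) = adjoint B *m adjoint A.
Proof. by rewrite /adjoint trmx_mul map_mxM. Qed.

Lemma adjointK m n (A : 'M[C]_(m, n)) : adjoint (adjoint A) = A.
Proof. by apply/matrixP => i j; rewrite !mxE conjCK. Qed.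

Lemma adjoint1 n : adjoint (1%:M : 'M[C]_n) = 1%:M.
Proof. by apply/matrixP => i j; rewrite !mxE rmorph_nat eq_sym. Qed.

Lemma adjointJ : adjoint (Jmx C) = Jmx C.
Proof.
apply/matrixP => i j; rewrite !mxE.
by case: i => [[|[|[|]]]] // ?; case: j => [[|[|[|]]]] // ?; rewrite /= ?rmorph0 ?rmorph1.
Qed.

Lemma unitary_inv (A : 'M[C]_3) : adjoint A *m Jmx C *m A = Jmx C ->
  A \in unitmx /\ invmx A = Jmx C *m adjoint A *m Jmx C.
Proof.
move=> hA.
have h : (Jmx C *m adjoint A *m Jmx C) *m A = 1%:M.
  by rewrite -!mulmxA [_ *m (_ *m A)]mulmxA hA Jmx_sq.
have [_ uA] := mulmx1_unit h.
by split=> //; rewrite -[LHS]mul1mx -h mulmxK.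
Qed.

Lemma O2_subring : [/\ O2 (0 : C), O2 (1 : C),
  (forall x y : C, O2 x -> O2 y -> O2 (x + y)),
  (forall x y : C, O2 x -> O2 y -> O2 (x * y)) & (forall x : C, O2 x -> O2 (- x))
  /\ (forall x : C, O2 x -> O2 x^* )].
Proof.
split; last split.
- by exists 0, 0; rewrite mul0r addr0.
- by exists 1, 0; rewrite mul0r addr0.
- by move=> _ _ [m [n ->]] [m' [n' ->]]; exists (m + m'), (n + n'); rewrite !intrD; ring.
- move=> _ _ [m [n ->]] [m' [n' ->]].
  exists (m * m' - 2 * n * n'), (m * n' + n * m'); rewrite !(intrD, intrM, rmorphN, intrB) /=.
  by have := alphaE C; set b := alpha C => b2; ring: b2.
- by move=> _ [m [n ->]]; exists (- m), (- n); rewrite !rmorphN /=; ring.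
- move=> _ [m [n ->]]; exists m, (- n); rewrite rmorphD (rmorphM _ n%:~R) /= alpha_conj.
  by rewrite !(CrealP _) ?realz // rmorphN /=; ring.
Qed.

Lemma O20 : O2 (0 : C). Proof. by have [] := O2_subring. Qed.
Lemma O21 : O2 (1 : C). Proof. by have [] := O2_subring. Qed.
Lemma O2D (x y : C) : O2 x -> O2 y -> O2 (x + y).
Proof. by have [_ _ h _ _] := O2_subring; apply: h. Qed.
Lemma O2M (x y : C) : O2 x -> O2 y -> O2 (x * y).
Proof. by have [_ _ _ h _] := O2_subring; apply: h. Qed.
Lemma O2N (x : C) : O2 x -> O2 (- x).
Proof. by have [_ _ _ _ [h _]] := O2_subring; apply: h. Qed.
Lemma O2C (x : C) : O2 x -> O2 x^*.
Proof. by have [_ _ _ _ [_ h]] := O2_subring; apply: h. Qed.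
Lemma O2B (x y : C) : O2 x -> O2 y -> O2 (x - y).
Proof. by move=> hx hy; apply/O2D/O2N. Qed.
Lemma O2z (m : int) : O2 (m%:~R : C).
Proof. by exists m, 0; rewrite mul0r addr0. Qed.
Lemma O2a : O2 (alpha C).
Proof. by exists 0, 1; rewrite mul1r add0r. Qed.

Lemma O2_sum (I : Type) (r : seq I) (P : pred I) (F : I -> C) :
  (forall i, P i -> O2 (F i)) -> O2 (\sum_(i <- r | P i) F i).
Proof. by move=> h; elim/big_ind: _ => //; [exact: O20|exact: O2D]. Qed.

Lemma O2_mulmx m n p (A : 'M[C]_(m, n)) (B : 'M[C]_(n, p)) :
  (forall i j, O2 (A i j)) -> (forall i j, O2 (B i j)) ->
  forall i j, O2 ((A *m B) i j).
Proof. by move=> hA hB i j; rewrite mxE; apply: O2_sum => k _; apply: O2M. Qed.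

Lemma O2_J i j : O2 (Jmx C i j).
Proof.
rewrite mxE; case: i => [[|[|[|]]]] // ?; case: j => [[|[|[|]]]] // ? /=;
  solve [exact: O20 | exact: O21].
Qed.

Lemma O2_adjoint m n (A : 'M[C]_(m, n)) :
  (forall i j, O2 (A i j)) -> forall i j, O2 (adjoint A i j).
Proof. by move=> hA i j; rewrite !mxE; apply: O2C. Qed.

Lemma unitaryO_unit A : unitaryO A -> A \in unitmx.
Proof. by case=> /unitary_inv[]. Qed.

Lemma unitaryOM A B : unitaryO A -> unitaryO B -> unitaryO (A *m B).
Proof.
move=> [hA oA] [hB oB]; split; last exact: O2_mulmx.
by rewrite adjointM -!mulmxA -[RHS]hB -[in RHS]hA !mulmxA.
Qed.

Lemma unitaryO1 : unitaryO 1%:M.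
Proof.
split; first by rewrite adjoint1 mul1mx mulmx1.
by move=> i j; rewrite mxE; case: (i == j); [exact: O21|exact: O20].
Qed.

Lemma unitaryOV A : unitaryO A -> unitaryO (invmx A).
Proof.
move=> [hA oA]; have [uA iA] := unitary_inv hA.
split; last first.
  rewrite iA; apply: O2_mulmx; last exact: O2_J.
  by apply: O2_mulmx; [exact: O2_J|exact: O2_adjoint].
have h : adjoint (invmx A) *m adjoint A = 1%:M by rewrite -adjointM mulmxV // adjoint1.
rewrite -[X in _ *m X *m _]hA -!mulmxA mulmxV // mulmx1.
by rewrite mulmxA h mul1mx.
Qed.

Lemma unitaryON A : unitaryO A -> unitaryO (- A).
Proof.
move=> [hA oA]; split; last by move=> i j; rewrite mxE; apply: O2N.
have -> : adjoint (- A) = - adjoint A by apply/matrixP => i j; rewrite !mxE rmorphN.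
by rewrite !mulNmx mulmxN opprK.
Qed.

Lemma Gamma2P g : Gamma2 g <-> exists2 A, unitaryO A & g = cls A.
Proof.
split=> [[A [UA OA] <-]|[A hA ->]].
  by exists (glval A); [split=> // i j; case: (OA i j)|rewrite cls_pi].
exists (toGL A); last by [].
have uA := unitaryO_unit hA; split; first by rewrite /UJ /= val_toGL //; case: hA.
move=> i j; rewrite val_toGL //; split; first by case: hA.
rewrite -[glval _]/(invmx (glval (toGL A))) val_toGL //.
by case: (unitaryOV hA).
Qed.

Lemma herm_unitary (A : 'M[C]_3) v w : adjoint A *m Jmx C *m A = Jmx C ->
  herm (A *m v) (A *m w) = herm v w.
Proof. by move=> hA; rewrite /herm adjointM -[in RHS]hA !mulmxA. Qed.

End ProjectiveClasses.

(** * Vectors and matrices over Z[i, sqrt 2] *)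

Definition zvec := (zq * zq * zq)%type.
Definition zmat := (zvec * zvec * zvec)%type.

Definition zdot (r c : zvec) : zq :=
  let: (r1, r2, r3) := r in let: (c1, c2, c3) := c in
  zadd (zadd (zmul r1 c1) (zmul r2 c2)) (zmul r3 c3).
Definition zmv (m : zmat) (v : zvec) : zvec :=
  let: (r1, r2, r3) := m in (zdot r1 v, zdot r2 v, zdot r3 v).
Definition ztr (m : zmat) : zmat :=
  let: ((a1, a2, a3), (b1, b2, b3), (c1, c2, c3)) := m in
  ((a1, b1, c1), (a2, b2, c2), (a3, b3, c3)).
Definition zmm (m n : zmat) : zmat :=
  let: (r1, r2, r3) := m in let: (c1, c2, c3) := ztr n in
  ((zdot r1 c1, zdot r1 c2, zdot r1 c3),
   (zdot r2 c1, zdot r2 c2, zdot r2 c3),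
   (zdot r3 c1, zdot r3 c2, zdot r3 c3)).
Definition zvmap (f : zq -> zq) (v : zvec) : zvec :=
  let: (a, b, c) := v in (f a, f b, f c).
Definition zmap (f : zq -> zq) (m : zmat) : zmat :=
  let: (a, b, c) := m in (zvmap f a, zvmap f b, zvmap f c).
Definition zadj (m : zmat) : zmat := ztr (zmap zconj m).
Definition zvadd (v w : zvec) : zvec :=
  let: (a, b, c) := v in let: (a', b', c') := w in
  (zadd a a', zadd b b', zadd c c').
Definition zmadd (m n : zmat) : zmat :=
  let: (a, b, c) := m in let: (a', b', c') := n in
  (zvadd a a', zvadd b b', zvadd c c').
Definition z1 : zmat :=
  ((zz 1, zz 0, zz 0), (zz 0, zz 1, zz 0), (zz 0, zz 0, zz 1)).
Definition zJ : zmat :=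
  ((zz 0, zz 0, zz 1), (zz 0, zz 1, zz 0), (zz 1, zz 0, zz 0)).
(* [zouter v w] is the matrix of [z |-> <z, w> v] *)
Definition zouter (v w : zvec) : zmat :=
  let: (v1, v2, v3) := v in let: (w1, w2, w3) := zvmap zconj w in
  ((zmul v1 w3, zmul v1 w2, zmul v1 w1),
   (zmul v2 w3, zmul v2 w2, zmul v2 w1),
   (zmul v3 w3, zmul v3 w2, zmul v3 w1)).
Definition zherm (v w : zvec) : zq :=
  let: (v1, v2, v3) := v in let: (w1, w2, w3) := zvmap zconj w in
  zadd (zadd (zmul w1 v3) (zmul w2 v2)) (zmul w3 v1).
Definition zdet (m : zmat) : zq :=
  let: ((a1, a2, a3), (b1, b2, b3), (c1, c2, c3)) := m in
  zadd (zadd (zmul a1 (zadd (zmul b2 c3) (zneg (zmul b3 c2))))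
             (zmul a2 (zadd (zmul b3 c1) (zneg (zmul b1 c3)))))
       (zmul a3 (zadd (zmul b1 c2) (zneg (zmul b2 c1)))).
Definition zall (P : pred zq) (m : zmat) : bool :=
  let: ((a1, a2, a3), (b1, b2, b3), (c1, c2, c3)) := m in
  [&& [&& P a1, P a2 & P a3], [&& P b1, P b2 & P b3] & [&& P c1, P c2 & P c3]].
Definition zunitary (m : zmat) : bool :=
  zall inO m && (zmm (zmm (zadj m) zJ) m == zJ).

Ltac mx33 := apply/matrixP; let i := fresh "i" in let j := fresh "j" in
  move=> i j; rewrite ?mxE ?big_ord_recl ?big_ord0 ?mxE;
  case: i => [[|[|[|]]]] // ?; case: j => [[|[|[|]]]] // ?; rewrite /= ?mxE.
Ltac cv3 := apply/matrixP; let i := fresh "i" in let j := fresh "j" in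
  move=> i j; rewrite ?mxE ?big_ord_recl ?big_ord0 ?mxE;
  case: i => [[|[|[|]]]] // ?; rewrite /= ?mxE.

Section EvalMatrices.
Variable C : numClosedFieldType.
Notation ev := (@ev C).

Definition evV (v : zvec) : 'cV[C]_3 :=
  let: (a, b, c) := v in vec3 (ev a) (ev b) (ev c).
Definition evM (m : zmat) : 'M[C]_3 :=
  let: ((a1, a2, a3), (b1, b2, b3), (c1, c2, c3)) := m in
  mx_of_rows 3 [:: [:: ev a1; ev a2; ev a3]; [:: ev b1; ev b2; ev b3];
    [:: ev c1; ev c2; ev c3]].

Lemma ev0 : ev (zz 0) = 0. Proof. by rewrite ev_zz. Qed.
Lemma ev1 : ev (zz 1) = 1. Proof. by rewrite ev_zz. Qed.

Lemma evM_mul m n : evM (zmm m n) = evM m *m evM n.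
Proof.
case: m => [[[[a1 a2] a3] [[b1 b2] b3]] [[c1 c2] c3]].
case: n => [[[[d1 d2] d3] [[e1 e2] e3]] [[f1 f2] f3]].
by mx33; rewrite !(evD, ev_mul) addr0 addrA.
Qed.

Lemma evM_mulV m v : evV (zmv m v) = evM m *m evV v.
Proof.
case: m => [[[[a1 a2] a3] [[b1 b2] b3]] [[c1 c2] c3]]; case: v => [[v1 v2] v3].
by cv3; rewrite !(evD, ev_mul) addr0 addrA.
Qed.

Lemma evM_adj m : evM (zadj m) = adjoint (evM m).
Proof.
case: m => [[[[a1 a2] a3] [[b1 b2] b3]] [[c1 c2] c3]].
by mx33; rewrite evC.
Qed.

Lemma evM_add m n : evM (zmadd m n) = evM m + evM n.
Proof.
case: m => [[[[a1 a2] a3] [[b1 b2] b3]] [[c1 c2] c3]].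
case: n => [[[[d1 d2] d3] [[e1 e2] e3]] [[f1 f2] f3]].
by mx33; rewrite evD.
Qed.

Lemma evM_scale x m : evM (zmap (zmul x) m) = ev x *: evM m.
Proof.
case: m => [[[[a1 a2] a3] [[b1 b2] b3]] [[c1 c2] c3]].
by mx33; rewrite ev_mul.
Qed.

Lemma evV_scale x v : evV (zvmap (zmul x) v) = ev x *: evV v.
Proof. by case: v => [[v1 v2] v3]; cv3; rewrite ev_mul. Qed.

Lemma evM_neg m : evM (zmap zneg m) = - evM m.
Proof.
case: m => [[[[a1 a2] a3] [[b1 b2] b3]] [[c1 c2] c3]].
by mx33; rewrite evN.
Qed.

Lemma evM1 : evM z1 = 1%:M.
Proof. by mx33; (exact: ev0 || exact: ev1). Qed.

Lemma evMJ : evM zJ = Jmx C.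
Proof. by mx33; (exact: ev0 || exact: ev1). Qed.

Lemma evM_inj : injective evM.
Proof.
case=> [[[[a1 a2] a3] [[b1 b2] b3]] [[c1 c2] c3]].
case=> [[[[d1 d2] d3] [[e1 e2] e3]] [[f1 f2] f3]] /matrixP h.
have := (h 0 0, h 0 1, h 0 2); have := (h 1 0, h 1 1, h 1 2).
have := (h 2 0, h 2 1, h 2 2); rewrite !mxE /=.
by move=> [[/ev_inj-> /ev_inj->] /ev_inj->] [[/ev_inj-> /ev_inj->] /ev_inj->]
          [[/ev_inj-> /ev_inj->] /ev_inj->].
Qed.

Lemma hermE (v w : 'cV[C]_3) :
  herm v w = (w 0 0)^* * v 2 0 + (w 1 0)^* * v 1 0 + (w 2 0)^* * v 0 0.
Proof.
rewrite /herm !mxE !big_ord_recl !big_ord0 !mxE !big_ord_recl !big_ord0 !mxE /=.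
rewrite !(mulr0, mulr1, addr0, add0r).
have -> : lift ord0 (lift ord0 ord0) = 2 :> 'I_3 by apply: val_inj.
have -> : lift ord0 ord0 = 1 :> 'I_3 by apply: val_inj.
by ring.
Qed.

Lemma ev_herm v w : ev (zherm v w) = herm (evV v) (evV w).
Proof.
case: v => [[v1 v2] v3]; case: w => [[w1 w2] w3].
by rewrite hermE !mxE /= !(evD, ev_mul, evC).
Qed.

Lemma evM_outer v w : evM (zouter v w) = evV v *m (adjoint (evV w) *m Jmx C).
Proof.
case: v => [[v1 v2] v3]; case: w => [[w1 w2] w3].
mx33; rewrite ?big_ord_recl ?big_ord0 !mxE /= !(ev_mul, evC);
  by rewrite ?(mulr0, mulr1, addr0, add0r).
Qed.

Lemma det33 (A : 'M[C]_3) :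
  \det A = A 0 0 * (A 1 1 * A 2 2 - A 1 2 * A 2 1)
         + A 0 1 * (A 1 2 * A 2 0 - A 1 0 * A 2 2)
         + A 0 2 * (A 1 0 * A 2 1 - A 1 1 * A 2 0).
Proof.
rewrite (expand_det_row _ 0) !big_ord_recl big_ord0 /cofactor.
rewrite !(expand_det_row _ 0) !big_ord_recl !big_ord0 /cofactor !det_mx11 !mxE /=.
have e1 k : lift (lift ord0 ord0) k = (if k == 0 then 0 else 2) :> 'I_3.
  by case: k => [[|[|]]] // ?; apply: val_inj.
have e2 k : lift (lift ord0 (lift ord0 ord0)) k = (if k == 0 then 0 else 1) :> 'I_3.
  by case: k => [[|[|]]] // ?; apply: val_inj.
have e0 k : lift ord0 k = (if k == 0 then 1 else 2) :> 'I_3.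
  by case: k => [[|[|]]] // ?; apply: val_inj.
rewrite !e1 !e2 !e0 /= !(expr0, expr1, expr2, addn0, mul1r) /=.
by rewrite /bump /= ?(expr0, expr1, expr2, addn0, addn1, addn2) /=; ring.
Qed.

Lemma ev_det m : ev (zdet m) = \det (evM m).
Proof.
case: m => [[[[a1 a2] a3] [[b1 b2] b3]] [[c1 c2] c3]].
by rewrite det33 !mxE /= !(evD, ev_mul, evN).
Qed.

Lemma O2_evM m : zall inO m -> forall i j, O2 (evM m i j).
Proof.
case: m => [[[[a1 a2] a3] [[b1 b2] b3]] [[c1 c2] c3]].
move=> /and3P[/and3P[? ? ?] /and3P[? ? ?] /and3P[? ? ?]] [[|[|[|]]]] // ? [[|[|[|]]]] // ?; rewrite mxE /=; exact: O2_inO.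
Qed.

Lemma zunitaryP m : zunitary m -> unitaryO (evM m).
Proof.
move=> /andP[mO /eqP mJ]; split; last exact: O2_evM.
by rewrite -evMJ -evM_adj -!evM_mul mJ.
Qed.

Lemma unitaryO_ev A : unitaryO A -> exists2 m, A = evM m & zunitary m.
Proof.
move=> [hA oA].
have h i j : {x | inO x & A i j = ev x}.
  apply: cid2; have /O2_ev[m [n ->]] := oA i j; by exists (zo m n).
pose e i j := s2val (h i j).
pose m : zmat := ((e 0 0, e 0 1, e 0 2), (e 1 0, e 1 1, e 1 2), (e 2 0, e 2 1, e 2 2)).
have Am : A = evM m.
  apply/matrixP => i j; rewrite mxE.
  case: i => [[|[|[|]]]] // p; case: j => [[|[|[|]]]] // q;
   rewrite /= /e -(s2valP' (h _ _)); congr (A _ _); exact: val_inj.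
exists m => //; apply/andP; split.
  by rewrite /m /= /e; apply/and3P; split; apply/and3P; split; exact: (s2valP (h _ _)).
by apply/eqP/evM_inj; rewrite !evM_mul evM_adj evMJ -Am.
Qed.

End EvalMatrices.

(** * The Hermitian form *)

Section HermitianForm.
Variable C : numClosedFieldType.
Implicit Types (u v w z : 'cV[C]_3) (A : 'M[C]_3).

Lemma hermDl u v w : herm (u + v) w = herm u w + herm v w.
Proof. by rewrite /herm mulmxDr mxE. Qed.
Lemma hermZl c v w : herm (c *: v) w = c * herm v w.
Proof. by rewrite /herm -scalemxAr mxE. Qed.
Lemma hermNl v w : herm (- v) w = - herm v w.
Proof. by rewrite -scaleN1r hermZl mulN1r. Qed.
Lemma hermBl u v w : herm (u - v) w = herm u w - herm v w.
Proof. by rewrite hermDl hermNl. Qed.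
Lemma herm0l w : herm 0 w = 0.
Proof. by rewrite -(scale0r w) hermZl mul0r. Qed.
Lemma hermC v w : (herm v w)^* = herm w v.
Proof. by rewrite !hermE !rmorphD !rmorphM /= !conjCK; ring. Qed.
Lemma hermDr u v w : herm w (u + v) = herm w u + herm w v.
Proof. by rewrite -hermC hermDl rmorphD /= !hermC. Qed.
Lemma hermZr c v w : herm w (c *: v) = c^* * herm w v.
Proof. by rewrite -hermC hermZl rmorphM /= !hermC. Qed.
Lemma hermNr v w : herm w (- v) = - herm w v.
Proof. by rewrite -hermC hermNl rmorphN /= hermC. Qed.
Lemma hermBr u v w : herm w (u - v) = herm w u - herm w v.
Proof. by rewrite hermDr hermNr. Qed.
Lemma herm0r w : herm w 0 = 0.
Proof. by rewrite -hermC herm0l rmorph0. Qed.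
Definition hermlin := (hermBl, hermBr, hermDl, hermDr, hermZl, hermZr, hermNl, hermNr).

Lemma herm_real v : herm v v \is Num.real.
Proof. by rewrite CrealE hermC. Qed.
Lemma herm_eq0C v w : herm v w = 0 -> herm w v = 0.
Proof. by move=> h; rewrite -hermC h rmorph0. Qed.

Lemma outer_mulE v w z : (v *m (adjoint w *m Jmx C)) *m z = herm z w *: v.
Proof.
rewrite -mulmxA [adjoint w *m Jmx C *m z]mx11_scalar mul_mx_scalar.
by rewrite /herm.
Qed.

Lemma herm_nondeg w : (forall z, herm z w = 0) -> w = 0.
Proof.
move=> h; apply/matrixP => i j; rewrite [j]ord1 mxE.
apply: (inv_inj (@conjCK C)); rewrite rmorph0.
have h0 := h (vec3 1 0 0); have h1 := h (vec3 0 1 0); have h2 := h (vec3 0 0 1).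
move: h0 h1 h2; rewrite !hermE !mxE /= !(mulr0, mulr1, addr0, add0r) => h0 h1 h2.
case: i => [[|[|[|]]]] // p.
- by rewrite -h2; congr ((w _ _)^*); exact: val_inj.
- by rewrite -h1; congr ((w _ _)^*); exact: val_inj.
- by rewrite -h0; congr ((w _ _)^*); exact: val_inj.
Qed.

Lemma herm_ltr0_neq0 v : herm v v < 0 -> v != 0.
Proof. by apply: contraTneq => ->; rewrite herm0l ltxx. Qed.
(* 2 <v,v> = |v_0 + v_2|^2 + 2 |v_1|^2 - |v_0 - v_2|^2, and the reverse
   Cauchy-Schwarz inequality follows from Lagrange's identity. *)
Lemma herm_perp_gt0 v z : herm v v < 0 -> herm z v = 0 -> z != 0 -> 0 < herm z z.
Proof.
move=> vneg zv z0.
pose vp := v 0 0 + v 2 0; pose vm := v 0 0 - v 2 0.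
pose zp := z 0 0 + z 2 0; pose zm := z 0 0 - z 2 0.
pose S := zp * zp^* + 2 * (z 1 0 * (z 1 0)^*).
pose T := vp * z 1 0 - v 1 0 * zp.
have hzv : vm^* * zm = vp^* * zp + 2 * (v 1 0)^* * z 1 0.
  apply/eqP; rewrite -subr_eq0; apply/eqP; rewrite -[RHS](mulr0 (- 2 : C)) -zv hermE.
  by rewrite /vm /zm /vp /zp !(rmorphB, rmorphD) /=; ring.
have hzv' : vm * zm^* = vp * zp^* + 2 * v 1 0 * (z 1 0)^*.
  have aux (x y p q r t : C) : x^* * y = p^* * q + 2 * r^* * t ->
      x * y^* = p * q^* + 2 * r * t^*.
    move/(congr1 Num.conj); rewrite rmorphD !rmorphM /= !conjCK => ->.
    by rewrite rmorphD rmorph1.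
  exact: aux hzv.
have key : vm * vm^* * (2 * herm z z) = - 2 * herm v v * S + 2 * (T * T^*).
  have -> : vm * vm^* * (2 * herm z z) =
    vm * vm^* * S - (vm^* * zm) * (vm * zm^*).
    rewrite hermE /S /zp /zm !(rmorphB, rmorphD) /=; ring.
  rewrite hzv hzv' hermE /S /T /zp /vp /vm !(rmorphB, rmorphD, rmorphM) /=; ring.
have S0 : 0 <= S by rewrite addr_ge0 ?(mulr_ge0 (ler0n _ 2) (mul_conjC_ge0 _)) ?mul_conjC_ge0.
have T0 : 0 <= T * T^* by rewrite mul_conjC_ge0.
have vm0 : 0 < vm * vm^*.
  have -> : vm * vm^* = vp * vp^* + 2 * (v 1 0 * (v 1 0)^*) - 2 * herm v v.
    by rewrite hermE /vm /vp !(rmorphB, rmorphD) /=; ring.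
  rewrite -mulNr ltr_wpDl ?addr_ge0 ?(mulr_ge0 (ler0n _ 2) (mul_conjC_ge0 _)) ?mul_conjC_ge0 //.
  by rewrite mulNr oppr_gt0 pmulr_rlt0 ?ltr0n.
have Sgt : 0 < S.
  rewrite lt0r S0 andbT; apply: contra_neq z0 => S00.
  have /andP[/eqP a0 /eqP b0] :
      (zp * zp^* == 0) && (2 * (z 1 0 * (z 1 0)^*) == 0).
    by rewrite -paddr_eq0 ?(mulr_ge0 (ler0n _ 2) (mul_conjC_ge0 _)) ?mul_conjC_ge0 // -/S S00.
  have zp0 : zp = 0 by apply/eqP; rewrite -mul_conjC_eq0 a0.
  have z10 : z 1 0 = 0.
    by apply/eqP; rewrite -mul_conjC_eq0; move/eqP: b0; rewrite mulf_eq0 pnatr_eq0.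
  have /eqP : vm^* * zm = 0 by rewrite hzv zp0 z10 !mulr0 addr0.
  rewrite mulf_eq0 conjC_eq0 => /orP[/eqP vm00|/eqP zm0].
    by move: vm0; rewrite vm00 mul0r ltxx.
  have h2 : 2 != 0 :> C by rewrite pnatr_eq0.
  have z00 : z 0 0 = 0.
    by apply: (mulfI h2); rewrite mulr0 -[RHS](addr0 0) -{1}zp0 -zm0 /zp /zm; ring.
  have z20 : z 2 0 = 0.
    by apply: (mulfI h2); rewrite mulr0 -[RHS](subr0 0) -{1}zp0 -zm0 /zp /zm; ring.
  apply/matrixP => i j; rewrite [j]ord1 mxE.
  case: i => [[|[|[|]]]] // p; [rewrite -z00|rewrite -z10|rewrite -z20];
    congr (z _ _); exact: val_inj.
have : 0 < vm * vm^* * (2 * herm z z).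
  rewrite key ltr_wpDr ?(mulr_ge0 (ler0n _ 2) T0) // -mulrA mulNr oppr_gt0.
  by rewrite pmulr_rlt0 ?ltr0n // nmulr_rlt0.
by rewrite pmulr_rgt0 // pmulr_rgt0 // ltr0n.
Qed.

(** Removing from (1, 0, -1), of norm -2, its component along the positive [w] can only lower the
    norm. *)
Lemma neg_perp_exists w : 0 < herm w w -> exists2 n, herm n n < 0 & herm n w = 0.
Proof.
move=> w0; pose n := vec3 1 0 (- 1) : 'cV[C]_3.
have nn : herm n n = - 2 by rewrite hermE !mxE /= rmorphN rmorph1; ring.
have wn0 := lt0r_neq0 w0.
exists (n - (herm n w / herm w w) *: w); last by rewrite !hermlin mulfVK // subrr.
have -> : herm (n - (herm n w / herm w w) *: w) (n - (herm n w / herm w w) *: w)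
   = - 2 - herm n w * (herm n w)^* / herm w w.
  rewrite !hermlin rmorphM fmorphV /= (CrealP (herm_real w)) nn -(hermC n w).
  by field.
rewrite -opprD oppr_lt0 ltr_pwDl ?ltr0n // divr_ge0 ?mul_conjC_ge0 //; exact: ltW.
Qed.

(** With N = -<n,n>, U = <u,u> and e = N / (N + U) < 1, every t <= e satisfies t^2 U <= t U < N. Any
    direction orthogonal to [n] can thus be followed for a while through negative vectors. *)
Lemma neg_add_small n u : herm n n < 0 -> herm u n = 0 ->
  exists2 e : C, 0 < e & forall t, 0 <= t <= e -> herm (n + t *: u) (n + t *: u) < 0.
Proof.
move=> n0 un; have nu := herm_eq0C un.
have [->|u0] := eqVneq u 0.
  by exists 1; rewrite ?ltr01 // => t _; rewrite scaler0 addr0.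
have U0 := herm_perp_gt0 n0 un u0; set U := herm u u in U0 *.
pose N := - herm n n; have N0 : 0 < N by rewrite oppr_gt0.
exists (N / (N + U)); first by rewrite divr_gt0 // addr_gt0.
move=> t /andP[t0 te]; rewrite !hermlin un nu (CrealP (ger0_real t0)) -/U.
rewrite !mulr0 addr0 add0r -[herm n n]opprK -/N addrC subr_lt0.
have e1 : N / (N + U) < 1 by rewrite ltr_pdivrMr ?addr_gt0 // mul1r ltrDl.
have t1 : t < 1 by apply: le_lt_trans te e1.
apply: le_lt_trans (_ : t * U < N).
  by rewrite ler_piMl ?mulr_ge0 // ltW.
apply: le_lt_trans (_ : N / (N + U) * U < N); first by rewrite ler_pM2r.
by rewrite mulrAC ltr_pdivrMr ?addr_gt0 // ltr_pM2l // ltrDr.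
Qed.

(** The complement of [w] is spanned by two negative vectors n and n + e u, so a linear property of
    it can be checked on points of the mirror. *)
Lemma mirror_spans w (P : 'cV[C]_3 -> Prop) : 0 < herm w w ->
  (forall x y c, P x -> P y -> P (c *: x + y)) ->
  (forall v, herm v v < 0 -> herm v w = 0 -> P v) ->
  forall z, herm z w = 0 -> P z.
Proof.
move=> w0 Plin Pneg z zw.
have [n n0 nw] := neg_perp_exists w0.
have nn0 := ltr0_neq0 n0.
pose b := herm z n / herm n n; pose u := z - b *: n.
have un : herm u n = 0 by rewrite !hermlin mulfVK // subrr.
have uw : herm u w = 0 by rewrite !hermlin zw nw mulr0 subr0.
have zE : z = b *: n + u by rewrite addrC subrK.
clearbody u; have [e e0 he] := neg_add_small n0 un.
have Pe : P (n + e *: u).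
  apply: Pneg; first by apply: he; rewrite lexx ltW.
  by rewrite !hermlin nw uw mulr0 addr0.
have Pn := Pneg n n0 nw.
have Peu : P (e *: u).
  have -> : e *: u = (- 1) *: n + (n + e *: u) by rewrite scaleN1r addKr.
  exact: Plin.
have Pu : P (e^-1 *: (e *: u) + 0 *: n).
  apply: (Plin) => //; have -> : 0 *: n = (-1) *: n + n by rewrite scale0r scaleN1r addNr.
  exact: Plin.
have -> : z = b *: n + (e^-1 *: (e *: u) + 0 *: n).
  by rewrite zE scalerA mulVf ?lt0r_neq0 // scale1r scale0r addr0.
exact: Plin.
Qed.

(** Fixing lines gives one eigenvalue for each point of the mirror; the work lies in showing that
    they all agree. *)
Lemma mirror_eigen w A : 0 < herm w w -> A \in unitmx ->
  (forall x, mirror w x -> act (cls A) x = x) ->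
  exists c, forall z, herm z w = 0 -> A *m z = c *: z.
Proof.
move=> w0 uA hA.
have hv v : herm v v < 0 -> herm v w = 0 -> exists c, A *m v = c *: v.
  move=> v0 vw; have : act (cls A) (line v) = line v by apply: hA; exists v.
  rewrite act_cls // => /(line_eq (herm_ltr0_neq0 v0))[c _ ->].
  by exists c.
have [n n0 nw] := neg_perp_exists w0.
have [c Anc] := hv n n0 nw; exists c => z zw.
have nn0 := ltr0_neq0 n0.
pose b := herm z n / herm n n; pose u := z - b *: n.
have un : herm u n = 0 by rewrite !hermlin mulfVK // subrr.
have uw : herm u w = 0 by rewrite !hermlin zw nw mulr0 subr0.
have zE : z = b *: n + u by rewrite addrC subrK.
clearbody u; suff Au : A *m u = c *: u.
  by rewrite zE mulmxDr -scalemxAr Anc Au scalerDr !scalerA mulrC.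
have [->|u0] := eqVneq u 0; first by rewrite mulmx0 scaler0.
have uu := lt0r_neq0 (herm_perp_gt0 n0 un u0).
have nu := herm_eq0C un.
have [e e0 he] := neg_add_small n0 un.
have e0' := lt0r_neq0 e0.
have step t : 0 < t <= e -> exists2 d, t * herm (A *m u) n = (d - c) * herm n n &
    herm (A *m u) u = d * herm u u.
  move=> /andP[t0 te].
  have [] := hv (n + t *: u).
  - by apply: he; rewrite te ltW.
  - by rewrite !hermlin nw uw mulr0 addr0.
  move=> d; rewrite mulmxDr Anc -scalemxAr scalerDr scalerA => h.
  exists d.
    move/(congr1 (fun y : 'cV[C]_3 => herm y n)): h; rewrite !hermlin un !mulr0 addr0 => h.
    by rewrite mulrBl -h; ring.
  move/(congr1 (fun y : 'cV[C]_3 => herm y u)): h; rewrite !hermlin nu !mulr0 !add0r => h.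
  by apply: (mulfI (lt0r_neq0 t0)); rewrite h; ring.
have [d d1 d2] := step e (introT andP (conj e0 (lexx e))).
have [|d' d1' d2'] := step (e / 2).
  by rewrite divr_gt0 ?ltr0n //= ler_pdivrMr ?ltr0n // ler_peMr ?ler1n // ltW.
(* The product with [u] shows that both parameters have the same eigenvalue; the product with [n]
   then makes [t * herm (A *m u) n] the same for [e] and [e / 2], hence zero. *)
have dd : d = d' by apply: (mulIf uu); rewrite -d2 d2'.
have An0 : herm (A *m u) n = 0.
  have h : e / 2 * herm (A *m u) n = e * herm (A *m u) n by rewrite d1 d1' dd.
  apply: (mulfI e0'); rewrite mulr0.
  have -> : e * herm (A *m u) n = 2 * (e * herm (A *m u) n - e / 2 * herm (A *m u) n).
    by field.
  by rewrite h subrr mulr0.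
have dc : d = c.
  apply/eqP; rewrite -subr_eq0; have /eqP := d1.
  by rewrite An0 mulr0 eq_sym mulf_eq0 (negbTE nn0) orbF.
have [] := hv (n + e *: u).
- by apply: he; rewrite lexx ltW.
- by rewrite !hermlin nw uw mulr0 addr0.
move=> d'' h; have := h; move/(congr1 (fun y : 'cV[C]_3 => herm y n)).
rewrite mulmxDr Anc -scalemxAr !hermlin An0 un !mulr0 !addr0 => /(mulIf nn0) cd.
move: h; rewrite mulmxDr Anc -scalemxAr scalerDr -cd => /addrI.
by rewrite scalerA mulrC -scalerA => /(scalerI e0').
Qed.

Lemma mirror_inj w w' : 0 < herm w w -> mirror w = mirror w' -> exists c, w' = c *: w.
Proof.
move=> w0 ww; have wn0 := lt0r_neq0 w0.
have hz z : herm z w = 0 -> herm z w' = 0.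
  apply: (mirror_spans (P := fun z => herm z w' = 0)) => //.
    by move=> x y c hx hy; rewrite !hermlin hx hy mulr0 addr0.
  move=> v v0 vw; have : mirror w (line v) by exists v.
  rewrite ww => -[v' [v'0 /(line_eq (herm_ltr0_neq0 v'0))[k _ ->] v'w]].
  by rewrite hermZl v'w mulr0.
exists (herm w' w / herm w w); apply/subr0_eq/herm_nondeg => z.
have := hz (z - (herm z w / herm w w) *: w); rewrite !hermlin mulfVK // subrr.
move=> /(_ erefl) /subr0_eq ->.
rewrite rmorphM fmorphV /= (CrealP (herm_real w)) hermC; field.
exact: wn0.
Qed.

Lemma mirrorZ c w : c != 0 -> mirror (c *: w) = mirror w.
Proof.
move=> c0; apply/seteqP; split=> x [v [v0 xv vw]]; exists v; split=> //.
  by apply/eqP; move/eqP: vw; rewrite hermZr mulf_eq0 conjC_eq0 (negbTE c0).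
by rewrite hermZr vw mulr0.
Qed.

Lemma mirror_act A w : adjoint A *m Jmx C *m A = Jmx C ->
  [set act (cls A) x | x in mirror w] = mirror (A *m w).
Proof.
move=> hA; have [uA iA] := unitary_inv hA.
apply/seteqP; split=> [_ [x [v [v0 -> vw]] <-]|x [v [v0 -> vw]]].
  by exists (A *m v); rewrite !herm_unitary ?act_cls.
exists (line (invmx A *m v)); last by rewrite act_cls // mulKVmx.
exists (invmx A *m v); split=> //.
  by rewrite -(herm_unitary _ _ hA) mulKVmx.
by rewrite -(herm_unitary _ _ hA) mulKVmx.
Qed.

End HermitianForm.

(** * Finite groups given by lists of matrices *)

Section Generated.
Variable gT : groupType.
Implicit Types (A B S : set gT).

Lemma generated_subgroup A : subgroup (generated A).
Proof.
split=> [S [[S1 _ _] _]|x y hx hy S [SS AS]|x hx S [SS AS]] //.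
  by case: (SS) => _ SM _; apply: SM; [exact: hx|exact: hy].
by case: (SS) => _ _ SV; apply: SV; exact: hx.
Qed.

Lemma sub_generated A : A `<=` generated A.
Proof. by move=> x Ax S [_]; apply. Qed.

Lemma generated_sub A S : subgroup S -> A `<=` S -> generated A `<=` S.
Proof. by move=> SS AS x; apply. Qed.

End Generated.

Lemma card_image_seq (T : eqType) (U : Type) (f : T -> U) (l : seq T) :
  uniq l -> {in l &, injective f} -> [set f x | x in [set` l]] #= `I_(size l).
Proof.
case: l => [_ _|x0 l ul fi].
  rewrite (_ : [set _ | _ in _] = set0); last by rewrite -subset0 => ? [].
  by rewrite /= II0 card_eq00.
have -> : [set f x | x in [set` x0 :: l]] =
          [set f (nth x0 (x0 :: l) i) | i in `I_(size (x0 :: l))].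
  apply/seteqP; split=> [_ [x xl <-]|_ [i il <-]].
    exists (index x (x0 :: l)); first by rewrite /mkset index_mem.
    by rewrite nth_index.
  by exists (nth x0 (x0 :: l) i) => //; apply: mem_nth.
apply: inj_card_eq => i j; rewrite !inE => il jl /fi.
by rewrite !mem_nth // => /(_ erefl erefl)/eqP; rewrite nth_uniq // => /eqP.
Qed.

(** Products of an element of [acc] with at most [n] generators on the right; starting from the
    identity in a finite group, these reach the inverses as well once [n] is large. *)
Fixpoint zgen (n : nat) (gens acc : seq zmat) : seq zmat :=
  if n is k.+1 then
    zgen k gens (undup (acc ++ [seq zmm x g | x <- acc, g <- gens]))
  else acc.

Section UnitaryLists.
Variable C : numClosedFieldType.
Notation evM := (@evM C).
Notation evV := (@evV C).

Lemma O2_norm1 (c : C) : O2 c -> c * c^* = 1 -> c = 1 \/ c = -1.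
Proof.
move=> [m [n ->]]; rewrite rmorphD (rmorphM _ n%:~R) /= alpha_conj.
rewrite !(CrealP _) ?realz // => h.
have {}h : m * m + 2 * (n * n) = 1.
  apply: (@intr_inj C); rewrite !(intrD, intrM) -[RHS]h.
  by have := alphaE C; set b := alpha C => b2; ring: b2.
have [n0 m1] : n = 0 /\ (m = 1 \/ m = -1) by nia.
by rewrite n0 mul0r addr0; case: m1 => ->; [left|right].
Qed.

(** The scalar matrix c = A B^-1 is itself integral and unitary. *)
Lemma unitaryO_prop (A B : 'M[C]_3) c : unitaryO A -> unitaryO B -> A = c *: B ->
  c = 1 \/ c = -1.
Proof.
move=> hA hB AB.
have [uB _] := unitary_inv (proj1 hB).
have hI := unitaryOM hA (unitaryOV hB).
rewrite AB -scalemxAl mulmxV // in hI.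
case: hI => hJ hO; apply: O2_norm1.
  by have := hO 0 0; rewrite !mxE mulr1.
have /matrixP/(_ 0 2) := hJ; rewrite !scalemx1.
have -> : adjoint (c%:M : 'M[C]_3) = c^*%:M.
  by apply/matrixP => i j; rewrite !mxE rmorphMn eq_sym.
rewrite mul_scalar_mx -scalemxAl mul_mx_scalar scalerA !mxE /= mulr1 => <-.
by rewrite mulrC.
Qed.

Lemma cls_zinj m n : zunitary m -> zunitary n -> zdet m = zz 1 -> zdet n = zz 1 ->
  cls (evM m) = cls (evM n) -> m = n.
Proof.
move=> /(zunitaryP C) um /(zunitaryP C) un dm dn.
move/eq_cls => /(_ (unitaryO_unit um) (unitaryO_unit un))[c c0 mn].
apply: (@evM_inj C); case: (unitaryO_prop um un mn) => c1; rewrite c1 in mn.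
  by rewrite mn scale1r.
have := ev_det C m; rewrite mn detZ -ev_det dm dn ev1 mulr1 => /eqP.
rewrite -subr_eq0 !exprS expr0 mulr1 !mulN1r opprK opprK.
by rewrite (_ : 1 + 1 = 2%:R) // pnatr_eq0.
Qed.

Lemma unitaryO_det (A : 'M[C]_3) : unitaryO A -> \det A = 1 \/ \det A = -1.
Proof.
move=> [hA oA]; apply: O2_norm1.
  by rewrite det33; do ![exact: oA|apply: O2B|apply: O2D|apply: O2M].
have dJ : \det (Jmx C) != 0.
  by have [] := mulmx1_unit (Jmx_sq C); rewrite unitmxE unitfE.
have := congr1 (fun M => \det M) hA; rewrite !det_mulmx.
have -> : \det (adjoint A) = (\det A)^* by rewrite /adjoint det_map_mx det_tr.
by rewrite mulrAC -[RHS]mul1r => /(mulIf dJ) <-; rewrite mulrC.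
Qed.

Lemma clsN (A : 'M[C]_3) : A \in unitmx -> cls (- A) = cls A.
Proof.
move=> uA; apply/eq_cls => //; last by exists (-1); rewrite ?oppr_eq0 ?oner_eq0 // scaleN1r.
by rewrite -scaleN1r unitmxZ // unitrN1.
Qed.

Lemma Gamma2_zmat g : Gamma2 g ->
  exists m, [/\ g = cls (evM m), zunitary m & zdet m = zz 1].
Proof.
move/Gamma2P => [A hA ->].
wlog dA : A hA / \det A = 1.
  case: (unitaryO_det hA) => dA; first exact.
  move=> /(_ (- A)); rewrite clsN ?unitaryO_unit //; apply; first exact: unitaryON.
  by rewrite -scaleN1r detZ dA !exprS expr0; ring.
have [m Am um] := unitaryO_ev hA; exists m; split=> //; first by rewrite Am.
by apply: (@ev_inj C); rewrite ev_det -Am dA ev1.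
Qed.

Definition zgroup (l : seq zmat) : set (PGL C 3) := [set cls (evM m) | m in [set` l]].

Definition zdet1 (m : zmat) : bool := zunitary m && (zdet m == zz 1).

Lemma zdet1_unit m : zdet1 m -> evM m \in unitmx.
Proof. by move=> /andP[um _]; apply/unitaryO_unit/zunitaryP. Qed.

Lemma card_zgroup l : all zdet1 l -> uniq l -> zgroup l #= `I_(size l).
Proof.
move=> /allP hl ul; apply: card_image_seq => // m n ml nl.
by have /andP[? /eqP ?] := hl _ ml; have /andP[? /eqP ?] := hl _ nl; apply: cls_zinj.
Qed.

Lemma zgen_sub (S : set (PGL C 3)) n gens acc : subgroup S ->
  all zdet1 gens -> zgroup gens `<=` S -> zgroup acc `<=` S -> all zdet1 acc ->
  zgroup (zgen n gens acc) `<=` S.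
Proof.
move=> SS /allP hg gS; elim: n acc => [//|n IH] acc aS ha0.
have /allP ha := ha0; rewrite /=; apply: IH.
  move=> _ [m mz <-]; move: mz; rewrite /= mem_undup mem_cat => /orP[ma|/allpairsP[[x g] /= [xa gg ->]]].
    by apply: aS; exists m.
  rewrite evM_mul clsM ?(zdet1_unit (ha _ xa)) ?(zdet1_unit (hg _ gg)) //.
  by case: SS => _ SM _; apply: SM; [apply: aS; exists x|apply: gS; exists g].
apply/(@allP _ zdet1) => m; rewrite mem_undup mem_cat.
move=> /orP[ma|/allpairsP[[x g] /= [xa gg ->]]]; first exact: ha.
have /andP[ux /eqP dx] := ha _ xa; have /andP[ug /eqP dg] := hg _ gg.
apply/andP; split.
  have := unitaryOM (zunitaryP C ux) (zunitaryP C ug); rewrite -evM_mul => hxg.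
  by have [m' /evM_inj -> ->] := unitaryO_ev hxg.
apply/eqP/(@ev_inj C); rewrite ev_det evM_mul det_mulmx -!ev_det dx dg ev1.
by rewrite mulr1.
Qed.

Definition zgroupb (l : seq zmat) : bool :=
  [&& all zdet1 l, z1 \in l & all (fun x => all (fun y => zmm x y \in l) l) l
   && all (fun x => has (fun y => zmm y x == z1) l) l].

Lemma zgroup_subgroup l : zgroupb l -> subgroup (zgroup l).
Proof.
move=> /and3P[/allP hl l1 /andP[/allP lM /allP lV]]; split.
- by exists z1 => //; rewrite evM1 cls1.
- move=> _ _ [x xl <-] [y yl <-]; exists (zmm x y).
    by apply: (allP (lM _ xl)).
  by rewrite evM_mul clsM ?zdet1_unit ?hl.
- move=> _ [x xl <-]; have /hasP[y yl /eqP yx] := lV _ xl; exists y => //.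
  apply: (mulIg (cls (evM x))); rewrite mulVg -clsM ?zdet1_unit ?hl //.
  by rewrite -evM_mul yx evM1 cls1.
Qed.

Lemma generated_zgroup n gens l : zgroupb l ->
  all (fun g => g \in l) gens -> all (fun m => m \in zgen n gens [:: z1]) l ->
  generated (zgroup gens) = zgroup l.
Proof.
move=> gl /allP gensl /allP lgen; have /and3P[/allP hl l1 _] := gl.
apply/seteqP; split.
  apply: generated_sub; first exact: zgroup_subgroup.
  by move=> _ [g gg <-]; exists g => //; apply: gensl.
have hgens : all zdet1 gens by apply/allP => g /gensl /hl.
have [h1 _ _] := generated_subgroup (zgroup gens).
move=> _ [m ml <-].
apply: (zgen_sub (n := n) (acc := [:: z1]) (gens := gens)) => //.
- exact: generated_subgroup.
- exact: sub_generated.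
- by move=> _ [m' + <-]; rewrite /= inE => /eqP ->; rewrite evM1 cls1.
- by exists m => //; apply: lgen.
Qed.

End UnitaryLists.

(** * Reflections and their mirrors *)

(** Every index other than 1 and 2 stands for the third base vector. *)
Definition zbase (j : nat) : zvec :=
  if j is 1%N then (zz 0, zz 1, zz 0)
  else if j is 2%N then (zz 1, zz (- 1), zz 0) else (zz 1, zz 0, zz 1).

Definition zre (x : zq) : Z := x.1.1.1.

(* [m + 1 = (2 / N) <., w> w] with [N = <w, w>] a nonzero integer. *)
Definition zpolar (m : zmat) (w : zvec) : bool :=
  let N := zherm w w in
  [&& N == zz (zre N), zre N != 0%bZ &
      zmap (zmul N) (zmadd m z1) == zmap (zmul (zz 2)) (zouter w w)].

Definition zentries (m : zmat) : seq zq :=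
  let: ((a1, a2, a3), (b1, b2, b3), (c1, c2, c3)) := m in
  [:: a1; a2; a3; b1; b2; b3; c1; c2; c3].

(* some 3 x 3 minor of the entries of [1, m, m^2] does not vanish *)
Definition zindep (m : zmat) : bool :=
  let t := zip (zip (zentries z1) (zentries m)) (zentries (zmm m m)) in
  has (fun p => has (fun q => has (fun r => zdet (p, q, r) != zz 0) t) t) t.

(** Three certificates: [m] is the identity, or its minimal polynomial has degree 3, or it fixes a
    negative vector of [p] and is -1 on the complement, so that its fixed point in the complex
    hyperbolic plane is isolated. *)
Definition nonreflb (p : seq zvec) (m : zmat) : bool :=
  [|| m == z1, zindep m |
      has (fun v => zpolar m v && (zre (zherm v v) <? 0)%bZ) p].

(* a reflection, a polar vector, and a witness that the latter is in the orbit
   of one of the three base vectors *)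
Definition rdata := (zmat * zvec * zmat * nat)%type.

Definition rdata_ok (r : rdata) : bool :=
  let: (m, w, t, j) := r in
  [&& zpolar m w, (0 <? zre (zherm w w))%bZ, zunitary t & zmv t (zbase j) == w]
  && (j \in [:: 1; 2; 3])%N.

Section Reflections.
Variable C : numClosedFieldType.
Notation evM := (@evM C).
Notation evV := (@evV C).
Notation ev := (@ev C).
Implicit Types (u v w z : 'cV[C]_3) (A : 'M[C]_3).

Lemma exists_perp2 (p q : 'cV[C]_3) :
  exists r : 'cV[C]_3, [/\ r != 0, herm r p = 0 & herm r q = 0].
Proof.
pose B : 'M[C]_(3, 1 + 1) := row_mx (adjoint p *m Jmx C)^T (adjoint q *m Jmx C)^T.
have kB : kermx B != 0.
  by rewrite kermx_eq0 /row_free; have := rank_leq_col B; case: eqP => // ->.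
pose r := (nz_row (kermx B))^T.
have r0 : r != 0.
  by rewrite /r -(inj_eq trmx_inj) trmxK trmx0 nz_row_eq0.
have /sub_kermxP : (nz_row (kermx B) <= kermx B)%MS by exact: nz_row_sub.
rewrite mul_mx_row -[0]row_mx0 => /eq_row_mx[hp hq].
exists r; split=> //.
  by rewrite /herm -[_ *m r]trmxK trmx_mul trmxK hp trmx0 mxE.
by rewrite /herm -[_ *m r]trmxK trmx_mul trmxK hq trmx0 mxE.
Qed.

Lemma perp_sub_line w w' : herm w w != 0 ->
  (forall z, herm z w = 0 -> herm z w' = 0) -> exists c, w' = c *: w.
Proof.
move=> wn0 hz.
exists (herm w' w / herm w w); apply/subr0_eq/herm_nondeg => z.
have := hz (z - (herm z w / herm w w) *: w); rewrite !hermlin mulfVK // subrr.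
move=> /(_ erefl) /subr0_eq ->.
rewrite rmorphM fmorphV /= (CrealP (herm_real w)) hermC; field.
exact: wn0.
Qed.

(** Minus the reflection with polar vector [w]: it is 1 on the line of [w] and -1 on the complement,
    so its determinant is 1. *)
Definition polar A w := forall z, A *m z = - z + (2 * (herm z w / herm w w)) *: w.

Lemma polar_sq A w : herm w w != 0 -> polar A w -> A *m A = 1%:M.
Proof.
move=> w0 hA; apply/trmx_inj/row_matrixP => i; rewrite -!tr_col; congr (_^T).
rewrite !colE -mulmxA mul1mx; set z := delta_mx i 0.
rewrite !hA !hermlin opprD opprK -addrA -scaleNr -scalerDl.
rewrite [X in X *: w](_ : _ = 0) ?scale0r ?addr0 //; field; exact: w0.
Qed.

Lemma polar_reflection A w : 0 < herm w w -> polar A w -> A \in unitmx ->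
  reflection_with_mirror (cls A) (mirror w).
Proof.
move=> w0 hA uA; have wn0 := lt0r_neq0 w0.
split.
- rewrite -cls1 => /eq_cls-/(_ uA (unitmx1 _ _))[c c0 Ac].
  have [r [r0 rw _]] := exists_perp2 w w.
  have := hA r; rewrite rw mul0r mulr0 scale0r addr0 Ac -scalemxAl mul1mx => h1.
  have := hA w; rewrite divff // Ac -scalemxAl mul1mx mulr1 => h2.
  have c1 : c = -1.
    apply/eqP; rewrite -subr_eq0 opprK; have /eqP : (c + 1) *: r = 0.
      by rewrite scalerDl scale1r h1 addNr.
    by rewrite scaler_eq0 (negbTE r0) orbF.
  have /eqP : w + w = 0.
    by move: h2; rewrite c1 scaleN1r -[LHS]addr0 => /addrI h3; rewrite -mulr2n -scaler_nat -h3.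
  rewrite -mulr2n -scaler_nat scaler_eq0 pnatr_eq0 /= => /eqP w00.
  by rewrite w00 herm0l ltxx in w0.
- exists 2%N => //; rewrite expgS expg1 -clsM // (polar_sq wn0 hA); exact: cls1.
- by exists w.
- move=> _ [v [v0 -> vw]]; rewrite act_cls // hA vw mul0r mulr0 scale0r addr0.
  by rewrite -scaleN1r lineZ // oppr_eq0 oner_eq0.
Qed.

(** A common perpendicular of [w] and [w'] is an eigenvector for -1, so the scalar by which [A] acts
    on the complement of [w'] is -1. The (-1)-eigenspace of [A] is the complement of [w], and the
    two complements coincide. *)
Lemma polar_mirror A w M : herm w w \is Num.real -> herm w w != 0 -> polar A w ->
  A \in unitmx -> reflection_with_mirror (cls A) M -> 0 < herm w w /\ M = mirror w.
Proof.
move=> wr w0 hA uA [_ _ [w' w'0 ->] hM].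
have [c hc] := mirror_eigen w'0 uA hM.
have [r [r0 rw rw']] := exists_perp2 w w'.
have c1 : c = -1.
  have := hc r rw'; rewrite hA rw mul0r mulr0 scale0r addr0 => /eqP.
  rewrite -scaleN1r -subr_eq0 -scalerBl scaler_eq0 (negbTE r0) orbF subr_eq0.
  by move/eqP.
have wn0 : w != 0 by apply: contraNneq w0 => ->; rewrite herm0l.
have [k wk] : exists k, w = k *: w'.
  apply: perp_sub_line; first exact: lt0r_neq0.
  move=> z zw'; have /eqP := hc z zw'; rewrite hA c1 scaleN1r -subr_eq0 addrC addrA.
  rewrite opprK subrr add0r scaler_eq0 (negbTE wn0) orbF !mulf_eq0 pnatr_eq0.
  by rewrite invr_eq0 (negbTE w0) orbF => /eqP.
have k0 : k != 0 by apply: contraNneq wn0 => k0; rewrite wk k0 scale0r.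
split; last by rewrite wk mirrorZ.
rewrite wk !hermlin mulrA mulr_gt0 // lt0r mul_conjC_ge0 mul_conjC_eq0 k0.
by [].
Qed.

Lemma zpolarP m (w : zvec) : zpolar m w -> polar (evM m) (evV w) /\ herm (evV w) (evV w) != 0.
Proof.
move=> /and3P[/eqP hN N0 /eqP hm].
have Nr : ev (zherm w w) = herm (evV w) (evV w) :> C by exact: ev_herm.
have Nn0 : herm (evV w) (evV w) != 0.
  rewrite -Nr hN ev_zz; apply: contraNneq N0 => h; apply/eqP/(@zr_inj C).
  by rewrite h.
split=> // z.
have := congr1 evM hm; rewrite !evM_scale evM_add evM1 evM_outer Nr ev_zz => h.
have := congr1 (fun X => X *m z) h; rewrite -!scalemxAl mulmxDl mul1mx outer_mulE.
rewrite !scalerA => h'; apply: (scalerI Nn0); rewrite -[evM m *m z](addrK z).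
rewrite scalerBr h' scalerDr scalerN addrC scalerA; congr (_ + _ *: _).
have -> : zr C 2%bZ = 2 by [].
field; exact: Nn0.
Qed.

Lemma zindepP m : zindep m -> forall b c, evM (zmm m m) <> b *: evM m + c *: 1%:M.
Proof.
move=> + b c h; rewrite -evM1 in h.
have hz p : p \in zip (zip (zentries z1) (zentries m)) (zentries (zmm m m)) ->
    ev p.2 = b * ev p.1.2 + c * ev p.1.1 :> C.
  move/matrixP: h; case: m => [[[[a1 a2] a3] [[b1 b2] b3]] [[c1 c2] c3]].
  case: (zmm _ _) => [[[[d1 d2] d3] [[e1 e2] e3]] [[f1 f2] f3]] h.
  have := (h 0 0, h 0 1, h 0 2); have := (h 1 0, h 1 1, h 1 2).
  have := (h 2 0, h 2 1, h 2 2); rewrite !mxE /=.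
  move=> [[h1 h2] h3] [[h4 h5] h6] [[h7 h8] h9].
  by rewrite !inE => /or3P[/eqP->|/eqP->|/or4P[/eqP->|/eqP->|/eqP->|/or4P[/eqP->|/eqP->|/eqP->|/eqP->]]].
case/hasP => [[[p1 p2] p3]] /hz/= hp /hasP[[[q1 q2] q3]] /hz/= hq /hasP[[[r1 r2] r3]] /hz/= hr.
move/eqP; apply; apply: (@ev_inj C); rewrite !(evD, ev_mul, evN) hp hq hr ev0; ring.
Qed.

(** A matrix that fixes a mirror pointwise is a rank one perturbation of a scalar, hence a root of a
    quadratic polynomial. *)
Lemma zindep_nonrefl m M : evM m \in unitmx -> zindep m ->
  ~ reflection_with_mirror (cls (evM m)) M.
Proof.
move=> um im [_ _ [w w0 ->] hM].
have [c hc] := mirror_eigen w0 um hM; have wn0 := lt0r_neq0 w0.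
set A := evM m in um hM hc *.
pose y := (herm w w)^-1 *: (A *m w - c *: w).
have hA z : A *m z = c *: z + herm z w *: y.
  pose k := herm z w / herm w w.
  have zE : z = k *: w + (z - k *: w) by rewrite addrC subrK.
  rewrite [in LHS]zE mulmxDr -scalemxAr hc; last by rewrite !hermlin mulfVK // subrr.
  by rewrite /y scalerA -/k !scalerBr !scalerA [c * k]mulrC addrCA.
(* The quadratic polynomial is (X - c)(X - c - <y,w>). *)
clearbody y; apply: (zindepP im (b := 2 * c + herm y w) (c := - (c * (c + herm y w)))).
rewrite evM_mul -/A; apply/trmx_inj/row_matrixP => i; rewrite -!tr_col; congr (_^T).
rewrite !colE -mulmxA !mulmxDl -!scalemxAl mul1mx; set z := delta_mx i 0.
rewrite [A *m z]hA mulmxDr -!scalemxAr [A *m z]hA [A *m y]hA !scalerDr !scalerA addrA.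
rewrite [RHS]addrAC -!addrA -!scalerDl [RHS]addrA -scalerDl.
congr (_ *: _ + _ *: _); ring.
Qed.

Lemma nonreflP p m M : zdet1 m -> nonreflb p m -> ~ reflection_with_mirror (cls (evM m)) M.
Proof.
move=> dm; have um := zdet1_unit C dm.
case/or3P => [/eqP->|im|/hasP[v _ /andP[vm vneg]]].
- by rewrite evM1 cls1 => -[].
- exact: zindep_nonrefl.
have /and3P[/eqP hN _ _] := vm.
have [hp v0] := zpolarP vm.
move/(polar_mirror (herm_real _) v0 hp um) => [+ _].
rewrite -ev_herm hN ev_zz /zr ltr0z; lia.
Qed.

Lemma rdata_reflection m (w : zvec) t j M : zdet1 m -> rdata_ok (m, w, t, j) ->
  reflection_with_mirror (cls (evM m)) M <-> M = mirror (evV w).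
Proof.
move=> dm /andP[/and4P[wm wpos _ _] _]; have um := zdet1_unit C dm.
have /and3P[/eqP hN _ _] := wm; have [hp w0] := zpolarP wm.
have wp : 0 < herm (evV w) (evV w) by rewrite -ev_herm hN ev_zz /zr ltr0z; lia.
split=> [/(polar_mirror (herm_real _) w0 hp um)[]//|->].
exact: polar_reflection.
Qed.

Lemma O2_trace (x : C) : O2 x -> exists k : int, x + x^* = (2 * k)%:~R.
Proof.
move=> [m [n ->]]; exists m; rewrite rmorphD (rmorphM _ n%:~R) /= alpha_conj.
by rewrite !(CrealP _) ?realz // intrM; ring.
Qed.

(** The first row of [A] is isotropic, so |A_01|^2 is minus the trace of an element of O_2, which is
    even. This separates the orbits of (0, 1, 0) and (1, -1, 0), which norms cannot do. *)
Lemma unitaryO_01 A : unitaryO A -> A 0 1 <> 1 /\ A 0 1 <> -1.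
Proof.
move=> [hA oA]; have [uA iA] := unitary_inv hA.
have h : A *m Jmx C *m adjoint A = Jmx C.
  have h1 : A *m (Jmx C *m adjoint A *m Jmx C) = 1%:M by rewrite -iA mulmxV.
  by rewrite -[RHS]mul1mx -h1 -!mulmxA Jmx_sq mulmx1.
have /matrixP/(_ 0 0) := h; rewrite !mxE !big_ord_recl !big_ord0 !mxE.
rewrite !big_ord_recl !big_ord0 !mxE /= !(mulr0, mulr1, addr0, add0r).
have -> : lift ord0 (lift ord0 ord0) = 2 :> 'I_3 by apply: val_inj.
have -> : lift ord0 ord0 = 1 :> 'I_3 by apply: val_inj.
move=> hh.
have [k hk] := O2_trace (O2M (oA 0 2) (O2C (oA 0 0))).
rewrite rmorphM /= conjCK in hk.
have {}hh : A 0 1 * (A 0 1)^* + (2 * k)%:~R = 0.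
  by rewrite -hk -hh; ring.
split=> e; move: hh; rewrite e ?rmorphN ?rmorph1 ?mulrNN mulr1 => /eqP;
  rewrite -[1 + _]/(1%:~R + _) -intrD intr_eq0; lia.
Qed.

Lemma base_orbit_aux A c : unitaryO A -> A *m evV (zbase 1) = c *: evV (zbase 2) ->
  c = 1 \/ c = -1 -> False.
Proof.
move=> hA /matrixP/(_ 0 0); rewrite !mxE !big_ord_recl big_ord0 !mxE /= !ev_zz.
rewrite !(mulr0, mulr1, addr0, add0r).
have -> : lift ord0 ord0 = 1 :> 'I_3 by apply: val_inj.
by move=> h [] e; have [h1 h2] := unitaryO_01 hA; [apply: h1|apply: h2]; rewrite h e.
Qed.

Lemma base_O2 A i j c : unitaryO A -> A *m evV (zbase i) = c *: evV (zbase j) -> O2 c.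
Proof.
move=> [_ oA] h.
have oz n : O2 (zr C n) by apply: O2z.
have ob : forall k l, O2 (evV (zbase i) k l).
  move=> k l; case: i {h} => [|[|[|i]]]; rewrite mxE /= ?ev_zz;
    by case: k => [[|[|[|]]]] // ? /=; rewrite ?ev_zz.
have oc := O2_mulmx oA ob; rewrite h in oc.
have := (oc 0 0, oc 1 0); case: j {h oc} => [|[|[|j]]] /=; rewrite !mxE /= !ev_zz;
  by rewrite /zr /= !mulr1 => -[].
Qed.

(** Both [c] and its inverse are integral, so [c] is a sign and [A] preserves the norms 1, 1, 2 of
    the base vectors; only the first two could be identified, and [base_orbit_aux] excludes that. *)
Lemma base_orbit A i j c : (i \in [:: 1; 2; 3])%N -> (j \in [:: 1; 2; 3])%N ->
  unitaryO A -> A *m evV (zbase i) = c *: evV (zbase j) -> i = j.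
Proof.
move=> hi hj hA h.
have oc := base_O2 hA h.
have b0 k : evV (zbase k) != 0.
  apply/eqP => /(congr1 (fun v => (v 0 0, v 1 0))).
  by case: k => [|[|[|k]]]; rewrite !mxE /= !ev_zz /zr /= => -[] // /eqP; rewrite ?oner_eq0.
have [uA iA] := unitary_inv (proj1 hA).
have c0 : c != 0.
  apply: contraNneq (b0 i) => c0; rewrite -[evV _](mulKmx uA) h c0 scale0r.
  by rewrite mulmx0.
have h' : invmx A *m evV (zbase j) = c^-1 *: evV (zbase i).
  by rewrite -[evV (zbase i)](mulKmx uA) h -scalemxAr scalerA mulVf // scale1r.
have oc' := base_O2 (unitaryOV hA) h'.
have c1 : c = 1 \/ c = -1.
  move: oc oc' => [m [n cE]] [m' [n' cE']].
  apply: O2_norm1; first by exists m, n.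
  have nE (x y : int) : (x%:~R + y%:~R * alpha C) * (x%:~R + y%:~R * alpha C)^* = (x * x + 2 * (y * y))%:~R.
    rewrite rmorphD (rmorphM _ y%:~R) /= alpha_conj !(CrealP _) ?realz //.
    rewrite !(intrD, intrM); have := alphaE C; set b := alpha C => b2; ring: b2.
  have : (c * c^*) * (c^-1 * c^-1^*) = 1.
    by rewrite mulrACA -rmorphM /= mulfV // rmorph1 mulr1.
  rewrite cE' cE !nE -intrM => /eqP; rewrite -[1]/(1%:~R) eqr_int => /eqP hh.
  have X0 : 0 <= m * m + 2 * (n * n) by nia.
  congr (_%:~R); move: X0 hh; move: (m * m + _) (m' * m' + _) => X Y.
  by move=> X0 hh; have Y0 : 0 < Y; nia.
have hn : herm (evV (zbase i)) (evV (zbase i)) = herm (evV (zbase j)) (evV (zbase j)).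
  rewrite -(herm_unitary _ _ (proj1 hA)) h !hermlin.
  case: c1 => ->; first by rewrite rmorph1 !mul1r.
  by rewrite rmorphN rmorph1 !mulN1r opprK.
rewrite -!ev_herm in hn; have {}hn := ev_inj hn.
move: hi hj hn h h'; rewrite !inE.
move=> /or3P[]/eqP-> /or3P[]/eqP-> //= _ h h'; exfalso.
  exact: base_orbit_aux hA h c1.
apply: (base_orbit_aux (unitaryOV hA) h').
by case: c1 => ->; rewrite ?invrN invr1; [left|right].
Qed.

End Reflections.

Lemma uniq_map_inj (T U : eqType) (f : T -> U) (s : seq T) :
  uniq (map f s) -> {in s &, injective f}.
Proof.
elim: s => //= x s IH /andP[xs us] y z; rewrite !inE.
move=> /orP[/eqP->|ys] /orP[/eqP->|zs] // e; last exact: IH.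
  by case/negP: xs; rewrite e map_f.
by case/negP: xs; rewrite -e map_f.
Qed.

(** * Mirrors of a listed group and their orbits *)

Section MirrorCounts.
Variable C : numClosedFieldType.
Notation evM := (@evM C).
Notation evV := (@evV C).
Notation ev := (@ev C).

Definition rmx (r : rdata) : zmat := r.1.1.1.
Definition rvec (r : rdata) : zvec := r.1.1.2.

(** Every element of [l] is either in the table of reflections [rl] or carries a certificate that it
    is none. *)
Definition refl_table (l : seq zmat) (pv : seq zvec) (rl : seq rdata) : bool :=
  [&& all zdet1 l, all rdata_ok rl, all (fun m => m \in l) (map rmx rl),
      uniq (map rmx rl) & all (fun m => (m \in map rmx rl) || nonreflb pv m) l].

Section Table.
Variables (l : seq zmat) (pv : seq zvec) (rl : seq rdata).
Hypothesis ok : refl_table l pv rl.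

Lemma table_zdet1 m : m \in l -> zdet1 m.
Proof. by case/and5P: ok => /allP h _ _ _ _; apply: h. Qed.

Lemma table_mem r : r \in rl -> rmx r \in l /\ rdata_ok r.
Proof.
case/and5P: ok => _ /allP h1 /allP h2 _ _ rr.
by split; [apply/h2/map_f|apply: h1].
Qed.

Lemma table_reflection m M : m \in l ->
  reflection_with_mirror (cls (evM m)) M <->
  exists r, [/\ r \in rl, rmx r = m & M = mirror (evV (rvec r))].
Proof.
move=> ml; have dm := table_zdet1 ml; split; last first.
  move=> [[[[m' w] t] j] [rr /= mm ->]]; rewrite /rmx /= in mm; subst m'; have [_ ro] := table_mem rr.
  by apply/(rdata_reflection _ dm ro).
move=> hM; case/and5P: (ok) => _ _ _ _ /allP/(_ _ ml)/orP[/mapP[r rr mr]|nr].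
  exists r; split=> //; have [_ ro] := table_mem rr.
  case: r rr mr ro => [[[m' w] t] j] rr mm ro; rewrite /rmx /= in mm; subst m.
  by apply/(rdata_reflection _ dm ro).
by have := nonreflP dm nr hM.
Qed.

Lemma table_reflections :
  @zgroup C l `&` @complex_reflection C = @zgroup C (map rmx rl).
Proof.
apply/seteqP; split=> [_ [[m ml <-] [M /(table_reflection M ml)[r [rr <- _]]]]|_ [m + <-]].
  by exists (rmx r) => //; apply: map_f.
move=> /= /mapP[r rr ->]; have [ml _] := table_mem rr; split; first by exists (rmx r).
by exists (mirror (evV (rvec r))); apply/table_reflection => //; exists r.
Qed.

Lemma rdata_polar m w t j : rdata_ok (m, w, t, j) ->
  polar (evM m) (evV w) /\ 0 < herm (evV w) (evV w).
Proof.
move=> /andP[/and4P[wm wpos _ _] _]; have /and3P[/eqP hN _ _] := wm.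
split; first by case: (zpolarP C wm).
by rewrite -ev_herm hN ev_zz /zr ltr0z; lia.
Qed.

(** A mirror determines its polar vector up to a scalar, and the matrix attached to a polar vector
    is unchanged by rescaling. *)
Lemma rvec_inj : {in rl &, injective (fun r => mirror (evV (rvec r)) : set (line_point C))}.
Proof.
move=> r r' rr rr' hM.
have [ml ro] := table_mem rr; have [ml' ro'] := table_mem rr'.
case/and5P: (ok) => _ _ _ um _; apply: (uniq_map_inj um) => //.
case: r rr hM ml ro => [[[m w] t] j] rr hM ml ro.
case: r' rr' hM ml' ro' => [[[m' w'] t'] j'] rr' hM ml' ro'.
rewrite /rmx /rvec /= in hM ml ml' *.
have [pm wp] := rdata_polar ro; have [pm' wp'] := rdata_polar ro'.
have [c wc] := mirror_inj wp hM.
have c0 : c != 0.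
  by apply: contraTneq wp' => c0; rewrite wc c0 scale0r herm0l ltxx.
apply: (@evM_inj C); apply/trmx_inj/row_matrixP => i; rewrite -!tr_col; congr (_^T).
rewrite !colE pm pm' wc !hermlin scalerA; congr (_ + _ *: _).
by field; rewrite ?(lt0r_neq0 wp) ?conjC_eq0 ?c0.
Qed.

(** Each entry carries a matrix that moves a base vector to its polar vector, so its mirror lies in
    the orbit named by the label; [base_orbit] shows that it lies in no other. *)
Lemma table_mirrors i : (i \in [:: 1; 2; 3])%N ->
  mirrors_in_orbit (@zgroup C l) (evV (zbase i)) #= `I_(count (fun r => r.2 == i) rl).
Proof.
move=> hi.
rewrite (_ : mirrors_in_orbit _ _ = [set (mirror (evV (rvec r)) : set (line_point C)) | r in
   [set` [seq r <- rl | r.2 == i]]]).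
  rewrite -size_filter; apply: card_image_seq.
    by case/and5P: ok => _ _ _ /map_uniq um _; apply: filter_uniq.
  by move=> r r'; rewrite !mem_filter => /andP[_ rr] /andP[_ rr']; apply: rvec_inj.
apply/seteqP; split.
  move=> _ [[_ [m ml <-] /(table_reflection _ ml)[r [rr mr ->]]] [g /Gamma2P[A hA ->] hM]].
  move: hM; rewrite mirror_act; last by case: hA.
  move=> hM; exists r => //=; rewrite mem_filter rr andbT.
  have [_ ro] := table_mem rr; case: r rr mr ro hM => [[[m' w] t] j] rr /= mm ro hM.
  have [_ wp] := rdata_polar ro; have [c wc] := mirror_inj wp hM.
  case/andP: ro => /and4P[_ _ ut /eqP tw] hj.
  have [ut' it] := unitary_inv (proj1 (zunitaryP C ut)).
  apply/eqP/esym/(@base_orbit C (invmx (evM t) *m A) _ _ c) => //.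
    exact: unitaryOM (unitaryOV (zunitaryP C ut)) hA.
  by rewrite -mulmxA wc /rvec /= -scalemxAr -tw evM_mulV mulKmx.
move=> _ [r + <-]; rewrite /= mem_filter => /andP[/eqP ri rr].
have [ml ro] := table_mem rr; split.
  by exists (cls (evM (rmx r))); [exists (rmx r)|apply/table_reflection => //; exists r].
case: r rr ri ml ro => [[[m w] t] j] rr /= ji ml /andP[/and4P[_ _ ut /eqP tw] hj].
subst j; have ut' := zunitaryP C ut; exists (cls (evM t)).
  by apply/Gamma2P; exists (evM t).
rewrite mirror_act; last by case: ut'.
by rewrite /rvec /= -tw evM_mulV.
Qed.

End Table.

(** Conjugation by [A] transports the isotropy group together with its reflections. *)
Lemma act_mirrors (A : 'M[C]_3) v w0 M : unitaryO A ->
  mirrors_in_orbit (isotropy (line v)) w0 M ->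
  mirrors_in_orbit (isotropy (line (A *m v))) w0 [set act (cls A) x | x in M].
Proof.
move=> hA [[g [Gg gv] [g1 [n n0 gn] [w w_gt0 Mw] gM]] [k Gk Mk]].
have uA := unitaryO_unit hA.
case/Gamma2P: Gg => B hB gE; case/Gamma2P: Gk => K hK kE.
have uB := unitaryO_unit hB; have uK := unitaryO_unit hK.
subst g k; split; last first.
  exists (cls (A *m K)); first by apply/Gamma2P; exists (A *m K) => //; exact: unitaryOM.
  rewrite Mk (mirror_act _ (proj1 hK)) (mirror_act _ (proj1 hA)).
  by rewrite (mirror_act _ (proj1 (unitaryOM hA hK))) mulmxA.
pose D := A *m B *m invmx A.
have hD : unitaryO D by apply: unitaryOM (unitaryOV hA); exact: unitaryOM.
have uD := unitaryO_unit hD.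
have DE : cls D = (cls B ^ (cls A)^-1)%g.
  by rewrite /D !clsM ?clsV ?unitmx_inv ?unitmx_mul ?uA ?uB // conjgE invgK mulgA.
have fixD x : act (cls B) (line x) = line x -> act (cls D) (line (A *m x)) = line (A *m x).
  rewrite !act_cls // => h; rewrite /D -!mulmxA mulKmx //.
  rewrite -(act_cls _ uA) h.
  by rewrite act_cls.
exists (cls D).
  by split; [apply/Gamma2P; exists D|exact: fixD].
split.
- rewrite DE => /(congr1 (fun y => (y ^ cls A)%g)); rewrite -conjgM mulVg conjg1 conj1g.
  exact: g1.
- by exists n => //; rewrite DE -conjXg gn conj1g.
- exists (A *m w); first by rewrite herm_unitary //; case: hA.
  by rewrite Mw mirror_act //; case: hA.
- move=> _ [y My <-]; move: (gM y My); move: My; rewrite Mw => -[x [x0 -> xw]] h.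
  by rewrite act_cls //; apply: fixD.
Qed.

Lemma mirrors_orbit_card (A : 'M[C]_3) v w0 : unitaryO A ->
  mirrors_in_orbit (isotropy (line (A *m v))) w0 #= mirrors_in_orbit (isotropy (line v)) w0.
Proof.
move=> hA; have uA := unitaryO_unit hA.
have actK (B : 'M[C]_3) w : unitaryO B ->
    [set act (cls (invmx B)) x | x in [set act (cls B) x | x in mirror w]] = mirror w.
  move=> hB; rewrite (mirror_act _ (proj1 hB)) (mirror_act _ (proj1 (unitaryOV hB))).
  by rewrite mulKmx // unitaryO_unit.
rewrite (_ : mirrors_in_orbit (isotropy (line (A *m v))) w0 =
  [set [set act (cls A) x | x in M] | M in mirrors_in_orbit (isotropy (line v)) w0]).
  apply: inj_card_eq => M M'; rewrite !inE => -[_ [k /Gamma2P[K hK ->] ->]] [_ [k' /Gamma2P[K' hK' ->] ->]].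
  rewrite (mirror_act _ (proj1 hK)) (mirror_act _ (proj1 hK')) => h.
  by rewrite -(actK A _ hA) h actK.
apply/seteqP; split=> [M hM|_ [M hM <-]]; last exact: act_mirrors.
have := act_mirrors (unitaryOV hA) hM; rewrite mulKmx // => hM'.
exists [set act (cls (invmx A)) x | x in M] => //.
case: hM => _ [k /Gamma2P[K hK ->] ->]; rewrite (mirror_act _ (proj1 hK)).
rewrite -[RHS](actK (invmx A) _ (unitaryOV hA)).
by rewrite invmxK.
Qed.

Lemma orbit2P (v w : 'cV[C]_3) : orbit2 (line v) (line w) ->
  exists2 A, unitaryO A & line w = line (A *m v).
Proof.
move=> [g /Gamma2P[A hA ->] <-]; exists A => //.
by rewrite act_cls // unitaryO_unit.
Qed.

(** The three counts are invariants of the orbit of a point, since group elements carry mirrors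
    bijectively to mirrors of the same orbit. *)
Lemma mirror_counts_inj (v w x : 'cV[C]_3) j1 j2 j3 k1 k2 k3 :
  orbit2 (line v) (line x) -> orbit2 (line w) (line x) ->
  mirror_counts (isotropy (line v)) j1 j2 j3 ->
  mirror_counts (isotropy (line w)) k1 k2 k3 -> [/\ j1 = k1, j2 = k2 & j3 = k3].
Proof.
move=> /orbit2P[A hA xA] /orbit2P[B hB xB] [h1 h2 h3] [h1' h2' h3'].
have key w0 j k : mirrors_in_orbit (isotropy (line v)) w0 #= `I_j ->
    mirrors_in_orbit (isotropy (line w)) w0 #= `I_k -> j = k.
  move=> hj hk; apply/card_eq_II; apply: card_eq_trans (card_esym hj) _.
  apply: card_eq_trans (card_esym (mirrors_orbit_card v w0 hA)) _.
  by rewrite -xA xB; apply: card_eq_trans (mirrors_orbit_card w w0 hB) _.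
by split; [apply: key h1 h1'|apply: key h2 h2'|apply: key h3 h3'].
Qed.

End MirrorCounts.

(** * Enumeration of isotropy groups *)

(* the Hermitian form with Gram matrix [H], antilinear in the first argument *)
Definition zform (H : zmat) (v w : zvec) : zq := zdot (zvmap zconj v) (zmv H w).

Arguments zform : simpl never.

Lemma zform_expand (a d f b1 b2 c1 c2 e1 e2 x1 y1 x2 y2 x3 y3 : Z) :
  (zre (zform (((a, 0, 0, 0), (b1, b2, 0, 0), (c1, c2, 0, 0)),
             ((b1, - b2, 0, 0), (d, 0, 0, 0), (e1, e2, 0, 0)),
             ((c1, - c2, 0, 0), (e1, - e2, 0, 0), (f, 0, 0, 0)))
             ((x1, y1, 0, 0), (x2, y2, 0, 0), (x3, y3, 0, 0))
             ((x1, y1, 0, 0), (x2, y2, 0, 0), (x3, y3, 0, 0))) =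
  a * (x1 * x1 + 2 * y1 * y1) + d * (x2 * x2 + 2 * y2 * y2)
     + f * (x3 * x3 + 2 * y3 * y3)
     + 2 * (x1 * (b1 * x2 - 2 * b2 * y2) + 2 * y1 * (b1 * y2 + b2 * x2))
     + 2 * (x1 * (c1 * x3 - 2 * c2 * y3) + 2 * y1 * (c1 * y3 + c2 * x3))
     + 2 * (x2 * (e1 * x3 - 2 * e2 * y3) + 2 * y2 * (e1 * y3 + e2 * x3)))%bZ.
Proof.
cbv [zform zdot zmv zvmap zconj zmul zadd zre fst snd]; lia.
Qed.

(* completing the square twice *)
Lemma third_coordinate_bound (a d f b1 b2 c1 c2 e1 e2 x1 y1 x2 y2 x3 y3 : Z) :
  (let D := a * d - (b1 * b1 + 2 * b2 * b2) in
   let F := a * f - (c1 * c1 + 2 * c2 * c2) in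
   let E1 := a * e1 - (b1 * c1 + 2 * b2 * c2) in
   let E2 := a * e2 - (b1 * c2 - b2 * c1) in
   0 <= D ->
   (D * F - (E1 * E1 + 2 * E2 * E2)) * (x3 * x3 + 2 * y3 * y3) <=
   D * a * (a * (x1 * x1 + 2 * y1 * y1) + d * (x2 * x2 + 2 * y2 * y2)
     + f * (x3 * x3 + 2 * y3 * y3)
     + 2 * (x1 * (b1 * x2 - 2 * b2 * y2) + 2 * y1 * (b1 * y2 + b2 * x2))
     + 2 * (x1 * (c1 * x3 - 2 * c2 * y3) + 2 * y1 * (c1 * y3 + c2 * x3))
     + 2 * (x2 * (e1 * x3 - 2 * e2 * y3) + 2 * y2 * (e1 * y3 + e2 * x3))))%bZ.
Proof.
move=> D F E1 E2 D0.
pose p := (a * x1 + (b1 * x2 - 2 * b2 * y2) + (c1 * x3 - 2 * c2 * y3))%bZ.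
pose q := (a * y1 + (b1 * y2 + b2 * x2) + (c1 * y3 + c2 * x3))%bZ.
pose s := (D * x2 + (E1 * x3 - 2 * E2 * y3))%bZ.
pose t := (D * y2 + (E1 * y3 + E2 * x3))%bZ.
have p2 : (0 <= D * (p * p + 2 * (q * q)))%bZ by apply: Z.mul_nonneg_nonneg => //; nia.
have s2 : (0 <= s * s + 2 * (t * t))%bZ by nia.
rewrite -Z.le_0_sub.
rewrite [X in (_ <= X)%bZ](_ : _ = (D * (p * p + 2 * (q * q)) + (s * s + 2 * (t * t)))%bZ).
  exact: Z.add_nonneg_nonneg.
by rewrite /p /q /s /t /E1 /E2 /F /D; clear; lia.
Qed.

Definition zrange (r : nat) : seq Z :=
  [seq (Z.of_nat i - Z.of_nat r)%bZ | i <- iota 0 (r + r).+1].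

Lemma mem_zrange r x : (- Z.of_nat r <= x <= Z.of_nat r)%bZ -> x \in zrange r.
Proof.
move=> hx; apply/mapP; exists (Z.to_nat (x + Z.of_nat r)); last lia.
by rewrite mem_iota; lia.
Qed.

Definition zbox (r : nat) : seq zq := [seq zo x y | x <- zrange r, y <- zrange r].

Definition zcands (H : zmat) (h : Z) (r : nat) : seq zvec :=
  [seq v <- [seq (xy.1, xy.2, z) | xy <- [seq (x, y) | x <- zbox r, y <- zbox r], z <- zbox r]
   | zre (zform H v v) == h].

(* [(num, den)] with [den * |z_3|^2 <= num * h] for all [z] of norm [h] *)
Definition zbound (a d f : Z) (b c e : zq) (r : nat) (h : Z) : bool :=
  (let: (b1, b2, _, _) := b in let: (c1, c2, _, _) := c in let: (e1, e2, _, _) := e in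
  let D := a * d - (b1 * b1 + 2 * b2 * b2) in
  let F := a * f - (c1 * c1 + 2 * c2 * c2) in
  let E1 := a * e1 - (b1 * c1 + 2 * b2 * c2) in
  let E2 := a * e2 - (b1 * c2 - b2 * c1) in
  let den := D * F - (E1 * E1 + 2 * E2 * E2) in
  let s := Z.of_nat r + 1 in
  [&& 0 <=? D, 0 <? den & D * a * h <? den * (s * s)])%bZ.

Arguments zbound : simpl never.

(** The bound for the last coordinate is used three times, each coordinate in turn being permuted
    into the last place. *)
Definition zbounds (H : zmat) (r : nat) (h : Z) : bool :=
  let: ((a, b, c), (_, d, e), (_, _, f)) := H in
  let a := zre a in let d := zre d in let f := zre f in
  [&& zbound a d f b c e r h, zbound a f d c b (zconj e) r h &
      zbound f d a (zconj e) (zconj c) (zconj b) r h].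

Lemma small_square (den k r x y : Z) : (0 <= r -> 0 < den ->
  den * (x * x + 2 * y * y) <= k -> k < den * ((r + 1) * (r + 1)) ->
  (- r <= x <= r) /\ (- r <= y <= r))%bZ.
Proof.
move=> r0 d0 h1 h2.
have h : (x * x + 2 * y * y < (r + 1) * (r + 1))%bZ by nia.
nia.
Qed.

Lemma zbox_mem r x y : (- Z.of_nat r <= x <= Z.of_nat r)%bZ ->
  (- Z.of_nat r <= y <= Z.of_nat r)%bZ -> (x, y, 0, 0)%bZ \in zbox r.
Proof. by move=> hx hy; apply/allpairsP; exists (x, y); split=> //; apply: mem_zrange. Qed.

Definition inOv (v : zvec) : bool := [&& inO v.1.1, inO v.1.2 & inO v.2].

Lemma zcands_complete H r h v : zall inO H -> zadj H = H -> zbounds H r h ->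
  inOv v -> zre (zform H v v) = h -> v \in zcands H h r.
Proof.
case: H => [[[[a b] c] [[b' d] e]] [[c' e'] f]].
case: a => [[[a a2] a3] a4]; case: b => [[[b1 b2] b3] b4]; case: c => [[[c1 c2] c3] c4].
case: b' => [[[b1' b2'] b3'] b4']; case: d => [[[d d2] d3] d4]; case: e => [[[e1 e2] e3] e4].
case: c' => [[[c1' c2'] c3'] c4']; case: e' => [[[e1' e2'] e3'] e4']; case: f => [[[f f2] f3] f4].
case: v => [[[[[x1 y1] z1'] t1] [[[x2 y2] z2'] t2]] [[[x3 y3] z3'] t3]].
rewrite /zall /inOv /inO /=.
move=> /and3P[/and3P[/andP[/eqP-> /eqP->] /andP[/eqP-> /eqP->] /andP[/eqP-> /eqP->]]
  /and3P[/andP[/eqP-> /eqP->] /andP[/eqP-> /eqP->] /andP[/eqP-> /eqP->]]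
  /and3P[/andP[/eqP-> /eqP->] /andP[/eqP-> /eqP->] /andP[/eqP-> /eqP->]]].
move=> hH hb hv hh; injection hH; clear hH; intros; move: hb hv hh.
have [-> -> ->] : [/\ a2 = 0, d2 = 0 & f2 = 0]%bZ by split; lia.
have [-> ->] : b1' = b1 /\ b2' = (- b2)%bZ by split; lia.
have [-> ->] : c1' = c1 /\ c2' = (- c2)%bZ by split; lia.
have [-> ->] : e1' = e1 /\ e2' = (- e2)%bZ by split; lia.
move=> /and3P[B1 B2 B3].
cbv [zbound zconj zre fst snd] in B1, B2, B3.
case/and3P: B1 => k1 k2 k3; case/and3P: B2 => k4 k5 k6; case/and3P: B3 => k7 k8 k9.
move=> /and3P[/andP[/eqP-> /eqP->] /andP[/eqP-> /eqP->] /andP[/eqP-> /eqP->]] hh.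
rewrite mem_filter; apply/andP; split; first exact/eqP.
rewrite zform_expand in hh.
have r0 : (0 <= Z.of_nat r)%bZ by lia.
have [X3 Y3] : (- Z.of_nat r <= x3 <= Z.of_nat r /\ - Z.of_nat r <= y3 <= Z.of_nat r)%bZ.
  have := @third_coordinate_bound a d f b1 b2 c1 c2 e1 e2 x1 y1 x2 y2 x3 y3.
  cbv zeta => k; match type of k with (_ -> (_ <= _ * ?Q)%bZ) =>
    replace Q with h in k by (rewrite -hh; lia) end.
  apply: (small_square r0 _ (k _)); lia.
have [X2 Y2] : (- Z.of_nat r <= x2 <= Z.of_nat r /\ - Z.of_nat r <= y2 <= Z.of_nat r)%bZ.
  have := @third_coordinate_bound a f d c1 c2 b1 b2 e1 (- e2) x1 y1 x3 y3 x2 y2.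
  cbv zeta => k; match type of k with (_ -> (_ <= _ * ?Q)%bZ) =>
    replace Q with h in k by (rewrite -hh; lia) end.
  apply: (small_square r0 _ (k _)); lia.
have [X1 Y1] : (- Z.of_nat r <= x1 <= Z.of_nat r /\ - Z.of_nat r <= y1 <= Z.of_nat r)%bZ.
  have := @third_coordinate_bound f d a e1 (- e2) c1 (- c2) b1 (- b2) x3 y3 x2 y2 x1 y1.
  cbv zeta => k; match type of k with (_ -> (_ <= _ * ?Q)%bZ) =>
    replace Q with h in k by (rewrite -hh; lia) end.
  apply: (small_square r0 _ (k _)); lia.
apply/allpairsP; exists ((x1, y1, 0, 0)%bZ, (x2, y2, 0, 0)%bZ, (x3, y3, 0, 0)%bZ).
split; [|exact: zbox_mem|by []].
apply/allpairsP; exists ((x1, y1, 0, 0)%bZ, (x2, y2, 0, 0)%bZ).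
by split; [exact: zbox_mem|exact: zbox_mem|].
Qed.

(* every determinant one matrix preserving [J] and [H] is in [l], by enumeration of
   the images of the columns of [B] *)
Definition enum_ok (H B Bi : zmat) (r : nat) (l : seq zmat) : bool :=
  let H2 := zmm (zadj B) (zmm H B) in
  let J2 := zmm (zadj B) (zmm zJ B) in
  let: ((h11, h12, h13), (_, h22, h23), (_, _, h33)) := H2 in
  let: ((j11, j12, j13), (_, j22, j23), (_, _, j33)) := J2 in
  let C1 := zcands H2 (zre h11) r in
  let C2 := zcands H2 (zre h22) r in
  let C3 := zcands H2 (zre h33) r in
  [&& zmm B Bi == z1, zmm Bi B == z1, zall inO B, zall inO Bi, zall inO H, zadj H2 == H2,
      zbounds H2 r (zre h11) && zbounds H2 r (zre h22) && zbounds H2 r (zre h33)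
    & all (fun c1 => (zform J2 c1 c1 == j11) ==>
        all (fun c2 => [&& zform J2 c2 c2 == j22, zform J2 c1 c2 == j12 & zform H2 c1 c2 == h12] ==>
          all (fun c3 => [&& zform J2 c3 c3 == j33, zform J2 c1 c3 == j13, zform J2 c2 c3 == j23,
               zform H2 c1 c3 == h13 & zform H2 c2 c3 == h23] ==>
            let m := zmm B (zmm (ztr (c1, c2, c3)) Bi) in
            (zdet m == zz 1) ==> (m \in l)) C3) C2) C1].

Lemma inO_add x y : inO x -> inO y -> inO (zadd x y).
Proof.
case: x => [[[a b] c] d]; case: y => [[[a' b'] c'] d'].
by move=> /andP[/= /eqP-> /eqP->] /andP[/= /eqP-> /eqP->].
Qed.

Lemma inO_mul x y : inO x -> inO y -> inO (zmul x y).
Proof.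
case: x => [[[a b] c] d]; case: y => [[[a' b'] c'] d'].
move=> /andP[/eqP hc /eqP hd] /andP[/eqP hc' /eqP hd']; rewrite /= in hc hd hc' hd'.
by subst c d c' d'; apply/andP; split; apply/eqP; cbv [fst snd zmul]; lia.
Qed.

Lemma inO_conj x : inO x -> inO (zconj x).
Proof. by case: x => [[[a b] c] d] /andP[/= /eqP-> /eqP->]. Qed.

Lemma zall_mm m n : zall inO m -> zall inO n -> zall inO (zmm m n).
Proof.
case: m => [[[[a1 a2] a3] [[b1 b2] b3]] [[c1 c2] c3]].
case: n => [[[[d1 d2] d3] [[e1 e2] e3]] [[f1 f2] f3]].
move=> /and3P[/and3P[? ? ?] /and3P[? ? ?] /and3P[? ? ?]].
move=> /and3P[/and3P[? ? ?] /and3P[? ? ?] /and3P[? ? ?]].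
by apply/and3P; split; apply/and3P; split; do ![apply: inO_add|apply: inO_mul].
Qed.

Lemma zall_adj m : zall inO m -> zall inO (zadj m).
Proof.
case: m => [[[[a1 a2] a3] [[b1 b2] b3]] [[c1 c2] c3]].
move=> /and3P[/and3P[? ? ?] /and3P[? ? ?] /and3P[? ? ?]].
by apply/and3P; split; apply/and3P; split; exact: inO_conj.
Qed.

Section Enumeration.
Variable C : numClosedFieldType.
Notation evM := (@evM C).
Notation evV := (@evV C).
Notation ev := (@ev C).

Lemma zmmA a b c : zmm a (zmm b c) = zmm (zmm a b) c.
Proof. by apply: (@evM_inj C); rewrite !evM_mul mulmxA. Qed.

Lemma zmm1 a : zmm a z1 = a.
Proof. by apply: (@evM_inj C); rewrite !evM_mul evM1 mulmx1. Qed.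

Lemma z1mm a : zmm z1 a = a.
Proof. by apply: (@evM_inj C); rewrite !evM_mul evM1 mul1mx. Qed.

Lemma zadj_mm a b : zadj (zmm a b) = zmm (zadj b) (zadj a).
Proof. by apply: (@evM_inj C); rewrite !(evM_mul, evM_adj) adjointM. Qed.

Lemma zform_gram (G m : zmat) c1 c2 c3 : m = ztr (c1, c2, c3) ->
  zmm (zadj m) (zmm G m) =
  ((zform G c1 c1, zform G c1 c2, zform G c1 c3),
   (zform G c2 c1, zform G c2 c2, zform G c2 c3),
   (zform G c3 c1, zform G c3 c2, zform G c3 c3)).
Proof.
move=> ->; case: c1 => [[a1 a2] a3]; case: c2 => [[b1 b2] b3]; case: c3 => [[d1 d2] d3].
by case: G => [[[[e1 e2] e3] [[f1 f2] f3]] [[g1 g2] g3]].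
Qed.

(** In the basis [B] the matrix becomes [n], which preserves [H2] and [J2]. Its columns thus have
    the lengths and mutual products of the basis vectors, and the enumeration meets them. The choice
    of [B] serves to keep the search box small. *)
Lemma enum_complete H B Bi r l m : enum_ok H B Bi r l -> zunitary m ->
  zmm (zadj m) (zmm H m) = H -> zdet m = zz 1 -> m \in l.
Proof.
rewrite /enum_ok; set H2 := zmm (zadj B) (zmm H B); set J2 := zmm (zadj B) (zmm zJ B).
case EH: H2 => [[[[h11 h12] h13] [[h21 h22] h23]] [[h31 h32] h33]].
case EJ: J2 => [[[[j11 j12] j13] [[j21 j22] j23]] [[j31 j32] j33]].
rewrite -EH -EJ.
move=> /andP[/eqP BBi /andP[/eqP BiB /andP[oB /andP[oBi /andP[oH /andP[/eqP aH
  /andP[/andP[/andP[b1 b2] b3] /allP ok]]]]]]].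
move=> um mH dm; pose n := zmm Bi (zmm m B).
have mE : m = zmm B (zmm n Bi).
  by rewrite /n -!zmmA BBi zmm1 zmmA BBi z1mm.
have om : zall inO m by case/andP: um.
have on : zall inO n by rewrite /n !zall_mm.
have conjn G : zmm (zadj m) (zmm G m) = G ->
    zmm (zadj n) (zmm (zmm (zadj B) (zmm G B)) n) = zmm (zadj B) (zmm G B).
  move=> hG; rewrite -[in RHS]hG /n !zadj_mm -!zmmA.
  rewrite (zmmA (zadj Bi)) -zadj_mm BBi.
  have -> : zadj z1 = z1 by apply: (@evM_inj C); rewrite evM_adj evM1 adjoint1.
  by rewrite z1mm (zmmA B Bi) BBi z1mm.
have mJ : zmm (zadj m) (zmm zJ m) = zJ by case/andP: um => _ /eqP; rewrite -zmmA.
have hH := etrans (conjn _ mH) EH; have hJ := etrans (conjn _ mJ) EJ.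
pose d := ztr n; case Ed: d => [[d1 d2] d3].
have nE : n = ztr (d1, d2, d3).
  rewrite -Ed /d.
  by case: (n) => [[[[x1 x2] x3] [[y1 y2] y3]] [[t1 t2] t3]].
rewrite (zform_gram _ nE) -/H2 in hH; rewrite (zform_gram _ nE) -/J2 in hJ.
have [w1 w2 w3] : [/\ inOv d1, inOv d2 & inOv d3].
  move: on; rewrite nE; move: (d1) (d2) (d3) => [[? ?] ?] [[? ?] ?] [[? ?] ?].
  move=> /and3P[/and3P[? ? ?] /and3P[? ? ?] /and3P[? ? ?]].
  by split; apply/and3P.
case: hH => [e11 e12 e13 _ e22 e23 _ _ e33].
case: hJ => [f11 f12 f13 _ f22 f23 _ _ f33].
have oH2 : zall inO H2 by rewrite !zall_mm ?zall_adj.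
have k1 : d1 \in zcands H2 (zre h11) r by apply: zcands_complete; rewrite ?e11.
have k2 : d2 \in zcands H2 (zre h22) r by apply: zcands_complete; rewrite ?e22.
have k3 : d3 \in zcands H2 (zre h33) r by apply: zcands_complete; rewrite ?e33.
move/ok/implyP: k1; rewrite f11 eqxx => /(_ isT)/allP ok2.
move/ok2/implyP: k2; rewrite f22 f12 e12 !eqxx => /(_ isT)/allP ok3.
move/ok3/implyP: k3; rewrite f33 f13 f23 e13 e23 !eqxx => /(_ isT)/implyP.
by rewrite -nE -mE dm eqxx => /(_ isT).
Qed.

End Enumeration.

(** * The majorant at a point and the isotropy group *)

(** The matrix of z |-> -<p,p> <z,z> + 2 |<z,p>|^2, which is -<p,p> times the form with its sign
    changed along [p]; it is positive definite for negative [p]. *)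
Definition zmaj (p : zvec) : zmat :=
  zmadd (zmap (zmul (zneg (zherm p p))) zJ)
        (zmap (zmul (zz 2)) (zmm zJ (zouter p p))).

(* the component of an element of Z[i, sqrt 2] in Z[i sqrt 2] *)
Definition zK (x : zq) : zq := let: (a, b, _, _) := x in (a, b, 0, 0)%bZ.

Definition zparallel (v w : zvec) : bool :=
  let: (v1, v2, v3) := v in let: (w1, w2, w3) := w in
  [&& zmul v1 w2 == zmul v2 w1, zmul v1 w3 == zmul v3 w1 & zmul v2 w3 == zmul v3 w2].

(* [g H] is the Q(i sqrt 2)-part of a multiple by [lam] of the majorant at [p], a
   positive definite form preserved by the isotropy group *)
Definition iso_ok (p : zvec) (lam : zq) (g : Z) (H B Bi : zmat) (r : nat) (l : seq zmat) : bool :=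
  [&& zherm p p != zz 0, g != 0%bZ,
      zmap (zmul (zz g)) H == zmap zK (zmap (zmul lam) (zmaj p)),
      enum_ok H B Bi r l, all zdet1 l & all (fun m => zparallel (zmv m p) p) l].

(* minus the reflection with polar vector [w] *)
Definition zrefl (w : zvec) : zmat :=
  let N := zre (zherm w w) in
  zmadd (zmap (fun x => let: (a, b, c, d) := x in
           ((2 * a) / N, (2 * b) / N, (2 * c) / N, (2 * d) / N)%bZ) (zouter w w))
        (zmap zneg z1).

Fixpoint zalt (n : nat) (x y : zmat) : zmat :=
  if n is k.+1 then zmm x (zalt k y x) else z1.

Definition zbraid (x y : zmat) (n : nat) : bool :=
  [&& (2 <= n)%N, zalt n x y == zalt n y x &
      all (fun k => zalt k x y != zalt k y x) (iota 2 (n - 2))].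

Section Isotropy.
Variable C : numClosedFieldType.
Notation evM := (@evM C).
Notation evV := (@evV C).
Notation ev := (@ev C).

(** [zK] is linear over O_2, so it commutes with multiplication by integral matrices: the
    O_2-component of an invariant form is again invariant. *)
Lemma zK_mul x y : inO x -> zK (zmul x y) = zmul x (zK y).
Proof.
case: x => [[[a b] c] d]; case: y => [[[a' b'] c'] d'] /andP[/eqP hc /eqP hd].
rewrite /= in hc hd; subst c d; cbv [zK zmul]; congr (_, _, _, _); lia.
Qed.

Lemma zK_add x y : zK (zadd x y) = zadd (zK x) (zK y).
Proof. by case: x => [[[a b] c] d]; case: y => [[[a' b'] c'] d']. Qed.

Lemma zmulC x y : zmul x y = zmul y x.
Proof. by apply: (@ev_inj C); rewrite !ev_mul mulrC. Qed.

Lemma zK_mml m X : zall inO m -> zmap zK (zmm m X) = zmm m (zmap zK X).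
Proof.
case: m => [[[[a1 a2] a3] [[b1 b2] b3]] [[c1 c2] c3]].
case: X => [[[[d1 d2] d3] [[e1 e2] e3]] [[f1 f2] f3]].
move=> /and3P[/and3P[? ? ?] /and3P[? ? ?] /and3P[? ? ?]].
by rewrite /zmm /ztr /zmap /zvmap /zdot !zK_add !zK_mul.
Qed.

Lemma zK_mmr m X : zall inO m -> zmap zK (zmm X m) = zmm (zmap zK X) m.
Proof.
case: m => [[[[a1 a2] a3] [[b1 b2] b3]] [[c1 c2] c3]].
case: X => [[[[d1 d2] d3] [[e1 e2] e3]] [[f1 f2] f3]].
move=> /and3P[/and3P[? ? ?] /and3P[? ? ?] /and3P[? ? ?]].
rewrite /zmm /ztr /zmap /zvmap /zdot !zK_add.
have h x y : inO y -> zK (zmul x y) = zmul (zK x) y.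
  by move=> oy; rewrite zmulC zK_mul // zmulC.
by rewrite !h.
Qed.

(** The eigenvalue of [m] at [p] has modulus 1 and cancels in the rank one term; the other term is a
    multiple of the preserved form. *)
Lemma maj_preserved m p c : zunitary m -> herm (evV p) (evV p) != 0 ->
  evM m *m evV p = c *: evV p ->
  zmm (zadj m) (zmm (zmaj p) m) = zmaj p.
Proof.
move=> um p0 mp; have [hU _] := zunitaryP C um; set A := evM m in mp hU.
have [uA iA] := unitary_inv hU.
have cc : c * c^* = 1.
  apply: (mulIf p0); rewrite mul1r -[RHS](herm_unitary _ _ hU) mp !hermlin; ring.
have c0 : c != 0 by apply: contra_eq_neq cc => ->; rewrite mul0r eq_sym oner_neq0.
have h1 : adjoint A *m Jmx C *m evV p = c^-1 *: (Jmx C *m evV p).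
  have -> : adjoint A *m Jmx C = Jmx C *m invmx A.
    by rewrite iA !mulmxA Jmx_sq mul1mx.
  have -> : c^-1 *: (Jmx C *m evV p) = Jmx C *m (c^-1 *: evV p) by rewrite scalemxAr.
  rewrite -mulmxA; congr (_ *m _); apply: (scalerI c0).
  by rewrite scalerA mulfV // scale1r scalemxAr -mp mulKmx.
have h2 : adjoint (evV p) *m Jmx C *m A = c *: (adjoint (evV p) *m Jmx C).
  have := congr1 (@adjoint C _ _) h1; rewrite !adjointM adjointK adjointJ mulmxA => ->.
  have -> : adjoint (c^-1 *: (Jmx C *m evV p)) = (c^-1)^* *: adjoint (Jmx C *m evV p).
    by apply/matrixP => i j; rewrite !mxE rmorphM.
  rewrite adjointM adjointJ; congr (_ *: _).
  by rewrite fmorphV /=; apply: (mulfI (_ : c^* != 0)); rewrite ?conjC_eq0 // mulfV ?conjC_eq0 // mulrC.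
apply: (@evM_inj C); rewrite !(evM_mul, evM_adj, evM_add, evM_scale, evMJ, evM_outer) -/A.
rewrite mulmxDl mulmxDr -!scalemxAl -!scalemxAr; congr (_ *: _ + _ *: _).
  by rewrite mulmxA.
rewrite [LHS](_ : _ = (adjoint A *m Jmx C *m evV p) *m (adjoint (evV p) *m Jmx C *m A)).
  by rewrite h1 h2 -scalemxAl -scalemxAr scalerA mulVf // scale1r !mulmxA.
by rewrite !mulmxA.
Qed.

Lemma zscale_inj g m n : g != 0%bZ -> zmap (zmul (zz g)) m = zmap (zmul (zz g)) n -> m = n.
Proof.
move=> g0 h; apply: (@evM_inj C).
have := congr1 evM h; rewrite !evM_scale ev_zz => /scalerI; apply.
by apply: contraNneq g0 => e; apply/eqP/(@zr_inj C).
Qed.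

Lemma zmm_scalel x m n : zmm (zmap (zmul x) m) n = zmap (zmul x) (zmm m n).
Proof. by apply: (@evM_inj C); rewrite !(evM_mul, evM_scale) scalemxAl. Qed.
Lemma zmm_scaler x m n : zmm m (zmap (zmul x) n) = zmap (zmul x) (zmm m n).
Proof. by apply: (@evM_inj C); rewrite !(evM_mul, evM_scale) scalemxAr. Qed.

Lemma zparallelP v w : evV w != 0 -> zparallel v w -> exists c, evV v = c *: evV w.
Proof.
case: v => [[v1 v2] v3]; case: w => [[w1 w2] w3] w0.
move=> /and3P[/eqP h12 /eqP h13 /eqP h23].
have {}h12 := congr1 ev h12; have {}h13 := congr1 ev h13; have {}h23 := congr1 ev h23.
rewrite !ev_mul in h12 h13 h23.
have [w10|w10] := eqVneq (ev w1) 0; last first.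
  exists (ev v1 / ev w1); cv3; rewrite ?mulfVK // mulrAC; apply: (mulIf w10); rewrite mulfVK //.
have [w20|w20] := eqVneq (ev w2) 0; last first.
  exists (ev v2 / ev w2); cv3; rewrite ?mulfVK // mulrAC; apply: (mulIf w20); rewrite mulfVK //.
have [w30|w30] := eqVneq (ev w3) 0; last first.
  exists (ev v3 / ev w3); cv3; rewrite ?mulfVK // mulrAC; apply: (mulIf w30); rewrite mulfVK //.
by case/eqP: w0; cv3; rewrite ?w10 ?w20 ?w30.
Qed.

(** An isotropy element preserves the majorant, hence its O_2-component [g H], and so is met by the
    enumeration. Conversely, the listed matrices are checked to map [p] to a parallel vector. *)
Theorem isotropyE p lam g H B Bi r l : iso_ok p lam g H B Bi r l ->
  isotropy (line (evV p)) = @zgroup C l.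
Proof.
move=> /and5P[N0 g0 /eqP hH en /andP[/allP hl /allP pl]].
have p0 : herm (evV p) (evV p) != 0.
  rewrite -ev_herm; apply: contraNneq N0 => h; apply/eqP/(@ev_inj C).
  by rewrite h ev0.
have pn0 : evV p != 0 by apply: contraNneq p0 => ->; rewrite herm0l.
apply/seteqP; split; last first.
  move=> _ [m ml <-]; have dm := hl _ ml; have um := zdet1_unit C dm.
  split.
    by apply/Gamma2P; exists (evM m) => //; case/andP: dm => /zunitaryP.
  have [c hc] := zparallelP pn0 (pl _ ml); rewrite evM_mulV in hc.
  rewrite act_cls // hc lineZ //; apply: contraNneq pn0 => c0.
  by rewrite -(mulKmx um (evV p)) hc c0 scale0r mulmx0.
move=> gg [/Gamma2_zmat[m [-> um dm]]].
rewrite act_cls ?(unitaryO_unit (zunitaryP C um)) // => /(line_eq pn0)[c c0 mp].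
exists m => //; apply: (enum_complete C en um _ dm).
have om : zall inO m by case/andP: um.
apply: (zscale_inj g0); rewrite -zmm_scaler -zmm_scalel hH.
rewrite -zK_mmr // -zK_mml ?zall_adj // zmm_scalel zmm_scaler.
by rewrite (maj_preserved um p0 mp).
Qed.

(** The quotients in [zrefl] are rounded, so [zpolar] certifies that they are exact; the sign
    disappears in PGL. *)
Lemma reflectionE w : zpolar (zrefl w) w -> zdet1 (zrefl w) ->
  reflection (evV w) = cls (evM (zrefl w)).
Proof.
move=> pw dm; have [hp w0] := zpolarP C pw; have um := zdet1_unit C dm.
rewrite /reflection -[RHS]clsN //; congr (cls _).
apply/trmx_inj/row_matrixP => i; rewrite -!tr_col; congr (_^T).
by rewrite !colE reflection_mxE mulNmx hp opprD opprK.
Qed.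

Lemma zdet1_mul x y : zdet1 x -> zdet1 y -> zdet1 (zmm x y).
Proof.
move=> /andP[ux /eqP dx] /andP[uy /eqP dy]; apply/andP; split.
  have := unitaryOM (zunitaryP C ux) (zunitaryP C uy); rewrite -evM_mul => h.
  by have [m /evM_inj -> ->] := unitaryO_ev h.
by apply/eqP/(@ev_inj C); rewrite ev_det evM_mul det_mulmx -!ev_det dx dy ev1 mulr1.
Qed.

Lemma braidP x y n : zdet1 x -> zdet1 y -> zbraid x y n ->
  has_braid_length (cls (evM x)) (cls (evM y)) n.
Proof.
move=> dx dy /and3P[n2 /eqP xy /allP nxy].
have d1 : zdet1 z1 by [].
have da (k : nat) (u v : zmat) : zdet1 u -> zdet1 v -> zdet1 (zalt k u v).
  by elim: k u v => //= k IH u v du dv; apply: zdet1_mul => //; apply: IH.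
have ea (k : nat) (u v : zmat) : zdet1 u -> zdet1 v ->
    Defs.alternating k (cls (evM u)) (cls (evM v)) = cls (evM (zalt k u v)).
  elim: k u v => [|k IH] u v du dv; first by rewrite -[RHS]/(cls (evM z1)) evM1 cls1.
  rewrite -[LHS]/(cls (evM u) * Defs.alternating k (cls (evM v)) (cls (evM u)))%g.
  by rewrite IH // -[zalt k.+1 u v]/(zmm u (zalt k v u)) evM_mul clsM ?zdet1_unit // da.
split=> //; first by rewrite !ea // xy.
move=> k /andP[k2 kn]; rewrite !ea // => h.
have kin : k \in iota 2 (n - 2) by rewrite mem_iota k2 subnKC.
case/eqP: (nxy _ kin).
have /andP[u1 /eqP e1] := da k x y dx dy; have /andP[u2 /eqP e2] := da k y x dy dx.
exact: cls_zinj h.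
Qed.

Lemma reflection_subgroupE l pv rl : refl_table l pv rl ->
  reflection_subgroup (@zgroup C l) = generated (@zgroup C (map rmx rl)).
Proof. by move=> ok; rewrite /reflection_subgroup (table_reflections C ok). Qed.

Lemma mirror_countsE l pv rl : refl_table l pv rl ->
  mirror_counts (@zgroup C l) (count (fun r => r.2 == 1)%N rl)
    (count (fun r => r.2 == 2)%N rl) (count (fun r => r.2 == 3)%N rl).
Proof.
move=> ok; have h := table_mirrors C ok.
have v1 : vec3 0 1 0 = evV (zbase 1) by rewrite /= !ev_zz.
have v2 : vec3 1 (-1) 0 = evV (zbase 2) by rewrite /= !ev_zz.
have v3 : vec3 1 0 1 = evV (zbase 3) by rewrite /= !ev_zz.
by split; rewrite ?v1 ?v2 ?v3; apply: h.
Qed.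

End Isotropy.

(** * The seven points *)

(* [zv a a' b b' c c'] is the vector (a + a' alpha, b + b' alpha, c + c' alpha). *)
Definition zv (a a' b b' c c' : Z) : zvec := (zo a a', zo b b', zo c c').
Definition zentry (w : zvec) (t : zmat) (j : nat) : rdata := (zrefl w, w, t, j).

Open Scope Z_scope.

(** For each point: a vector [q], generators, the isotropy group as a list of their products, the
    table [refl] of its reflections, and in [points] the negative vectors certifying that the
    remaining involutions are point reflections. The [iso_ok] statements supply the rational form, a
    basis with its inverse, and a search radius. *)
Definition q1 : zvec := (zv 1 0 0 0 (-1) 0).
Definition gens1 : seq zmat := [:: zrefl (zv 0 0 1 0 0 0); zrefl (zv 1 0 0 0 1 0)].
Definition list1 : seq zmat := zgen 2 gens1 [:: z1].
Definition refl1 : seq rdata := [::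
  zentry (zv 0 0 1 0 0 0) ((zv 1 0 0 0 0 0), (zv 0 0 1 0 0 0), (zv 0 0 0 0 1 0)) 1%nat;
  zentry (zv 1 0 0 0 1 0) ((zv 1 0 0 0 0 0), (zv 0 0 1 0 0 0), (zv 0 0 0 0 1 0)) 3%nat].
Definition points1 : seq zvec := [:: (zv (-1) 0 0 0 1 0)].
Lemma iso_ok1 : iso_ok q1 (1, 0, 0, 0) 2
  ((zv 1 0 0 0 0 0), (zv 0 0 1 0 0 0), (zv 0 0 0 0 1 0))
  ((zv (-1) 0 0 0 0 0), (zv 0 0 (-1) 0 0 0), (zv 0 0 0 0 (-1) 0))
  ((zv (-1) 0 0 0 0 0), (zv 0 0 (-1) 0 0 0), (zv 0 0 0 0 (-1) 0))
  1 list1.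
Proof. by vm_compute. Qed.
Lemma table_ok1 : refl_table list1 points1 refl1.
Proof. by vm_compute. Qed.
Lemma group_ok1 : zgroupb list1.
Proof. by vm_compute. Qed.

Definition q2 : zvec := (zv (-1) (-1) 0 1 0 1).
Definition gens2 : seq zmat := [:: zrefl (zv 1 0 (-1) 0 0 0); zrefl (zv 1 0 0 (-1) 0 (-1))].
Definition list2 : seq zmat := zgen 2 gens2 [:: z1].
Definition refl2 : seq rdata := [::
  zentry (zv 1 0 (-1) 0 0 0) ((zv 1 0 0 0 0 0), (zv 0 0 1 0 0 0), (zv 0 0 0 0 1 0)) 2%nat;
  zentry (zv (-1) 0 0 1 0 1) ((zv 0 0 0 0 (-1) 0), (zv 0 0 (-1) 0 0 1), (zv (-1) 0 0 1 1 1)) 3%nat].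
Definition points2 : seq zvec := [:: (zv (-1) (-1) 0 1 0 1)].
Lemma iso_ok2 : iso_ok q2 (1, 0, 0, 0) 2
  ((zv 2 0 2 0 (-1) (-1)), (zv 2 0 3 0 (-2) (-1)), (zv (-1) 1 (-2) 1 3 0))
  ((zv (-1) 0 (-2) 0 (-1) (-1)), (zv 1 0 1 1 (-1) 1), (zv 0 0 1 1 (-1) 1))
  ((zv 0 0 1 0 (-1) 0), (zv (-1) 1 (-1) 1 2 0), (zv (-1) (-1) (-1) (-1) (-1) 1))
  2 list2.
Proof. by vm_compute. Qed.
Lemma table_ok2 : refl_table list2 points2 refl2.
Proof. by vm_compute. Qed.
Lemma group_ok2 : zgroupb list2.
Proof. by vm_compute. Qed.

Definition q3 : zvec := (zv (-2) (-1) (-1) 0 0 1).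
Definition gens3 : seq zmat := [:: zrefl (zv 1 0 0 (-1) 0 0); zrefl (zv 1 1 0 0 1 0)].
Definition list3 : seq zmat := zgen 3 gens3 [:: z1].
Definition refl3 : seq rdata := [::
  zentry (zv (-1) 0 0 1 0 0) ((zv (-1) 0 0 0 0 0), (zv 0 1 1 0 0 0), (zv 1 0 0 (-1) (-1) 0)) 3%nat;
  zentry (zv 0 (-1) 0 (-1) (-1) 0) ((zv 3 (-1) 0 (-3) (-3) 0), (zv 0 (-1) (-1) 0 0 0), (zv (-1) (-1) (-2) 0 0 1)) 3%nat;
  zentry (zv 1 1 0 0 1 0) ((zv (-1) (-1) (-2) 2 2 2), (zv (-2) 0 1 2 2 0), (zv 0 1 2 0 1 (-1))) 3%nat].
Definition points3 : seq zvec := [:: ].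
Lemma iso_ok3 : iso_ok q3 (1, 0, 0, 0) 1
  ((zv 4 0 0 (-2) (-1) (-4)), (zv 0 2 5 0 4 (-2)), (zv (-1) 4 4 2 12 0))
  ((zv (-1) 0 (-1) 1 (-2) 0), (zv 0 0 0 1 (-1) 0), (zv 0 0 1 0 0 1))
  ((zv (-1) 0 0 1 1 1), (zv 0 0 0 (-1) (-1) 0), (zv 0 0 1 0 0 (-1)))
  1 list3.
Proof. by vm_compute. Qed.
Lemma table_ok3 : refl_table list3 points3 refl3.
Proof. by vm_compute. Qed.
Lemma group_ok3 : zgroupb list3.
Proof. by vm_compute. Qed.

Definition q4 : zvec := (zv 1 0 (-1) 0 (-1) 0).
Definition gens4 : seq zmat := [:: zrefl (zv 0 0 1 0 1 0); zrefl (zv 1 0 0 0 1 0)].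
Definition list4 : seq zmat := zgen 4 gens4 [:: z1].
Definition refl4 : seq rdata := [::
  zentry (zv 1 0 (-2) 0 (-1) 0) ((zv 2 0 2 0 (-1) 0), (zv (-2) 0 (-1) 0 0 0), (zv (-1) 0 0 0 0 0)) 3%nat;
  zentry (zv 1 0 (-1) 0 0 0) ((zv 1 0 0 0 0 0), (zv 0 0 1 0 0 0), (zv 0 0 0 0 1 0)) 2%nat;
  zentry (zv 0 0 (-1) 0 (-1) 0) ((zv 2 0 2 0 (-1) 0), (zv (-2) 0 (-1) 0 0 0), (zv (-1) 0 0 0 0 0)) 2%nat;
  zentry (zv 1 0 0 0 1 0) ((zv 1 0 0 0 0 0), (zv 0 0 1 0 0 0), (zv 0 0 0 0 1 0)) 3%nat].
Definition points4 : seq zvec := [:: (zv (-1) 0 1 0 1 0)].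
Lemma iso_ok4 : iso_ok q4 (1, 0, 0, 0) 1
  ((zv 2 0 2 0 (-1) 0), (zv 2 0 3 0 (-2) 0), (zv (-1) 0 (-2) 0 2 0))
  ((zv (-1) 0 (-1) 0 0 0), (zv 1 0 1 0 (-1) 0), (zv 0 0 1 0 (-1) 0))
  ((zv 0 0 1 0 (-1) 0), (zv (-1) 0 (-1) 0 1 0), (zv (-1) 0 (-1) 0 0 0))
  1 list4.
Proof. by vm_compute. Qed.
Lemma table_ok4 : refl_table list4 points4 refl4.
Proof. by vm_compute. Qed.
Lemma group_ok4 : zgroupb list4.
Proof. by vm_compute. Qed.

Definition q5 : zvec := (zv (-2) (-1) (-1) 1 0 1).
Definition gens5 : seq zmat := [:: zrefl (zv 0 0 0 1 1 0); zrefl (zv 1 1 2 0 1 (-1)); zrefl (zv 1 1 2 (-1) 0 (-1))].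
Definition list5 : seq zmat := zgen 6 gens5 [:: z1].
Definition refl5 : seq rdata := [::
  zentry (zv 3 0 0 (-2) (-1) (-1)) ((zv 0 1 2 0 3 (-1)), (zv 2 0 (-1) (-2) (-2) (-2)), (zv 1 (-1) (-2) 0 (-2) 0)) 3%nat;
  zentry (zv 2 (-1) (-2) (-1) (-1) 0) ((zv 3 (-1) 2 (-1) (-1) 0), (zv (-2) (-1) (-1) 0 0 0), (zv (-1) 0 0 0 0 0)) 3%nat;
  zentry (zv 1 1 2 (-1) 0 (-1)) ((zv (-3) 1 4 2 4 0), (zv 2 1 1 (-2) 0 (-2)), (zv 1 0 0 (-1) (-1) (-1))) 3%nat;
  zentry (zv 2 2 2 (-1) 1 (-1)) ((zv (-1) 3 4 (-1) 3 (-1)), (zv 4 0 (-3) (-2) (-2) (-1)), (zv 2 (-1) (-2) 0 (-1) 0)) 3%nat;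
  zentry (zv (-1) 2 2 1 2 0) ((zv 2 (-2) (-6) 2 (-3) 4), (zv (-2) 0 3 2 4 1), (zv (-1) 0 2 1 3 0)) 3%nat;
  zentry (zv 1 (-2) (-2) 0 (-1) 0) ((zv (-2) 2 6 (-2) 3 (-4)), (zv 2 2 (-1) (-4) (-4) (-2)), (zv 3 0 (-4) (-2) (-4) 0)) 3%nat;
  zentry (zv 1 1 2 0 1 (-1)) ((zv 5 (-2) (-8) 0 (-4) 3), (zv (-2) (-2) 1 4 4 2), (zv (-2) (-1) 2 2 3 0)) 3%nat;
  zentry (zv 1 1 0 (-1) 0 0) ((zv 0 (-1) 0 2 1 2), (zv (-2) 0 3 0 2 (-1)), (zv (-1) 1 2 (-1) 1 (-1))) 3%nat;
  zentry (zv 0 0 0 (-1) (-1) 0) ((zv (-1) 0 0 1 1 0), (zv 0 0 1 0 0 (-1)), (zv 0 0 0 0 (-1) 0)) 3%nat;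
  zentry (zv (-3) 0 0 1 0 1) ((zv 0 (-1) (-2) 0 (-3) 1), (zv 0 0 (-1) 0 0 1), (zv (-1) 0 0 1 1 1)) 3%nat;
  zentry (zv (-2) 1 0 1 1 1) ((zv (-1) (-2) (-2) 3 (-1) 3), (zv (-2) 1 3 0 2 0), (zv (-1) 1 2 0 2 0)) 3%nat;
  zentry (zv 1 1 0 0 1 0) ((zv (-1) (-1) (-2) 2 2 2), (zv (-2) 0 1 2 2 0), (zv 0 1 2 0 1 (-1))) 3%nat].
Definition points5 : seq zvec := [:: (zv (-2) (-1) (-1) 1 0 1)].
Lemma iso_ok5 : iso_ok q5 (1, 0, 0, 0) 1
  ((zv 4 0 4 (-2) (-3) (-4)), (zv 4 2 7 0 0 (-6)), (zv (-3) 4 0 6 12 0))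
  ((zv (-2) (-1) (-3) 0 (-2) (-2)), (zv (-1) 1 0 1 (-2) 1), (zv 0 1 0 1 (-1) 1))
  ((zv 0 1 1 1 2 (-1)), (zv (-1) 0 0 1 0 0), (zv 0 (-1) (-2) (-1) (-1) 1))
  2 list5.
Proof. by vm_compute. Qed.
Lemma table_ok5 : refl_table list5 points5 refl5.
Proof. by vm_compute. Qed.
Lemma group_ok5 : zgroupb list5.
Proof. by vm_compute. Qed.

Definition q6 : zvec := ((-2, 1, -1, 0), (0, 2, 0, 0), (2, 0, 0, 0)).
Definition gens6 : seq zmat := [:: zmap zneg ((zv 1 (-1) (-2) 0 0 1), (zv 0 (-1) (-1) 0 0 0), (zv (-1) 0 0 1 1 0))].
Definition list6 : seq zmat := zgen 7 gens6 [:: z1].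
Definition refl6 : seq rdata := [::
  zentry (zv 0 (-1) (-1) 0 0 0) ((zv 1 (-1) 0 (-1) (-3) (-1)), (zv 0 (-1) (-1) 0 (-2) 0), (zv (-1) 0 0 0 0 1)) 1%nat].
Definition points6 : seq zvec := [:: ].
(** The O_2-component of a matrix is half its sum with its conjugate under sqrt 2 |-> - sqrt 2, i
    |-> - i. The conjugate of the majorant is indefinite, since the conjugate of [q6] is a positive
    vector; the factor 2 + sqrt 2, large against its conjugate 2 - sqrt 2, makes the sum positive
    definite. *)
Lemma iso_ok6 : iso_ok q6 (2, 0, 1, 0) 8
  ((zv 2 0 0 (-2) (-2) (-1)), (zv 0 2 5 0 2 (-3)), (zv (-2) 1 2 3 6 0))
  ((zv 0 (-1) (-1) (-1) (-1) 0), (zv (-1) 0 (-2) 0 0 1), (zv 0 0 0 1 1 0))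
  ((zv 0 0 (-1) 0 0 1), (zv (-1) 0 0 1 1 0), (zv 0 1 2 0 1 (-1)))
  1 list6.
Proof. by vm_compute. Qed.
Lemma table_ok6 : refl_table list6 points6 refl6.
Proof. by vm_compute. Qed.
Lemma group_ok6 : zgroupb list6.
Proof. by vm_compute. Qed.

Definition q7 : zvec := ((-1, 0, 0, 1), (1, 1, 0, -1), (1, 0, 0, 0)).
Definition gens7 : seq zmat := [:: zmap zneg ((zv 1 0 2 0 (-2) (-2)), (zv 0 (-1) (-1) (-2) (-2) 2), (zv (-1) (-1) (-2) (-1) (-1) 2))].
Definition list7 : seq zmat := zgen 3 gens7 [:: z1].
Definition refl7 : seq rdata := [::
  zentry (zv 0 1 1 0 1 0) ((zv 0 1 0 0 3 0), (zv 0 0 (-1) 0 0 0), (zv 1 0 0 0 0 (-1))) 2%nat].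
Definition points7 : seq zvec := [:: ].
(** As for [q6], with the factor 3 + 2 sqrt 2 = (1 + sqrt 2)^2. *)
Lemma iso_ok7 : iso_ok q7 (3, 0, 2, 0) 2
  ((zv 3 0 3 (-1) (-2) (-2)), (zv 3 1 5 0 (-2) (-3)), (zv (-2) 2 (-2) 3 6 0))
  ((zv 0 (-1) (-1) (-1) (-1) 0), (zv (-1) 0 (-1) 1 1 1), (zv (-1) 0 0 1 1 0))
  ((zv (-1) 0 (-1) 0 0 1), (zv 0 1 1 1 1 (-1)), (zv 1 0 1 (-1) (-1) 0))
  1 list7.
Proof. by vm_compute. Qed.
Lemma table_ok7 : refl_table list7 points7 refl7.
Proof. by vm_compute. Qed.
Lemma group_ok7 : zgroupb list7.
Proof. by vm_compute. Qed.

Close Scope Z_scope.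

Section Points.
Variable C : numClosedFieldType.
Notation evM := (@evM C).
Notation evV := (@evV C).
Notation ev := (@ev C).
Notation a := (alpha C).
Notation refl x y z := (reflection (vec3 x y z) : PGL C 3).
Notation RG G := (reflection_subgroup G).

Lemma zr_small : (zr C 0%bZ = 0) * (zr C 1%bZ = 1) * (zr C 2%bZ = 2) *
  (zr C (-1)%bZ = - 1) * (zr C (-2)%bZ = - 2).
Proof. by []. Qed.

Ltac evring := rewrite /evV /zv /zo /ev ?zr_small;
  congr (vec3 _ _ _); ring.

Lemma vec_q1 : vec3 1 0 (-1) = evV q1. Proof. by rewrite /q1; evring. Qed.
Lemma vec_q2 : vec3 (- 1 - a) a a = evV q2. Proof. by rewrite /q2; evring. Qed.
Lemma vec_q3 : vec3 (- 2 - a) (- 1) a = evV q3. Proof. by rewrite /q3; evring. Qed.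
Lemma vec_q4 : vec3 1 (- 1) (- 1) = evV q4. Proof. by rewrite /q4; evring. Qed.
Lemma vec_q5 : vec3 (- 2 - a) (- 1 + a) a = evV q5. Proof. by rewrite /q5; evring. Qed.

Lemma herm_q (q : zvec) (n : Z) : zherm q q = zz n -> (n < 0)%bZ -> H2 (line (evV q)).
Proof.
move=> qn n0; exists (evV q) => //.
by rewrite -ev_herm qn ev_zz /zr ltrz0; lia.
Qed.

Lemma refl_cls x y z w : vec3 x y z = evV w -> zpolar (zrefl w) w -> zdet1 (zrefl w) ->
  refl x y z = cls (evM (zrefl w)).
Proof. by move=> ->; apply: reflectionE. Qed.

Lemma zgroup2 x y : @zgroup C [:: x; y] = [set cls (evM x); cls (evM y)].
Proof.
apply/seteqP; split=> [_ [m + <-]|_ [->|->]]; last 2 first.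
- by exists x => //=; rewrite inE eqxx.
- by exists y => //=; rewrite !inE eqxx orbT.
by rewrite /= !inE => /orP[]/eqP->; [left|right].
Qed.

Lemma zgroup1 x : @zgroup C [:: x] = [set cls (evM x)].
Proof.
apply/seteqP; split=> [_ [m + <-]|_ ->]; last by exists x => //=; rewrite inE eqxx.
by rewrite /= inE => /eqP ->.
Qed.

Lemma zgroup3 x y z : @zgroup C [:: x; y; z] = [set cls (evM x); cls (evM y); cls (evM z)].
Proof.
apply/seteqP; split=> [_ [m + <-]|_ [[->|->]|->]]; last 3 first.
- by exists x => //=; rewrite inE eqxx.
- by exists y => //=; rewrite !inE eqxx orbT.
- by exists z => //=; rewrite !inE eqxx !orbT.
by rewrite /= !inE => /or3P[]/eqP->; [left; left|left; right|right].
Qed.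

Definition zsub (l s : seq zmat) : bool := all (fun m => m \in s) l.

Lemma table_group l pv rl n : zgroupb l -> refl_table l pv rl ->
  zsub l (zgen n (map rmx rl) [:: z1]) ->
  RG (@zgroup C l) = @zgroup C l.
Proof.
move=> gl tl hl; rewrite (reflection_subgroupE C tl).
by apply: (generated_zgroup C gl _ hl); case/and5P: tl.
Qed.

Lemma gens_group l gens n : zgroupb l -> all (fun g => g \in l) gens ->
  zsub l (zgen n gens [:: z1]) ->
  @zgroup C l = generated (@zgroup C gens).
Proof. by move=> gl hg hl; rewrite (generated_zgroup C gl hg hl). Qed.

Lemma group_card l n : zgroupb l -> uniq l && (size l == n) -> @zgroup C l #= `I_n.
Proof. by move=> /and3P[hl _ _] /andP[ul /eqP <-]; apply: card_zgroup. Qed.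

Lemma table_counts l pv rl (j : nat * nat * nat) : refl_table l pv rl ->
  [seq count (fun r => r.2 == i)%N rl | i <- [:: 1; 2; 3]%N] == [:: j.1.1; j.1.2; j.2] ->
  mirror_counts (@zgroup C l) j.1.1 j.1.2 j.2.
Proof. by move=> /(mirror_countsE C) + /eqP [<- <- <-]. Qed.

Lemma iso1 : isotropy (line (evV q1)) = @zgroup C list1.
Proof. exact: isotropyE iso_ok1. Qed.
Lemma iso2 : isotropy (line (evV q2)) = @zgroup C list2.
Proof. exact: isotropyE iso_ok2. Qed.
Lemma iso3 : isotropy (line (evV q3)) = @zgroup C list3.
Proof. exact: isotropyE iso_ok3. Qed.
Lemma iso4 : isotropy (line (evV q4)) = @zgroup C list4.
Proof. exact: isotropyE iso_ok4. Qed.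
Lemma iso5 : isotropy (line (evV q5)) = @zgroup C list5.
Proof. exact: isotropyE iso_ok5. Qed.
Lemma iso6 : isotropy (line (evV q6)) = @zgroup C list6.
Proof. exact: isotropyE iso_ok6. Qed.
Lemma iso7 : isotropy (line (evV q7)) = @zgroup C list7.
Proof. exact: isotropyE iso_ok7. Qed.

Lemma point1 (G := isotropy (line (vec3 1 0 (-1)))) (A := refl 0 1 0) (B := refl 1 0 1) :
  H2 (line (vec3 1 0 (-1) : 'cV[C]_3)) /\
  [/\ RG G = G, G #= `I_4, G = generated [set A; B],
      has_braid_length A B 2 & mirror_counts G 1 0 1].
Proof.
have AE : A = cls (evM (zrefl (zv 0 0 1 0 0 0))).
  by apply: refl_cls; [evring|vm_compute|vm_compute].
have BE : B = cls (evM (zrefl (zv 1 0 0 0 1 0))).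
  by apply: refl_cls; [evring|vm_compute|vm_compute].
rewrite /G vec_q1 iso1 AE BE; split.
  exact: (@herm_q _ (-2)%bZ).
split.
- by apply: (table_group (n := 6) group_ok1 table_ok1); vm_compute.
- by apply: (group_card group_ok1); vm_compute.
- by rewrite -zgroup2; apply: (gens_group (n := 6) group_ok1); vm_compute.
- by apply: braidP; vm_compute.
- by apply: (@table_counts _ _ _ (1, 0, 1)%N table_ok1); vm_compute.
Qed.

Lemma point2 (G := isotropy (line (vec3 (- 1 - a) a a))) (A := refl 1 (- 1) 0) (B := refl 1 (- a) (- a)) :
  H2 (line (vec3 (- 1 - a) a a : 'cV[C]_3)) /\
  [/\ RG G = G, G #= `I_4, G = generated [set A; B],
      has_braid_length A B 2 & mirror_counts G 0 1 1].
Proof.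
have AE : A = cls (evM (zrefl (zv 1 0 (-1) 0 0 0))).
  by apply: refl_cls; [evring|vm_compute|vm_compute].
have BE : B = cls (evM (zrefl (zv 1 0 0 (-1) 0 (-1)))).
  by apply: refl_cls; [evring|vm_compute|vm_compute].
rewrite /G vec_q2 iso2 AE BE; split; first exact: (@herm_q _ (-2)%bZ).
split.
- by apply: (table_group (n := 6) group_ok2 table_ok2); vm_compute.
- by apply: (group_card group_ok2); vm_compute.
- by rewrite -zgroup2; apply: (gens_group (n := 6) group_ok2); vm_compute.
- by apply: braidP; vm_compute.
- by apply: (@table_counts _ _ _ (0, 1, 1)%N table_ok2); vm_compute.
Qed.

Lemma point3 (G := isotropy (line (vec3 (- 2 - a) (- 1) a))) (A := refl 1 (- a) 0) (B := refl (1 + a) 0 1) :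
  H2 (line (vec3 (- 2 - a) (- 1) a : 'cV[C]_3)) /\
  [/\ RG G = G, G #= `I_6, G = generated [set A; B],
      has_braid_length A B 3 & mirror_counts G 0 0 3].
Proof.
have AE : A = cls (evM (zrefl (zv 1 0 0 (-1) 0 0))).
  by apply: refl_cls; [evring|vm_compute|vm_compute].
have BE : B = cls (evM (zrefl (zv 1 1 0 0 1 0))).
  by apply: refl_cls; [evring|vm_compute|vm_compute].
rewrite /G vec_q3 iso3 AE BE; split; first exact: (@herm_q _ (-3)%bZ).
split.
- by apply: (table_group (n := 6) group_ok3 table_ok3); vm_compute.
- by apply: (group_card group_ok3); vm_compute.
- by rewrite -zgroup2; apply: (gens_group (n := 6) group_ok3); vm_compute.
- by apply: braidP; vm_compute.
- by apply: (@table_counts _ _ _ (0, 0, 3)%N table_ok3); vm_compute.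
Qed.

Lemma point4 (G := isotropy (line (vec3 1 (- 1) (- 1)))) (A := refl 0 1 1) (B := refl 1 0 1) :
  H2 (line (vec3 1 (- 1) (- 1) : 'cV[C]_3)) /\
  [/\ RG G = G, G #= `I_8, G = generated [set A; B],
      has_braid_length A B 4 & mirror_counts G 0 2 2].
Proof.
have AE : A = cls (evM (zrefl (zv 0 0 1 0 1 0))).
  by apply: refl_cls; [evring|vm_compute|vm_compute].
have BE : B = cls (evM (zrefl (zv 1 0 0 0 1 0))).
  by apply: refl_cls; [evring|vm_compute|vm_compute].
rewrite /G vec_q4 iso4 AE BE; split; first exact: (@herm_q _ (-1)%bZ).
split.
- by apply: (table_group (n := 6) group_ok4 table_ok4); vm_compute.
- by apply: (group_card group_ok4); vm_compute.
- by rewrite -zgroup2; apply: (gens_group (n := 6) group_ok4); vm_compute.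
- by apply: braidP; vm_compute.
- by apply: (@table_counts _ _ _ (0, 2, 2)%N table_ok4); vm_compute.
Qed.

Lemma point5 (G := isotropy (line (vec3 (- 2 - a) (- 1 + a) a)))
    (A := refl 0 a 1) (B := refl (1 + a) 2 (1 - a)) (D := refl (1 + a) (2 - a) (- a)) :
  [/\ H2 (line (vec3 (- 2 - a) (- 1 + a) a : 'cV[C]_3)), RG G = G & G #= `I_48] /\
  [/\ G = generated [set A; B; D], has_braid_length A B 6, has_braid_length A D 6,
      has_braid_length B D 6 & mirror_counts G 0 0 12].
Proof.
have AE : A = cls (evM (zrefl (zv 0 0 0 1 1 0))).
  by apply: refl_cls; [evring|vm_compute|vm_compute].
have BE : B = cls (evM (zrefl (zv 1 1 2 0 1 (-1)))).
  by apply: refl_cls; [evring|vm_compute|vm_compute].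
have DE : D = cls (evM (zrefl (zv 1 1 2 (-1) 0 (-1)))).
  by apply: refl_cls; [evring|vm_compute|vm_compute].
rewrite /G vec_q5 iso5 AE BE DE; split; split.
- exact: (@herm_q _ (-1)%bZ).
- by apply: (table_group (n := 6) group_ok5 table_ok5); vm_compute.
- by apply: (group_card group_ok5); vm_compute.
- by rewrite -zgroup3; apply: (gens_group (n := 6) group_ok5); vm_compute.
- by apply: braidP; vm_compute.
- by apply: braidP; vm_compute.
- by apply: braidP; vm_compute.
- by apply: (@table_counts _ _ _ (0, 0, 12)%N table_ok5); vm_compute.
Qed.

Definition zM6 : zmat := (zv 1 (-1) (-2) 0 0 1, zv 0 (-1) (-1) 0 0 0, zv (-1) 0 0 1 1 0)%bZ.

(** The displayed matrix has determinant -1, so the list of the group contains its negative; the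
    same holds for the matrix of the seventh point. *)
Lemma cls_M6 : cls (mx_of_rows 3 [:: [:: 1 - a; - 2; a]; [:: - a; - 1; 0]; [:: - 1; a; 1]]) = cls (evM (zmap zneg zM6)) :> PGL C 3.
Proof.
rewrite evM_neg clsN; last first.
  by apply/unitaryO_unit/zunitaryP.
congr (cls _); rewrite /zM6 /zv /zo /evM /ev ?zr_small.
by congr (mx_of_rows 3 [:: [:: _; _; _]; [:: _; _; _]; [:: _; _; _]]); ring.
Qed.

Lemma point6 (G := isotropy (line (evV q6))) (M := cls (mx_of_rows 3 [:: [:: 1 - a; - 2; a]; [:: - a; - 1; 0]; [:: - 1; a; 1]])) :
  [/\ G = generated [set M], G #= `I_8, RG G #= `I_2,
      RG G = generated [set refl a 1 0] & mirror_counts G 1 0 0].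
Proof.
have AE : refl a 1 0 = cls (evM (zrefl (zv 0 1 1 0 0 0))).
  by apply: refl_cls; [evring|vm_compute|vm_compute].
have rE : RG G = generated (@zgroup C [:: zrefl (zv 0 1 1 0 0 0)]).
  by rewrite /G iso6 (reflection_subgroupE C table_ok6).
split.
- rewrite /G iso6 /M cls_M6 -zgroup1.
  by apply: (gens_group (n := 8) group_ok6); vm_compute.
- by rewrite /G iso6; apply: (group_card group_ok6); vm_compute.
- rewrite rE -(@gens_group [:: z1; zrefl (zv 0 1 1 0 0 0)] _ 1) //.
  by apply: group_card; vm_compute.
- by rewrite rE AE zgroup1.
- by rewrite /G iso6; apply: (@table_counts _ _ _ (1, 0, 0)%N table_ok6); vm_compute.
Qed.

Definition zM7 : zmat := (zv 1 0 2 0 (-2) (-2), zv 0 (-1) (-1) (-2) (-2) 2, zv (-1) (-1) (-2) (-1) (-1) 2)%bZ.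

Lemma cls_M7 : cls (mx_of_rows 3 [:: [:: 1; 2; - 2 - 2 * a]; [:: - a; - 1 - 2 * a; - 2 + 2 * a]; [:: - 1 - a; - 2 - a; - 1 + 2 * a]]) = cls (evM (zmap zneg zM7)) :> PGL C 3.
Proof.
rewrite evM_neg clsN; last first.
  by apply/unitaryO_unit/zunitaryP.
congr (cls _); rewrite /zM7 /zv /zo /evM /ev ?zr_small.
by congr (mx_of_rows 3 [:: [:: _; _; _]; [:: _; _; _]; [:: _; _; _]]); ring.
Qed.

Lemma point7 (G := isotropy (line (evV q7))) (M := cls (mx_of_rows 3 [:: [:: 1; 2; - 2 - 2 * a]; [:: - a; - 1 - 2 * a; - 2 + 2 * a]; [:: - 1 - a; - 2 - a; - 1 + 2 * a]])) :
  [/\ G = generated [set M], G #= `I_4, RG G #= `I_2,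
      RG G = generated [set refl a 1 1] & mirror_counts G 0 1 0].
Proof.
have AE : refl a 1 1 = cls (evM (zrefl (zv 0 1 1 0 1 0))).
  by apply: refl_cls; [evring|vm_compute|vm_compute].
have rE : RG G = generated (@zgroup C [:: zrefl (zv 0 1 1 0 1 0)]).
  by rewrite /G iso7 (reflection_subgroupE C table_ok7).
split.
- rewrite /G iso7 /M cls_M7 -zgroup1.
  by apply: (gens_group (n := 8) group_ok7); vm_compute.
- by rewrite /G iso7; apply: (group_card group_ok7); vm_compute.
- rewrite rE -(@gens_group [:: z1; zrefl (zv 0 1 1 0 1 0)] _ 1) //.
  by apply: group_card; vm_compute.
- by rewrite rE AE zgroup1.
- by rewrite /G iso7; apply: (@table_counts _ _ _ (0, 1, 0)%N table_ok7); vm_compute.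
Qed.

End Points.

Arguments zmul : simpl never.
Arguments zadd : simpl never.

(** * The isomorphism with G_12 *)

Definition zmat2 := ((zq * zq) * (zq * zq))%type.

Definition zmm2 (m n : zmat2) : zmat2 :=
  let: ((a, b), (c, d)) := m in let: ((a', b'), (c', d')) := n in
  ((zadd (zmul a a') (zmul b c'), zadd (zmul a b') (zmul b d')),
   (zadd (zmul c a') (zmul d c'), zadd (zmul c b') (zmul d d'))).
Definition zmap2 (f : zq -> zq) (m : zmat2) : zmat2 :=
  let: ((a, b), (c, d)) := m in ((f a, f b), (f c, f d)).
Definition zhalf (x : zq) : zq :=
  let: (a, b, c, d) := x in (a / 2, b / 2, c / 2, d / 2)%bZ.
Definition ztwo : zmat2 := ((zz 2, zz 0), (zz 0, zz 2)).

(* [n] stands for the matrix [n / 2] *)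
Definition hmul (m n : zmat2) : zmat2 := zmap2 zhalf (zmm2 m n).
(** [zhalf] rounds down; this test says that the halving loses nothing. *)
Definition hexact (m n : zmat2) : bool := zmap2 (zmul (zz 2)) (hmul m n) == zmm2 m n.

Definition pmul (x y : zmat * zmat2) := (zmm x.1 y.1, hmul x.2 y.2).

Fixpoint pgen (n : nat) (gens acc : seq (zmat * zmat2)) :=
  if n is k.+1 then pgen k gens (undup (acc ++ [seq pmul x g | x <- acc, g <- gens]))
  else acc.

(** Twice the defining generators of [G12], written with 2 / sqrt 2 = sqrt 2. *)
Definition gens12 : seq zmat2 :=
  [:: (((0, 0, 1, 0), (0, 0, -1, 0)), ((0, 0, -1, 0), (0, 0, -1, 0)));
      (((0, 0, 1, 0), (0, 0, 1, 0)), ((0, 0, 1, 0), (0, 0, -1, 0)));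
      (((0, 0, 0, 0), (0, 1, 1, 0)), ((0, -1, 1, 0), (0, 0, 0, 0)))]%bZ.

Definition pgens : seq (zmat * zmat2) :=
  [:: (zrefl (zv 0 0 0 1 1 0),
       (((0, 0, -1, 0), (0, 1, 0, 0)), ((0, -1, 0, 0), (0, 0, 1, 0))));
      (zrefl (zv 1 1 2 0 1 (-1)),
       (((0, 0, -1, 0), (0, 0, 1, 0)), ((0, 0, 1, 0), (0, 0, 1, 0))));
      (zrefl (zv 1 1 2 (-1) 0 (-1)),
       (((0, 0, 0, 0), (0, 1, 1, 0)), ((0, -1, 1, 0), (0, 0, 0, 0))))]%bZ.

(** The pairs generate the graph of the isomorphism inside the product of the two groups: both
    projections of the list are injective. *)
Definition ptable : seq (zmat * zmat2) := pgen 6 pgens [:: (z1, ztwo)].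

Fixpoint hgen (n : nat) (gens acc : seq zmat2) :=
  if n is k.+1 then hgen k gens (undup (acc ++ [seq hmul x g | x <- acc, g <- gens]))
  else acc.

Fixpoint hgen_exact (n : nat) (gens acc : seq zmat2) : bool :=
  if n is k.+1 then
    all (fun x => all (hexact x) gens) acc &&
    hgen_exact k gens (undup (acc ++ [seq hmul x g | x <- acc, g <- gens]))
  else true.

Definition ptable_ok (T : seq (zmat * zmat2)) (l : seq zmat) (h : seq zmat2) : bool :=
  [&& zsub l (map fst T), zsub (map fst T) l, uniq (map fst T), uniq (map snd T),
      all (fun x => all (fun y => (pmul x y \in T) && hexact x.2 y.2) T) T,
      all (fun n => n \in map snd T) gens12, all (fun n => n \in h) (map snd T)
    & all (fun x => has (fun y => (hmul x y == ztwo) && (hmul y x == ztwo)) (map snd T)) (map snd T)].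

Lemma ptable_okP : ptable_ok ptable list5 (hgen 6 gens12 [:: ztwo]).
Proof. by vm_compute. Qed.
Lemma hgen_exactP : hgen_exact 6 gens12 [:: ztwo].
Proof. by vm_compute. Qed.

Section G12Isomorphism.
Variable C : numClosedFieldType.
Notation evM := (@evM C).
Notation ev := (@ev C).

Definition evM2 (m : zmat2) : 'M[C]_2 :=
  let: ((a, b), (c, d)) := m in
  2^-1 *: mx_of_rows 2 [:: [:: ev a; ev b]; [:: ev c; ev d]].

Ltac mx22 := apply/matrixP; let i := fresh "i" in let j := fresh "j" in
  move=> i j; rewrite ?mxE ?big_ord_recl ?big_ord0 ?mxE;
  case: i => [[|[|]]] // ?; case: j => [[|[|]]] // ?; rewrite /= ?mxE.

Lemma evM2_inj : injective evM2.
Proof.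
have t0 : 2^-1 != 0 :> C by rewrite invr_eq0 pnatr_eq0.
case=> [[a b] [c d]] [[a' b'] [c' d']] /(scalerI t0)/matrixP h.
have := (h 0 0, h 0 1); have := (h 1 0, h 1 1).
by rewrite !mxE /= => -[/ev_inj-> /ev_inj->] [/ev_inj-> /ev_inj->].
Qed.

Lemma evM2_two : evM2 ztwo = 1%:M.
Proof.
have e2 : ev (zz 2%bZ) = 2 by rewrite ev_zz.
have t0 : 2 != 0 :> C by rewrite pnatr_eq0.
by mx22; rewrite ?ev0 ?mulr0 // -[X in ev X]/(zz 2%bZ) e2 mulVf.
Qed.

Lemma evM2_mul m n : hexact m n -> evM2 (hmul m n) = evM2 m *m evM2 n.
Proof.
rewrite /hexact; set k := hmul m n => /eqP hk.
have h2 : 2 *: evM2 k = 2 *: (evM2 m *m evM2 n).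
  transitivity (evM2 (zmap2 (zmul (zz 2%bZ)) k)).
    case: k {hk} => [[a b] [c d]]; mx22; rewrite !ev_mul ev_zz;
      (have -> : zr C 2%bZ = 2 by []); ring.
  rewrite hk; case: m {k hk} => [[a b] [c d]]; case: n => [[a' b'] [c' d']].
  by mx22; rewrite !(evD, ev_mul); field.
by apply: scalerI h2; rewrite pnatr_eq0.
Qed.

Definition h12 (m : zmat2) : GL C 2 := toGL (evM2 m).
Variables (T : seq (zmat * zmat2)) (l : seq zmat) (k : nat).
Hypothesis T_ok : ptable_ok T l (hgen k gens12 [:: ztwo]).
Hypothesis T_exact : hgen_exact k gens12 [:: ztwo].
Hypothesis T1 : ztwo \in map snd T.
Hypothesis l_ok : zgroupb l.

Lemma h12_unit m : m \in map snd T -> evM2 m \in unitmx.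
Proof.
move=> mT; have := T_ok.
case/andP=> _ /andP[_ /andP[_ /andP[_ /andP[ex /andP[_ /andP[_ /allP inv]]]]]].
have /hasP[n nT /andP[/eqP mn _]] := inv _ mT.
have [x xT mE] := mapP mT; have [y yT nE] := mapP nT.
have /allP/(_ _ yT)/andP[_ e] := allP ex _ xT.
have := evM2_mul e; rewrite -mE -nE mn evM2_two => h.
by have [] := mulmx1_unit (esym h).
Qed.

Lemma h12_mul m n : m \in map snd T -> n \in map snd T -> hexact m n ->
  h12 (hmul m n) = (h12 m * h12 n)%g.
Proof. by move=> mT nT e; rewrite /h12 evM2_mul // toGL_mul ?h12_unit. Qed.

Lemma h12_two : h12 ztwo = 1%g.
Proof. by apply: val_inj; rewrite /h12 -![val _]/(glval _) val_toGL evM2_two ?unitmx1. Qed.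

Lemma h12_inj : {in map snd T &, injective h12}.
Proof.
move=> m n mT nT /(congr1 (@glval _ _)); rewrite !val_toGL ?h12_unit //.
exact: evM2_inj.
Qed.

(** The second projection of the table contains the generators, is closed under products and
    inverses, and consists of words in the generators. *)
Lemma G12E : G12 C = [set h12 m | m in [set` map snd T]].
Proof.
have := T_ok.
case/andP=> _ /andP[_ /andP[_ /andP[_ /andP[/allP ex /andP[/allP gT /andP[/allP Th /allP inv]]]]]].
have genE : [set toGL ((sqrtC 2)^-1 *: M) | M in
    [set mx_of_rows 2 [:: [:: 1; -1]; [:: -1; -1]];
         mx_of_rows 2 [:: [:: 1; 1]; [:: 1; -1]];
         mx_of_rows 2 [:: [:: 0; 1 + 'i]; [:: 1 - 'i; 0]]]] =
   [set h12 m | m in [set` gens12]] :> set (GL C 2).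
  have hs : (sqrtC 2)^-1 = 2^-1 * sqrtC 2 :> C.
    have t0 : 2 != 0 :> C by rewrite pnatr_eq0.
    have := s2E C; have := s2_neq0 C; set s := sqrtC 2 => s0 ss.
    by apply: (mulfI s0); rewrite mulfV // mulrCA ss mulVf.
  have ea : alpha C = sqrtC 2 * 'i by rewrite /alpha mulrC.
  have e1 : (sqrtC 2)^-1 *: mx_of_rows 2 [:: [:: 1; -1]; [:: -1; -1]] = evM2 (nth ztwo gens12 0).
    by rewrite hs; mx22; rewrite /ev !zr_small; ring.
  have e2 : (sqrtC 2)^-1 *: mx_of_rows 2 [:: [:: 1; 1]; [:: 1; -1]] = evM2 (nth ztwo gens12 1).
    by rewrite hs; mx22; rewrite /ev !zr_small; ring.
  have e3 : (sqrtC 2)^-1 *: mx_of_rows 2 [:: [:: 0; 1 + 'i]; [:: 1 - 'i; 0]] = evM2 (nth ztwo gens12 2).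
    by rewrite hs; mx22; rewrite /ev !zr_small ?ea; ring.
  apply/seteqP; split.
    move=> _ [M [[->|->]|->] <-]; rewrite ?e1 ?e2 ?e3.
    - by exists (nth ztwo gens12 0).
    - by exists (nth ztwo gens12 1).
    - by exists (nth ztwo gens12 2).
  move=> _ [m + <-]; rewrite /= !inE => /or3P[]/eqP->.
  - by exists (mx_of_rows 2 [:: [:: 1; -1]; [:: -1; -1]]); [left; left|rewrite e1].
  - by exists (mx_of_rows 2 [:: [:: 1; 1]; [:: 1; -1]]); [left; right|rewrite e2].
  - by exists (mx_of_rows 2 [:: [:: 0; 1 + 'i]; [:: 1 - 'i; 0]]); [right|rewrite e3].
have mulT m n : m \in map snd T -> n \in map snd T ->
    hexact m n /\ hmul m n \in map snd T.
  move=> /mapP[x xT ->] /mapP[y yT ->]; have /allP/(_ _ yT)/andP[xy e] := ex _ xT.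
  by split=> //; apply/mapP; exists (pmul x y).
rewrite /G12 genE; apply/seteqP; split.
  apply: generated_sub; last by move=> _ [m mg <-]; exists m => //; apply: gT.
  split.
  - by exists ztwo => //; exact: h12_two.
  - move=> _ _ [m mT <-] [n nT <-]; have [e mn] := mulT _ _ mT nT.
    by exists (hmul m n) => //; rewrite h12_mul.
  - move=> _ [m mT <-]; have /hasP[n nT /andP[/eqP mn /eqP nm]] := inv _ mT.
    exists n => //; apply: (mulIg (h12 m)); rewrite mulVg -h12_mul ?nm ?h12_two //.
    by have [] := mulT _ _ nT mT.
have [G1 GM GV] := generated_subgroup [set h12 m | m in [set` gens12]].
have key n acc : {subset acc <= map snd T} -> hgen_exact n gens12 acc ->
    (forall m, m \in acc -> generated [set h12 m | m in [set` gens12]] (h12 m)) ->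
    forall m, m \in hgen n gens12 acc -> generated [set h12 m | m in [set` gens12]] (h12 m).
  elim: n acc => [//|n IH] acc aT /andP[/allP exa exn] aG.
  have hx x g : x \in acc -> g \in gens12 -> h12 (hmul x g) = (h12 x * h12 g)%g.
    by move=> xa gg; apply: h12_mul; [exact: aT|exact: gT|exact: (allP (exa _ xa))].
  apply: IH exn _.
    move=> m; rewrite mem_undup mem_cat => /orP[/aT//|/allpairsP[[x g] /= [xa gg ->]]].
    by have [] := mulT _ _ (aT _ xa) (gT _ gg).
  move=> m; rewrite mem_undup mem_cat => /orP[/aG//|/allpairsP[[x g] /= [xa gg ->]]].
  rewrite hx //; apply: GM; first exact: aG.
  by apply: sub_generated; exists g.
move=> _ [m mT <-]; apply: (key k [:: ztwo]).
- by move=> x; rewrite inE => /eqP ->.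
- exact: T_exact.
- by move=> x; rewrite inE => /eqP ->; rewrite h12_two.
- exact: Th.
Qed.

Lemma table_iso : isomorphic_groups (@zgroup C l) (G12 C).
Proof.
have := T_ok.
case/andP=> /allP lT /andP[/allP Tl /andP[uT1 /andP[uT2 /andP[/allP ex _]]]].
have /and3P[/allP hl _ _] := l_ok.
have cT x : x \in T -> zdet1 x.1 by move=> xT; apply/hl/Tl/map_f.
have cinj : {in T &, injective (fun x : zmat * zmat2 => cls (evM x.1))}.
  move=> x y xT yT h; apply: (uniq_map_inj uT1) => //.
  have /andP[ux /eqP dx] := cT _ xT; have /andP[uy /eqP dy] := cT _ yT.
  exact: cls_zinj h.
(* The map looks a class up in the table; the default pair is returned only outside the group. *)
pose ff (g : PGL C 3) := h12 (nth (z1, ztwo) T (find (fun x => `[< cls (evM x.1) = g >]) T)).2.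
have fE x : x \in T -> ff (cls (evM x.1)) = h12 x.2.
  move=> xT; have hx : has (fun y => `[< cls (evM y.1) = cls (evM x.1) >]) T.
    by apply/hasP; exists x => //; apply/asboolP.
  have /asboolP e := nth_find (z1, ztwo) hx.
  rewrite /ff; congr (h12 _.2); apply: cinj => //.
  by apply: mem_nth; rewrite -has_find.
have gE g : @zgroup C l g -> exists2 x, x \in T & g = cls (evM x.1).
  by move=> [m ml <-]; have /mapP[x xT ->] := lT _ ml; exists x.
exists ff.
  split.
  - move=> _ /gE[x xT ->]; rewrite fE // G12E; exists x.2 => //; exact: map_f.
  - move=> _ _ /set_mem/gE[x xT ->] /set_mem/gE[y yT ->]; rewrite !fE // => h.
    have := h12_inj (map_f snd xT) (map_f snd yT) h => /(uniq_map_inj uT2 xT yT).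
    by move=> ->.
  - rewrite G12E => _ [m /= /mapP[x xT ->] <-]; exists (cls (evM x.1)); last exact: fE.
    by exists x.1 => //; apply/Tl/map_f.
move=> _ _ /gE[x xT ->] /gE[y yT ->].
have /allP/(_ _ yT)/andP[xyT e] := ex _ xT.
rewrite -clsM ?zdet1_unit ?cT // -evM_mul -[zmm _ _]/(pmul x y).1 !fE //.
by rewrite h12_mul ?map_f.
Qed.

End G12Isomorphism.

Lemma group5_iso (C : numClosedFieldType) : isomorphic_groups (@zgroup C list5) (G12 C).
Proof.
apply: (table_iso (T := ptable) C ptable_okP hgen_exactP _ group_ok5).
by vm_compute.
Qed.

(* [mu_i / sqrt 2] is the eigenvalue of [m] at [e_i] *)
Definition eigen_ok (m : zmat) (e1 e2 e3 : zvec) (mu1 mu2 mu3 : zq) : bool :=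
  let s v := zvmap (zmul (0, 0, 1, 0)%bZ) v in
  [&& s (zmv m e1) == zvmap (zmul mu1) e1, s (zmv m e2) == zvmap (zmul mu2) e2,
      s (zmv m e3) == zvmap (zmul mu3) e3, mu2 != mu1, mu3 != mu1,
      zdet (ztr (e1, e2, e3)) != zz 0 & (zherm e2 e1 == zz 0) && (zherm e3 e1 == zz 0)].

Lemma subr3 (V : zmodType) (x1 x2 x3 y1 y2 y3 : V) :
  (x1 - y1) + (x2 - y2) + (x3 - y3) = (x1 + x2 + x3) - (y1 + y2 + y3).
Proof. by rewrite (addrACA x1) (addrACA (x1 + x2)) -!opprD. Qed.

(** * Unique fixed points and their irrationality *)

Section FixedPoints.
Variable C : numClosedFieldType.
Notation evM := (@evM C).
Notation evV := (@evV C).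
Notation ev := (@ev C).
Notation a := (alpha C).

Lemma ev_s2 : ev (0, 0, 1, 0)%bZ = sqrtC 2.
Proof. by rewrite /ev !zr_small; ring. Qed.

Lemma evM_tr c1 c2 c3 (y : 'cV[C]_3) : evM (ztr (c1, c2, c3)) *m y =
  y 0 0 *: evV c1 + y 1 0 *: evV c2 + y 2 0 *: evV c3.
Proof.
case: c1 => [[a1 a2] a3]; case: c2 => [[b1 b2] b3]; case: c3 => [[d1 d2] d3].
have l1 : lift ord0 ord0 = 1 :> 'I_3 by apply: val_inj.
have l2 : lift ord0 (lift ord0 ord0) = 2 :> 'I_3 by apply: val_inj.
by cv3; rewrite ?l1 ?l2 !ord1; ring.
Qed.

(** Since [e2] and [e3] are orthogonal to the negative [e1], a negative fixed vector has a nonzero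
    component along [e1]. Its eigenvalue is therefore the one of [e1], which differs from the other
    two. *)
Lemma fixed_point_unique m e1 e2 e3 mu1 mu2 mu3 : zdet1 m ->
  eigen_ok m e1 e2 e3 mu1 mu2 mu3 -> herm (evV e1) (evV e1) < 0 ->
  H2 `&` [set x | act (cls (evM m)) x = x] = [set line (evV e1)].
Proof.
move=> dm /andP[/eqP h1 /andP[/eqP h2 /andP[/eqP h3 /andP[m21 /andP[m31 /andP[d0 /andP[/eqP o2 /eqP o3]]]]]]] neg.
have um := zdet1_unit C dm.
have s0 := s2_neq0 C; set s := sqrtC 2 in s0.
have ei e mu : zvmap (zmul (0, 0, 1, 0)%bZ) (zmv m e) = zvmap (zmul mu) e ->
    s *: (evM m *m evV e) = ev mu *: evV e.
  by move=> /(congr1 evV); rewrite !evV_scale evM_mulV ev_s2.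
have {}h1 := ei _ _ h1; have {}h2 := ei _ _ h2; have {}h3 := ei _ _ h3.
have e10 := herm_ltr0_neq0 neg.
apply/seteqP; split; last first.
  move=> _ ->; split; first by exists (evV e1).
  rewrite /= act_cls //.
  have Ae : evM m *m evV e1 = (s^-1 * ev mu1) *: evV e1.
    by apply: (scalerI s0); rewrite h1 scalerA mulrA mulfV // mul1r.
  rewrite Ae lineZ //; apply: contraNneq e10 => c0.
  by rewrite -(mulKmx um (evV e1)) Ae c0 scale0r mulmx0.
move=> _ [[v v0 ->] /=]; rewrite act_cls // => /(line_eq (herm_ltr0_neq0 v0))[c _ Av].
pose P := evM (ztr (e1, e2, e3)); pose y := invmx P *m v.
have uP : P \in unitmx.
  rewrite unitmxE unitfE -ev_det; apply: contraNneq d0 => h; apply/eqP/(@ev_inj C).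
  by rewrite h ev0.
have vE : v = y 0 0 *: evV e1 + y 1 0 *: evV e2 + y 2 0 *: evV e3.
  by rewrite -evM_tr mulKVmx.
clearbody y.
have he2 : herm (evV e2) (evV e1) = 0 by rewrite -ev_herm o2 ev0.
have he3 : herm (evV e3) (evV e1) = 0 by rewrite -ev_herm o3 ev0.
have y0 : y 0 0 != 0.
  apply/eqP => y00; have h : herm v (evV e1) = 0.
    by rewrite vE !hermlin y00 mul0r he2 he3 !mulr0 !addr0.
  by have := lt_trans v0 (herm_perp_gt0 neg h (herm_ltr0_neq0 v0)); rewrite ltxx.
(* These are the components along the eigenvectors of the zero vector s c v - s (m v). *)
have hy : evM (ztr (e1, e2, e3)) *m (\col_i [:: (s * c - ev mu1) * y 0 0; (s * c - ev mu2) * y 1 0;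
   (s * c - ev mu3) * y 2 0]`_i) = 0.
  rewrite evM_tr !mxE /=.
  have hs : s *: (evM m *m v) = (s * c) *: v by rewrite Av scalerA.
  have split_scale k t (u : 'cV[C]_3) :
      ((s * c - k) * t) *: u = (s * c) *: (t *: u) - t *: (k *: u).
    by rewrite mulrBl scalerBl !scalerA [t * k]mulrC.
  rewrite !split_scale subr3 -!scalerDr -vE -hs.
  rewrite [in s *: _]vE !mulmxDr -!scalemxAr !scalerDr ![s *: (_ *: _)]scalerA ![s * y _ _]mulrC.
  by rewrite -!scalerA h1 h2 h3 subrr.
have {hy} hy := canRL (mulKmx uP) hy; rewrite mulmx0 in hy.
have /matrixP hz := hy.
have := hz 0 0; have := hz 1 0; have := hz 2 0; rewrite !mxE /= => z3 z2 z1.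
have sc : s * c = ev mu1.
  by apply/eqP; rewrite -subr_eq0; move/eqP: z1; rewrite mulf_eq0 (negbTE y0) orbF.
have kill mu t : mu != mu1 -> (s * c - ev mu) * t = 0 -> t = 0.
  move=> mn /eqP; rewrite mulf_eq0 sc subr_eq0 => /orP[/eqP/(@ev_inj C) e|/eqP //].
  by rewrite e eqxx in mn.
rewrite vE (kill _ _ m21 z2) (kill _ _ m31 z3) !scale0r !addr0.
by rewrite /= lineZ.
Qed.

Lemma Qalpha_int z : Qalpha C z ->
  exists d m n : Z, d <> 0%bZ /\ zr C d * z = ev (zo m n).
Proof.
move=> [q [r ->]].
have zi (k : int) : zr C (Z_of_int k) = k%:~R by rewrite /zr Z_of_intK.
exists (Z_of_int (denq q * denq r)), (Z_of_int (numq q * denq r)), (Z_of_int (numq r * denq q)).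
have dq : denq q != 0 := denq_neq0 q; have dr : denq r != 0 := denq_neq0 r.
have dq' : (denq q)%:~R != 0 :> C by rewrite intr_eq0.
have dr' : (denq r)%:~R != 0 :> C by rewrite intr_eq0.
split; first by move: dq dr; lia.
rewrite /ev /zo !zi !zr_small !intrM /ratr; field.
by rewrite dq' dr'.
Qed.

Lemma zmul_zo x1 x2 x3 x4 m n : zmul (x1, x2, x3, x4) (zo m n) =
  (x1 * m - 2 * (x2 * n), x1 * n + x2 * m, x3 * m - x4 * n, x4 * m + 2 * (x3 * n))%bZ.
Proof. by rewrite /zmul /zo; congr (_, _, _, _); lia. Qed.

Lemma zmul_zz k x1 x2 x3 x4 : zmul (zz k) (x1, x2, x3, x4) =
  (k * x1, k * x2, k * x3, k * x4)%bZ.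
Proof. by rewrite /zmul /zz; congr (_, _, _, _); lia. Qed.

(** The quotient of the first and third coordinates would lie in Q(i sqrt 2), whereas the third is a
    positive integer and the first has a nonzero component along sqrt 2 or i. *)
Lemma not_rational (q1 q2 q3 : zq) (v : 'cV[C]_3) : inO q3 -> q3 = zz (zre q3) ->
  (0 < zre q3)%bZ -> (q1.1.2 != 0 \/ q1.2 != 0)%bZ ->
  line v = line (evV (q1, q2, q3)) -> ~ (forall i, Qalpha C (v i 0)).
Proof.
move=> _ q3E q30 q1n vl hv.
have w0 : evV (q1, q2, q3) != 0.
  apply/eqP => /matrixP/(_ 2 0); rewrite !mxE /= q3E ev_zz => /(@zr_inj C _ 0); lia.
have [c c0 vE] := line_eq w0 vl.
have [d [m [n [d0 e0]]]] := Qalpha_int (hv 0).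
have [d' [m' [n' [d0' e2]]]] := Qalpha_int (hv 2).
rewrite vE !mxE /= in e0 e2.
have h : zmul (zz (d' * zre q3)) (zo m n) = zmul (zz d) (zmul q1 (zo m' n')).
  by apply: (@ev_inj C); rewrite !ev_mul !ev_zz -e0 -e2 q3E ev_zz zrM /=; ring.
have [m0 n0] : m' = 0%bZ /\ n' = 0%bZ.
  move: h q1n; move: (d' * zre q3)%bZ => k; case: (q1) => [[[x1 x2] x3] x4].
  rewrite !zmul_zo zmul_zz => h q1n.
  have h3 := congr1 (fun x : zq => x.1.2) h; have h4 := congr1 snd h.
  cbv [fst snd] in h3, h4, q1n.
  have {}q1n : (0 < x3 * x3 + x4 * x4)%bZ by case: q1n => /eqP; nia.
  (* The components along sqrt 2 and i form a linear system for m' and n' of determinant 2 x3^2 +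
     x4^2. *)
  have k3 : (x3 * m' - x4 * n' = 0)%bZ.
    have : (d * (x3 * m' - x4 * n') = 0)%bZ by move: h3; clear; lia.
    by move/Z.mul_eq_0; case.
  have k4 : (x4 * m' + 2 * (x3 * n') = 0)%bZ.
    have : (d * (x4 * m' + 2 * (x3 * n')) = 0)%bZ by move: h4; clear; lia.
    by move/Z.mul_eq_0; case.
  have q2n : (2 * (x3 * x3) + x4 * x4 <> 0)%bZ by nia.
  have km : ((2 * (x3 * x3) + x4 * x4) * m' = 0)%bZ.
    have -> : ((2 * (x3 * x3) + x4 * x4) * m' =
      2 * x3 * (x3 * m' - x4 * n') + x4 * (x4 * m' + 2 * (x3 * n')))%bZ by lia.
    by rewrite k3 k4; lia.
  have kn : ((2 * (x3 * x3) + x4 * x4) * n' = 0)%bZ.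
    have -> : ((2 * (x3 * x3) + x4 * x4) * n' =
      x3 * (x4 * m' + 2 * (x3 * n')) - x4 * (x3 * m' - x4 * n'))%bZ by lia.
    by rewrite k3 k4; lia.
  by move/Z.mul_eq_0: km; move/Z.mul_eq_0: kn; case=> // -> [] // ->.
have e3 : ev q3 = zr C (zre q3) by rewrite {1}q3E ev_zz.
have : zr C d' * (c * ev q3) != 0.
  rewrite e3 mulf_neq0 //; first by apply/eqP => /(@zr_inj C _ 0).
  by rewrite mulf_neq0 //; apply/eqP => /(@zr_inj C _ 0); lia.
by rewrite e2 m0 n0 -[zo 0 0]/(zz 0) ev0 eqxx.
Qed.

Lemma q6_neg : herm (evV q6) (evV q6) < 0.
Proof.
have -> : herm (evV q6) (evV q6) = ev (0, 0, -4, 0)%bZ.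
  by rewrite -ev_herm; congr ev; vm_compute.
have -> : ev (0, 0, -4, 0)%bZ = - (4 * sqrtC 2).
  have z4 : zr C (-4)%bZ = - 4 by [].
  by rewrite /ev z4 !zr_small; ring.
by rewrite oppr_lt0 mulr_gt0 ?ltr0n ?s2_gt0.
Qed.

Lemma q7_neg : herm (evV q7) (evV q7) < 0.
Proof.
have -> : herm (evV q7) (evV q7) = ev (2, 0, -2, 0)%bZ.
  by rewrite -ev_herm; congr ev; vm_compute.
have -> : ev (2, 0, -2, 0)%bZ = 2 * (1 - sqrtC 2).
  by rewrite /ev !zr_small; ring.
rewrite pmulr_rlt0 ?ltr0n // subr_lt0 -[X in X < _]sqrtC1.
by rewrite ltr_sqrtC ?qualifE /= ?ler01 ?ler0n // (ltr_nat _ 1 2).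
Qed.

Lemma fixed6 : H2 `&` [set x | act (cls (mx_of_rows 3
    [:: [:: 1 - a; - 2; a]; [:: - a; - 1; 0]; [:: - 1; a; 1]])) x = x] = [set line (evV q6)].
Proof.
rewrite cls_M6; apply: (@fixed_point_unique _ q6 ((-2, 1, 1, 0), (0, 2, 0, 0), (2, 0, 0, 0))%bZ
  ((0, 1, 0, 0), (1, 0, 0, 0), (0, 0, 0, 0))%bZ (-1, 0, 0, 1)%bZ (1, 0, 0, 1)%bZ (0, 0, -1, 0)%bZ).
- by vm_compute.
- by vm_compute.
- exact: q6_neg.
Qed.

Lemma fixed7 : H2 `&` [set x | act (cls (mx_of_rows 3
    [:: [:: 1; 2; - 2 - 2 * a]; [:: - a; - 1 - 2 * a; - 2 + 2 * a];
        [:: - 1 - a; - 2 - a; - 1 + 2 * a]])) x = x] = [set line (evV q7)].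
Proof.
rewrite cls_M7; apply: (@fixed_point_unique _ q7 ((-1, 0, 0, -1), (1, 1, 0, 1), (1, 0, 0, 0))%bZ
  ((0, 1, 0, 0), (1, 0, 0, 0), (1, 0, 0, 0))%bZ (0, -1, 0, 0)%bZ (0, 1, 0, 0)%bZ (0, 0, 1, 0)%bZ).
- by vm_compute.
- by vm_compute.
- exact: q7_neg.
Qed.

Lemma irrational67 v : (line (evV q6) = line v \/ line (evV q7) = line v) ->
  ~ (forall i, Qalpha C (v i 0)).
Proof.
case=> vl.
  by apply: (@not_rational (-2, 1, -1, 0)%bZ (0, 2, 0, 0)%bZ (2, 0, 0, 0)%bZ v _ _ _ _ (esym vl)) => //; left.
by apply: (@not_rational (-1, 0, 0, 1)%bZ (1, 1, 0, -1)%bZ (1, 0, 0, 0)%bZ v _ _ _ _ (esym vl)) => //; right.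
Qed.

End FixedPoints.

(** * Lattices over O_2 *)

Lemma int_round (m a : int) : 0 < a -> exists p : int, 4 * ((m - p * a) * (m - p * a)) <= a * a.
Proof.
(* Rounding m/a + 1/2 down gives a nearest integer to m/a. *)
move=> a0; exists ((2 * m + a) %/ (2 * a))%Z.
have h1 := divz_eq (2 * m + a) (2 * a).
have h2 : 0 <= ((2 * m + a) %% (2 * a))%Z by apply: modz_ge0; lia.
have h3 : ((2 * m + a) %% (2 * a))%Z < 2 * a by apply: ltz_pmod; lia.
move: h1 h2 h3; move: (_ %/ _)%Z (_ %% _)%Z => p r h1 h2 h3.
have h : 2 * (m - p * a) = r - a by lia.
have -> : 4 * ((m - p * a) * (m - p * a)) = (r - a) * (r - a) by rewrite -h; ring.
nia.
Qed.

Section Lattice.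
Variable C : numClosedFieldType.
Implicit Types (u v w z : 'cV[C]_3) (A : 'M[C]_3).
Notation a := (alpha C).

Definition O3 v := forall i, O2 (v i 0).

Definition oint (m n : int) : C := m%:~R + n%:~R * a.

Lemma O2_oint m n : O2 (oint m n). Proof. by exists m, n. Qed.

Lemma oint_conj m n : (oint m n)^* = oint m (- n).
Proof.
by rewrite /oint rmorphD (rmorphM _ n%:~R) /= alpha_conj !(CrealP _) ?realz // rmorphN /=; ring.
Qed.

Lemma oint_norm m n : oint m n * (oint m n)^* = (m * m + 2 * (n * n))%:~R.
Proof.
rewrite oint_conj /oint !(intrD, intrM, rmorphN) /=.
by have := alphaE C; set b := alpha C => b2; ring: b2.
Qed.

Lemma oint_inj m n m' n' : oint m n = oint m' n' -> m = m' /\ n = n'.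
Proof.
have e (k l : int) : oint k l = ev C (zo (Z_of_int k) (Z_of_int l)).
  by rewrite /oint /ev /zo /zr !Z_of_intK; ring.
by rewrite !e => /ev_inj[/(can_inj Z_of_intK)-> /(can_inj Z_of_intK)->].
Qed.

Lemma O2_real_int (x : C) : O2 x -> x \is Num.real -> exists m : int, x = m%:~R.
Proof.
move=> [m [n ->]] /CrealP; rewrite -/(oint m n) oint_conj => /oint_inj[_ nn].
have n0 : n = 0 by lia.
by exists m; rewrite n0 /oint mul0r addr0.
Qed.

Lemma O2_norm (x : C) : O2 x -> exists2 k : nat, x * x^* = k%:R & (k = 0%N -> x = 0).
Proof.
move=> [m [n ->]]; rewrite -/(oint m n) oint_norm.
exists (absz (m * m + 2 * (n * n))).
  by rewrite -[RHS]/((Posz _)%:~R) gez0_abs //; nia.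
move=> h; have m0 : m = 0 by nia.
have n0 : n = 0 by nia.
by rewrite m0 n0 /oint mul0r addr0.
Qed.

(** Rounding both coordinates to nearest integers leaves an error of norm at most 1/4 + 2/4. *)
Lemma O2_round (x : C) (d : int) : d != 0 -> O2 (d%:~R * x) ->
  exists2 o, O2 o & (x - o) * (x - o)^* <= 3 / 4.
Proof.
move=> d0; wlog dp : d d0 / 0 < d.
  move=> hw hO; case: (ltgtP 0 d) => [dp|dn|de]; first exact: hw hO.
    apply: (hw (- d)); rewrite ?oppr_eq0 ?oppr_gt0 // rmorphN mulNr.
    exact: O2N.
  by rewrite -de eqxx in d0.
move=> [m [n h]]; have [p hp] := int_round m dp; have [q hq] := int_round n dp.
exists (oint p q); first exact: O2_oint.
have dn : d%:~R != 0 :> C by rewrite intr_eq0.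
have dr : (d%:~R)^* = d%:~R :> C by apply/CrealP; rewrite realz.
have e : d%:~R * (x - oint p q) = oint (m - p * d) (n - q * d).
  by rewrite mulrBr h /oint !(intrD, intrM, rmorphN, intrB) /=; ring.
have e2 : (d * d)%:~R * ((x - oint p q) * (x - oint p q)^*) =
    ((m - p * d) * (m - p * d) + 2 * ((n - q * d) * (n - q * d)))%:~R.
  by rewrite -oint_norm -e intrM (rmorphM _ d%:~R) /= dr; ring.
have dd : 0 < (d * d)%:~R :> C by rewrite ltr0z; nia.
rewrite -(ler_pM2l dd) e2 [X in _ <= X]mulrA ler_pdivlMr ?ltr0n //.
rewrite -[4]/(4%:~R) -[3]/(3%:~R) -!intrM ler_int; nia.
Qed.

Lemma O2_euclid (x y : C) : O2 x -> O2 y -> y != 0 ->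
  exists2 o, O2 o & (x - o * y) * (x - o * y)^* < y * y^*.
Proof.
move=> ox oy y0; have [k yk k0] := O2_norm oy.
have kn : k%:R != 0 :> C by rewrite -yk mul_conjC_eq0.
have [||r Or h] := @O2_round (x / y) k.
- by rewrite -(intr_eq0 C).
- rewrite -[k%:~R]/(k%:R) -yk [X in O2 X](_ : _ = x * y^*); last by field.
  by apply: O2M => //; apply: O2C.
exists r => //.
have -> : x - r * y = (x / y - r) * y by field.
have yp : 0 < y * y^* by rewrite lt0r mul_conjC_eq0 y0 mul_conjC_ge0.
rewrite rmorphM /= mulrACA -[X in _ < X]mul1r ltr_pM2r //.
by apply: le_lt_trans h _; rewrite ltr_pdivrMr ?ltr0n // mul1r ltr_nat.
Qed.

Lemma O3D u v : O3 u -> O3 v -> O3 (u + v).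
Proof. by move=> hu hv i; rewrite mxE; apply: O2D. Qed.
Lemma O3Z c v : O2 c -> O3 v -> O3 (c *: v).
Proof. by move=> hc hv i; rewrite mxE; apply: O2M. Qed.
Lemma O3N v : O3 v -> O3 (- v).
Proof. by move=> hv i; rewrite mxE; apply: O2N. Qed.
Lemma O3B u v : O3 u -> O3 v -> O3 (u - v).
Proof. by move=> hu hv; apply/O3D/O3N. Qed.
Lemma O2_herm u v : O3 u -> O3 v -> O2 (herm u v).
Proof. by move=> hu hv; rewrite hermE; do ![apply: O2D|apply: O2M|apply: O2C|exact: hu|exact: hv]. Qed.
Lemma O3_mulmx A v : (forall i j, O2 (A i j)) -> O3 v -> O3 (A *m v).
Proof. by move=> hA hv i; rewrite mxE; apply: O2_sum => k _; apply: O2M. Qed.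
Lemma O3_delta j : O3 (delta_mx j 0).
Proof. by move=> i; rewrite mxE; case: (_ && _); [exact: O21|exact: O20]. Qed.

Lemma herm_int u : O3 u -> exists n : int, herm u u = n%:~R.
Proof. by move=> hu; apply: O2_real_int (herm_real u); apply: O2_herm. Qed.

Lemma vec_delta u : u = \sum_j u j 0 *: delta_mx j 0.
Proof.
apply/matrixP => i j; rewrite summxE (bigD1 i) //= big1 => [|k ki]; rewrite !mxE ?ord1 ?eqxx ?mulr1 ?addr0 //.
by rewrite eq_sym (negbTE ki) mulr0.
Qed.

(* the ideal of O generated by the products with a lattice vector is principal *)
Lemma primitive_vector w : O3 w -> w != 0 ->
  exists g w' z0, [/\ O3 w', O3 z0, herm z0 w' = 1 & w = g *: w'].
Proof.
move=> ow w0.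
pose P k := `[< exists z, O3 z /\ herm z w * (herm z w)^* = k.+1%:R >].
have exP : exists k, P k.
  have : ~ (forall z, O3 z -> herm z w = 0).
    move=> h; case/eqP: w0; apply: herm_nondeg => z; rewrite (vec_delta z) !big_ord_recl big_ord0.
    by rewrite !hermlin herm0l !h ?mulr0 ?addr0 //; exact: O3_delta.
  move/existsNP => [z /not_implyP[ oz /eqP hz]].
  have [k hk k0] := O2_norm (O2_herm oz ow); exists k.-1; apply/asboolP; exists z; split=> //.
  by case: k hk k0 => [_ /(_ erefl) e|k ->] //; rewrite e eqxx in hz.
have [k /asboolP[z0 [ oz0 hk]] kmin] := ex_minnP exP.
set d := herm z0 w in hk; have od : O2 d by apply: O2_herm.
have d0 : d != 0 by rewrite -mul_conjC_eq0 hk pnatr_eq0.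
have hdiv z : O3 z -> exists2 o, O2 o & herm z w = o * d.
  move=> oz; have [r Or ho] := O2_euclid (O2_herm oz ow) od d0; exists r => //.
  have oz' : O3 (z - r *: z0) by apply: O3B => //; apply: O3Z.
  have [l hl l0] := O2_norm (O2_herm oz' ow).
  rewrite !hermlin -/d in hl l0; apply/eqP; rewrite -subr_eq0; apply/eqP/l0.
  case: l hl {l0} => // l hl; have := kmin l; rewrite leqNgt => /(_ _)/negP[].
    by apply/asboolP; exists (z - r *: z0); rewrite !hermlin.
  by move: ho; rewrite hl hk ltr_nat ltnS.
have [b0 ob0 h0] := hdiv _ (O3_delta 0); have [b1 ob1 h1] := hdiv _ (O3_delta 1).
have [b2 ob2 h2] := hdiv _ (O3_delta 2).
(* The matrix [J] reverses the order of the coordinates. *)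
have he (j : 'I_3) : herm (delta_mx j 0) w = (w (rev_ord j) 0)^*.
  by rewrite hermE !mxE; case: j => [[|[|[|]]]] // ? /=; rewrite ?mulr1 ?mulr0 ?addr0 ?add0r;
    congr ((w _ _)^*); apply: val_inj.
pose w' : 'cV[C]_3 := vec3 b2^* b1^* b0^*.
have ww : w = d^* *: w'.
  apply/matrixP => i j; rewrite !mxE ord1; apply: (inv_inj (@conjCK C)).
  have -> : w i 0 = w (rev_ord (rev_ord i)) 0 by rewrite rev_ordK.
  rewrite rmorphM /= conjCK -he.
  case: i => [[|[|[|]]]] // ? /=; rewrite ?conjCK mulrC; [rewrite -h2|rewrite -h1|rewrite -h0];
    by congr (herm (delta_mx _ _) _); apply: val_inj.
exists d^*, w', z0; split=> //.
- by move=> i; rewrite mxE; case: i => [[|[|[|]]]] // ? /=; apply: O2C.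
- have : d = d * herm z0 w' by rewrite /d {1}ww hermZr conjCK.
  by rewrite -[X in X = _ -> _]mulr1 => /(mulfI d0).
Qed.

End Lattice.

(** * Bases of orthogonal lattices, Gram determinants and frames *)

Section Bases.
Variable C : numClosedFieldType.
Implicit Types (u v w z : 'cV[C]_3) (A : 'M[C]_3).
Notation a := (alpha C).
Notation O3 := (@O3 C).

Definition cols (p q r : 'cV[C]_3) : 'M[C]_3 :=
  \matrix_(i, j) (nth 0 [:: p; q; r] j) i 0.

Lemma cols_mul p q r (y : 'cV[C]_3) :
  cols p q r *m y = y 0 0 *: p + y 1 0 *: q + y 2 0 *: r.
Proof.
have l1 : lift ord0 ord0 = 1 :> 'I_3 by apply: val_inj.
have l2 : lift ord0 (lift ord0 ord0) = 2 :> 'I_3 by apply: val_inj.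
apply/matrixP => i j; rewrite !mxE !big_ord_recl big_ord0 !mxE /= ?l1 ?l2 !ord1.
by ring.
Qed.

Lemma cols_O2 p q r : O3 p -> O3 q -> O3 r -> forall i j, O2 (cols p q r i j).
Proof. by move=> hp hq hr i j; rewrite mxE; case: j => [[|[|[|]]]] // ?. Qed.

Lemma det_colsD3 p q r t c : \det (cols p q (r + c *: t)) = \det (cols p q r) + c * \det (cols p q t).
Proof. by rewrite !det33 !mxE /=; ring. Qed.

Lemma det_cols1 s z0 x u y u' :
  \det (cols (s *: z0 + x *: u + y *: u') u u') = s * \det (cols z0 u u').
Proof. by rewrite !det33 !mxE /=; ring. Qed.

Lemma cols_dep p q r : \det (cols p q r) = 0 ->
  exists y : 'cV[C]_3, y != 0 /\ y 0 0 *: p + y 1 0 *: q + y 2 0 *: r = 0.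
Proof.
move=> d0; have /det0P[y y0 hy] : \det (cols p q r)^T == 0 by rewrite det_tr d0.
exists y^T; split; first by rewrite -(inj_eq trmx_inj) trmxK trmx0.
by rewrite -cols_mul; apply: trmx_inj; rewrite trmx_mul trmxK hy trmx0.
Qed.

Lemma cols_gram p q r i j : (adjoint (cols p q r) *m Jmx C *m cols p q r) i j =
  herm (nth 0 [:: p; q; r] j) (nth 0 [:: p; q; r] i).
Proof.
rewrite hermE !mxE !big_ord_recl !big_ord0 !mxE !big_ord_recl !big_ord0 !mxE /=.
have l1 : lift ord0 ord0 = 1 :> 'I_3 by apply: val_inj.
have l2 : lift ord0 (lift ord0 ord0) = 2 :> 'I_3 by apply: val_inj.
by rewrite ?l1 ?l2; ring.
Qed.

Lemma det_J : \det (Jmx C) = -1.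
Proof. by rewrite det33 !mxE /=; ring. Qed.

Lemma det_adjoint A : \det (adjoint A) = (\det A)^*.
Proof. by rewrite /adjoint det_map_mx det_tr. Qed.

Definition perp_lattice w z := O3 z /\ herm z w = 0.

Definition lattice_basis w u u' := [/\ perp_lattice w u, perp_lattice w u' &
  forall z, perp_lattice w z -> exists x y, [/\ O2 x, O2 y & z = x *: u + y *: u']].

Lemma perpZD w x u z : O2 x -> perp_lattice w u -> perp_lattice w z -> perp_lattice w (z + x *: u).
Proof.
move=> ox [ ou uw] [ oz zw]; split; first by apply: O3D => //; apply: O3Z.
by rewrite !hermlin uw zw mulr0 addr0.
Qed.

Lemma basis_shift w u u' r : O2 r -> lattice_basis w u u' -> lattice_basis w u (u' + r *: u).
Proof.
move=> Or [pu pu' hb]; split=> //; first exact: perpZD.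
move=> z /hb[x [y [ox oy ->]]]; exists (x - y * r), y; split=> //.
  by apply: O2B => //; apply: O2M.
by rewrite scalerDr scalerBl scalerA addrCA addrC subrK addrC.
Qed.

Section Primitive.
Variables w z0 : 'cV[C]_3.
Hypotheses (ow : O3 w) (oz0 : O3 z0) (z0w : herm z0 w = 1) (ww : herm w w != 0).

(** Because [herm z0 w = 1], the projection along [z0] is integral, and the lattice is the direct
    sum of O_2 [z0] and the part orthogonal to [w]. *)
Lemma perp_proj z : O3 z -> perp_lattice w (z - herm z w *: z0).
Proof.
move=> oz; split; last by rewrite !hermlin z0w mulr1 subrr.
by apply: O3B => //; apply: O3Z => //; apply: O2_herm.
Qed.

Lemma perp_line u z : u != 0 -> herm u w = 0 -> herm z w = 0 -> \det (cols w u z) = 0 ->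
  exists x, z = x *: u.
Proof.
move=> u0 uw zw /cols_dep[y [y0 hy]].
have y00 : y 0 0 = 0.
  have := congr1 (fun t : 'cV[C]_3 => herm t w) hy.
  rewrite !hermlin uw zw !mulr0 !addr0 herm0l => /eqP.
  by rewrite mulf_eq0 (negbTE ww) orbF => /eqP.
rewrite y00 scale0r add0r in hy.
have y20 : y 2 0 != 0.
  apply: contraNneq y0 => y20; rewrite y20 scale0r addr0 in hy.
  have y10 : y 1 0 = 0 by move/eqP: hy; rewrite scaler_eq0 (negbTE u0) orbF => /eqP.
  by apply/eqP/matrixP => i j; rewrite mxE ord1; case: i => [[|[|[|]]]] // p;
    [rewrite -y00|rewrite -y10|rewrite -y20]; congr (y _ _); apply: val_inj.
exists (- (y 2 0)^-1 * y 1 0); apply: (scalerI y20).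
by rewrite scalerA mulrA mulrN mulfV // mulN1r scaleNr; apply/eqP; rewrite -addr_eq0 addrC hy.
Qed.

(** Choose [u'] with the least nonzero value of |det(w, u, u')|. Division with remainder on this
    determinant leaves a remainder proportional to [u], and [u] is primitive. *)
Lemma basis_exists u : perp_lattice w u -> u != 0 -> (forall x, O3 (x *: u) -> O2 x) ->
  exists u', lattice_basis w u u'.
Proof.
move=> pu u0 umin; have [ ou uw] := pu.
pose f z := \det (cols w u z).
have fO z : O3 z -> O2 (f z).
  move=> oz; have h := cols_O2 ow ou oz.
  by rewrite /f det33; do ![exact: h|apply: O2B|apply: O2D|apply: O2M].
pose P k := `[< exists z, perp_lattice w z /\ f z * (f z)^* = k.+1%:R >].
have exP : exists k, P k.
  have : ~ (forall z, perp_lattice w z -> f z = 0).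
    move=> h; have [r [r0 rz0 ru]] := exists_perp2 z0 u.
    case/eqP: r0; apply: herm_nondeg => z.
    rewrite (vec_delta z) !big_ord_recl big_ord0 !hermlin herm0l.
    have hd j : herm (delta_mx j 0) r = 0.
      have pd := perp_proj (@O3_delta C j).
      have [x hx] := perp_line u0 uw pd.2 (h _ pd).
      have -> : delta_mx j 0 = x *: u + herm (delta_mx j 0) w *: z0 by rewrite -hx subrK.
      by rewrite !hermlin (herm_eq0C ru) (herm_eq0C rz0) !mulr0 addr0.
    by rewrite !hd !mulr0 !addr0.
  move/existsNP => [z /not_implyP[pz /eqP fz]].
  have [k hk k0] := O2_norm (fO _ pz.1); exists k.-1; apply/asboolP; exists z; split=> //.
  by case: k hk k0 => [_ /(_ erefl) e|k ->] //; rewrite e eqxx in fz.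
have [k /asboolP[u' [pu' hk]] kmin] := ex_minnP exP.
have fu' : f u' != 0 by rewrite -mul_conjC_eq0 hk pnatr_eq0.
exists u'; split=> // z pz.
have [y Oy hy] := O2_euclid (fO _ pz.1) (fO _ pu'.1) fu'.
have pz' : perp_lattice w (z + (- y) *: u') by apply: perpZD => //; apply: O2N.
have fz' : f (z + (- y) *: u') = f z - y * f u' by rewrite /f det_colsD3 mulNr.
have f0 : f (z + (- y) *: u') = 0.
  have [l hl l0] := O2_norm (fO _ pz'.1); apply: l0.
  case: l hl => // l hl; have := kmin l; rewrite leqNgt => /(_ _)/negP[].
    by apply/asboolP; exists (z + (- y) *: u').
  by move: hy; rewrite -fz' hl hk ltr_nat ltnS.
have [x hx] := perp_line u0 uw pz'.2 f0.
exists x, y; split=> //; first by apply: umin; rewrite -hx; exact: pz'.1.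
by rewrite -hx scaleNr subrK.
Qed.

(** A vector of least value is primitive: if x u is in the lattice and x is not in O_2, rounding x
    produces a nonzero vector of at most 3/4 of the value. *)
Lemma min_vector (q : 'cV[C]_3 -> C) :
  (forall z, perp_lattice w z -> z != 0 -> exists2 k : nat, (0 < k)%N & q z = k%:R) ->
  (forall x z, q (x *: z) = x * x^* * q z) ->
  exists u, [/\ perp_lattice w u, u != 0, (forall x, O3 (x *: u) -> O2 x)
    & forall z, perp_lattice w z -> z != 0 -> q u <= q z].
Proof.
move=> qn qZ.
pose P k := `[< exists z, [/\ perp_lattice w z, z != 0 & q z = k%:R] >].
have exP : exists k, P k.
  have : ~ (forall z, perp_lattice w z -> z = 0).
    move=> h; have [r [r0 rz0 _]] := exists_perp2 z0 z0.
    case/eqP: r0; apply: herm_nondeg => z.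
    rewrite (vec_delta z) !big_ord_recl big_ord0 !hermlin herm0l.
    have hd j : herm (delta_mx j 0) r = 0.
      have hx := h _ (perp_proj (@O3_delta C j)).
      have -> : delta_mx j 0 = herm (delta_mx j 0) w *: z0 by apply/eqP; rewrite -subr_eq0 hx.
      by rewrite !hermlin (herm_eq0C rz0) !mulr0.
    by rewrite !hd !mulr0 !addr0.
  move/existsNP => [z /not_implyP[pz /eqP z1]].
  by have [k _ hk] := qn z pz z1; exists k; apply/asboolP; exists z.
have [k /asboolP[u [pu u0 hk]] kmin] := ex_minnP exP.
have umin z : perp_lattice w z -> z != 0 -> q u <= q z.
  move=> pz z1; have [l _ hl] := qn z pz z1; rewrite hk hl ler_nat; apply: kmin.
  by apply/asboolP; exists z.
exists u; split=> // x xu.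
have [i ui] : exists i, u i 0 != 0.
  apply: contrapT => h; case/eqP: u0; apply/matrixP => i j; rewrite mxE ord1.
  by apply/eqP/negPn/negP => ui; apply: h; exists i.
have [n hn n0] := O2_norm (pu.1 i).
have nn : n%:R != 0 :> C by rewrite -hn mul_conjC_eq0.
have [||r Or hr] := @O2_round C x n.
- by rewrite -(intr_eq0 C).
- rewrite -[n%:~R]/(n%:R) -hn mulrC mulrA; apply: O2M; last by apply: O2C; exact: pu.1.
  by have := xu i; rewrite mxE.
have [xr|xr] := eqVneq x r; first by rewrite xr.
have pz : perp_lattice w ((x - r) *: u).
  split; last by rewrite hermZl pu.2 mulr0.
  by rewrite scalerBl; apply: O3B => //; apply: O3Z => //; exact: pu.1.
have := umin _ pz; rewrite scaler_eq0 subr_eq0 (negbTE xr) (negbTE u0) => /(_ isT).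
have [l l0 hl] := qn u pu u0; rewrite qZ hl => h; exfalso; move: h.
apply/negP; rewrite -real_ltNge ?realn //; last first.
  by rewrite realM ?realn // ger0_real // mul_conjC_ge0.
apply: le_lt_trans (_ : 3 / 4 * l%:R < _); first by rewrite ler_wpM2r ?ler0n.
by rewrite -[X in _ < X]mul1r ltr_pM2r ?ltr0n // ltr_pdivrMr ?ltr0n // mul1r ltr_nat.
Qed.

(** The vectors [z0], [u], [u'] form a basis of the whole lattice, so their determinant is a
    unit. *)
Lemma basis_det u u' : lattice_basis w u u' ->
  \det (cols z0 u u') * (\det (cols z0 u u'))^* = 1.
Proof.
move=> [pu pu' hb]; set P := cols z0 u u'.
have h j : {y : 'cV[C]_3 | O3 y & delta_mx j 0 = P *m y}.
  apply: cid2; have [x [y [ox oy hxy]]] := hb _ (perp_proj (@O3_delta C j)).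
  exists (vec3 (herm (delta_mx j 0) w) x y).
    move=> i; rewrite mxE; case: i => [[|[|[|]]]] // ? /=.
    by apply: O2_herm => //; exact: O3_delta.
  by rewrite cols_mul !mxE /= -addrA -hxy addrC subrK.
pose Q : 'M[C]_3 := \matrix_(i, j) s2val (h j) i 0.
have PQ : P *m Q = 1%:M.
  apply/matrixP => i j; have := s2valP' (h j) => /matrixP/(_ i 0); rewrite !mxE eqxx andbT => ->.
  by apply: eq_bigr => k _; rewrite !mxE.
have hO : O2 (\det P).
  have hp := cols_O2 oz0 pu.1 pu'.1.
  by rewrite det33; do ![exact: hp|apply: O2B|apply: O2D|apply: O2M].
have hQ : O2 (\det Q).
  have hq i j : O2 (Q i j) by rewrite mxE; apply: (s2valP (h j)).
  by rewrite det33; do ![exact: hq|apply: O2B|apply: O2D|apply: O2M].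
have [k hk _] := O2_norm hO; have [l hl _] := O2_norm hQ.
have : (\det P * (\det P)^*) * (\det Q * (\det Q)^*) = 1.
  by rewrite mulrACA -rmorphM /= -det_mulmx PQ det1 rmorph1 mulr1.
rewrite hk hl -natrM => /eqP; rewrite -[X in _ == X]/(1%:R) eqr_nat muln_eq1.
by move=> /andP[/eqP-> _].
Qed.

Lemma basis_coord u u' : lattice_basis w u u' ->
  exists x y, [/\ O2 x, O2 y & w = herm w w *: z0 + x *: u + y *: u'].
Proof.
move=> [_ _ hb]; have [x [y [ox oy h]]] := hb _ (perp_proj ow).
by exists x, y; split=> //; rewrite -addrA -h addrC subrK.
Qed.

(** The Gram determinant of (w, u, u') is <w,w> times that of (u, u'). It is also |det(w, u, u')|^2
    det J = -<w,w>^2, as [w] has coordinate <w,w> along [z0]. *)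
Lemma gram_det u u' : lattice_basis w u u' ->
  herm u u * herm u' u' - herm u u' * herm u' u = - herm w w.
Proof.
move=> hb; have [x [y [_ _ wE]]] := basis_coord hb.
have [[_ uw] [_ u'w] _] := hb.
have := congr1 (fun M => \det M) (erefl (adjoint (cols w u u') *m Jmx C *m cols w u u')).
rewrite [in LHS]det33 !cols_gram /= uw u'w (herm_eq0C uw) (herm_eq0C u'w).
rewrite !det_mulmx det_J det_adjoint [in RHS]wE det_cols1 rmorphM /= (CrealP (herm_real w)).
have hd := basis_det hb => h.
apply: (mulfI ww); rewrite mulrN; apply: etrans (_ : - (herm w w * herm w w) *
  (\det (cols z0 u u') * (\det (cols z0 u u'))^* ) = _); last by rewrite hd mulr1.
move: h; set D := \det _ => h; rewrite [RHS](_ : _ = herm w w * D^* * -1 * (herm w w * D)); last by ring.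
by rewrite -h; ring.
Qed.

(** Replacing [u'] by [t] multiplies the Gram determinant by |y|^2. For [t] the image of [u] under
    [A], this controls the index of the span of [u] and [t]. *)
Lemma gram_line u u' t x y : lattice_basis w u u' -> t = x *: u + y *: u' ->
  herm u u * herm t t - herm u t * herm t u = - herm w w * (y * y^*).
Proof. by move=> hb ->; rewrite -(gram_det hb) !hermlin; ring. Qed.

End Primitive.

(** The matrix P F^-1 carries one frame to the other. It is integral because F is invertible over
    O_2, and unitary because the Gram matrices agree. *)
Lemma orbit_frame (f1 f2 f3 : zvec) (Fi : zmat) (p1 p2 p3 : 'cV[C]_3) (y : 'cV[C]_3) :
  zmm (ztr (f1, f2, f3)) Fi = z1 -> zall inO Fi ->
  O3 p1 -> O3 p2 -> O3 p3 ->
  herm p1 p1 = ev C (zherm f1 f1) -> herm p2 p2 = ev C (zherm f2 f2) ->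
  herm p3 p3 = ev C (zherm f3 f3) -> herm p1 p2 = ev C (zherm f1 f2) ->
  herm p1 p3 = ev C (zherm f1 f3) -> herm p2 p3 = ev C (zherm f2 f3) ->
  orbit2 (line (y 0 0 *: evV C f1 + y 1 0 *: evV C f2 + y 2 0 *: evV C f3))
         (line (y 0 0 *: p1 + y 1 0 *: p2 + y 2 0 *: p3)).
Proof.
move=> FFi oFi o1 o2 o3 h11 h22 h33 h12 h13 h23.
pose F := evM C (ztr (f1, f2, f3)); pose P := cols p1 p2 p3.
have FE : F = cols (evV C f1) (evV C f2) (evV C f3).
  apply/matrixP => i j; rewrite /F; case: (f1) (f2) (f3) => [[? ?] ?] [[? ?] ?] [[? ?] ?].
  by rewrite !mxE; case: i => [[|[|[|]]]] // ?; case: j => [[|[|[|]]]] // ?; rewrite /= mxE.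
have FI : F *m evM C Fi = 1%:M by rewrite /F -evM_mul FFi evM1.
have [uF uFi] := mulmx1_unit FI.
have FiF : evM C Fi *m F = 1%:M by apply: mulmx1C.
have gram : adjoint P *m Jmx C *m P = adjoint F *m Jmx C *m F.
  apply/matrixP => i j; rewrite FE !cols_gram.
  by case: i => [[|[|[|]]]] // ?; case: j => [[|[|[|]]]] // ? /=;
    rewrite -?ev_herm ?h11 ?h22 ?h33 ?h12 ?h13 ?h23 // -hermC ?h12 ?h13 ?h23 ev_herm hermC -ev_herm.
pose g := P *m evM C Fi.
have ug : unitaryO g.
  split; last by apply: O2_mulmx; [exact: cols_O2|exact: O2_evM].
  rewrite /g adjointM -!mulmxA (mulmxA (adjoint P)) (mulmxA (adjoint P *m _)) gram.
  have -> : adjoint F *m Jmx C *m F *m evM C Fi = adjoint F *m Jmx C.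
    by rewrite -mulmxA FI mulmx1.
  by rewrite mulmxA -adjointM FI adjoint1 mul1mx.
rewrite -(cols_mul p1) -(cols_mul (evV C f1)) -FE; exists (cls g).
  by apply/Gamma2P; exists g.
by rewrite act_cls ?unitaryO_unit // /g -mulmxA (mulmxA (evM C Fi)) FiF mul1mx.
Qed.

End Bases.

(** * Orbits of negative lattice vectors *)

(** The integral inverse [Fi] says that the frame is a basis of the whole lattice; [c] holds the
    coordinates of a multiple of [q]. *)
Definition frame_ok (f1 f2 f3 : zvec) (Fi : zmat) (c q : zvec) : bool :=
  let F := ztr (f1, f2, f3) in
  [&& zmm F Fi == z1, zall inO Fi, zparallel (zmv F c) q,
      zmv F c != (zz 0, zz 0, zz 0) & q != (zz 0, zz 0, zz 0)].

Lemma small_int (m : int) : m * m <= 3 -> m = -1 \/ m = 0 \/ m = 1.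
Proof.
move=> h; have h1 : -1 <= m by nia.
have h2 : m <= 1 by nia.
by lia.
Qed.

Lemma norm_eq3 (m n : int) : m * m + 2 * (n * n) = 3 -> (m = 1 \/ m = -1) /\ (n = 1 \/ n = -1).
Proof.
move=> h; have hm : m * m <= 3 by nia.
have hn : n * n <= 3 by nia.
by case: (small_int hm) h => [->|[->|->]]; case: (small_int hn) => [->|[->|->]]; lia.
Qed.

Section NegativeLines.
Variable C : numClosedFieldType.
Implicit Types (u v w z : 'cV[C]_3) (A : 'M[C]_3).
Notation a := (alpha C).
Notation O3 := (@O3 C).
Notation ev := (@ev C).
Notation evV := (@evV C).
Notation oint := (@oint C).

Lemma evV_neq0 (v : zvec) : v != (zz 0, zz 0, zz 0) -> evV v != 0.
Proof.
apply: contraNneq; case: v => [[v1 v2] v3] /matrixP h.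
have := (h 0 0, h 1 0, h 2 0); rewrite !mxE /= => -[[h1 h2] h3].
by rewrite -(ev0 C) in h1 h2 h3; rewrite (ev_inj h1) (ev_inj h2) (ev_inj h3).
Qed.

Lemma orbit_frame_ok (f1 f2 f3 : zvec) (Fi : zmat) (c1 c2 c3 : zq) (q : zvec)
    (p1 p2 p3 : 'cV[C]_3) :
  frame_ok f1 f2 f3 Fi (c1, c2, c3) q -> O3 p1 -> O3 p2 -> O3 p3 ->
  herm p1 p1 = ev (zherm f1 f1) -> herm p2 p2 = ev (zherm f2 f2) ->
  herm p3 p3 = ev (zherm f3 f3) -> herm p1 p2 = ev (zherm f1 f2) ->
  herm p1 p3 = ev (zherm f1 f3) -> herm p2 p3 = ev (zherm f2 f3) ->
  orbit2 (line (evV q)) (line (ev c1 *: p1 + ev c2 *: p2 + ev c3 *: p3)).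
Proof.
move=> /and5P[/eqP FFi oFi par F0 q0] h1 h2 h3 h11 h22 h33 h12 h13 h23.
have := @orbit_frame C f1 f2 f3 Fi p1 p2 p3 (vec3 (ev c1) (ev c2) (ev c3)) FFi oFi h1 h2 h3 h11 h22 h33 h12 h13 h23.
rewrite -evM_tr !mxE /=.
have -> : vec3 (ev c1) (ev c2) (ev c3) = evV (c1, c2, c3) by [].
rewrite -evM_mulV; have [k hk] := zparallelP (evV_neq0 q0) par.
have k0 : k != 0 by apply: contraNneq (evV_neq0 F0) => k0; rewrite hk k0 scale0r.
by rewrite hk lineZ.
Qed.

Lemma perp_herm_pos w u : herm w w < 0 -> perp_lattice w u -> u != 0 ->
  exists2 k : nat, (0 < k)%N & herm u u = k%:R.
Proof.
move=> w0 [ ou uw] u0; have [n hn] := herm_int ou.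
have := herm_perp_gt0 w0 uw u0; rewrite hn ltr0z => n0.
by exists `|n|%N; [lia|rewrite -[RHS]/((Posz _)%:~R) gez0_abs //; lia].
Qed.

(** The vector [u] is minimal and [u'] is reduced modulo [u]. With the Gram determinant the
    inequalities give k^2 <= -4 s, so finitely many Gram matrices remain. *)
Lemma definite_basis w z0 (s : int) : O3 w -> O3 z0 -> herm z0 w = 1 ->
  herm w w = s%:~R -> s < 0 ->
  exists u u' (k d m n : int), [/\ lattice_basis w u u',
    [/\ herm u u = k%:~R, herm u' u' = d%:~R & herm u' u = oint m n],
    [/\ 0 < k, k <= d, 4 * (m * m + 2 * (n * n)) <= 3 * (k * k) &
        k * d - (m * m + 2 * (n * n)) = - s] &
    forall z, perp_lattice w z -> z != 0 -> k%:~R <= herm z z].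
Proof.
move=> ow oz z0w ws s0.
have wneg : herm w w < 0 by rewrite ws ltrz0.
have wn0 : herm w w != 0 by rewrite ltr0_neq0.
have [||u [pu u0 uprim umin]] := @min_vector C w z0 ow oz z0w (fun z => herm z z).
- by move=> z; apply: perp_herm_pos.
- by move=> x z; rewrite hermZl hermZr mulrA.
have [u1 b1] := basis_exists ow oz z0w wn0 pu u0 uprim.
have [k k0 uk] := perp_herm_pos wneg pu u0.
have pu1 : perp_lattice w u1 by case: b1.
have kn : k%:R != 0 :> C by rewrite pnatr_eq0 -lt0n.
have [||r Or hr] := @O2_round C (herm u1 u / k%:R) k.
- by lia.
- by rewrite -[k%:~R]/(k%:R) mulrC divfK //; apply: O2_herm; [exact: pu1.1|exact: pu.1].
have b2 := basis_shift (O2N Or) b1; set u' := u1 + - r *: u in b2.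
have [_ pu' _] := b2.
have [m [n hmn]] : O2 (herm u' u) by apply: O2_herm; [exact: pu'.1|exact: pu.1].
have hr' : herm u' u * (herm u' u)^* <= 3 / 4 * (k%:R * k%:R).
  have -> : herm u' u = (herm u1 u / k%:R - r) * k%:R.
    by rewrite /u' !hermlin uk; field.
  rewrite rmorphM /= mulrACA (CrealP (realn _ k)) ler_pM2r // ?mulr_gt0 // ltr0n //.
have u'0 : u' != 0.
  apply: contraNneq (wn0) => u'0; have := gram_det ow oz z0w wn0 b2.
  by rewrite u'0 !(herm0l, herm0r) mulr0 mul0r subrr => /esym/eqP; rewrite oppr_eq0.
have [d d0 u'd] := perp_herm_pos wneg pu' u'0.
exists u, u', (Posz k), (Posz d), m, n; split=> //.
  split; [lia| | |].
  - by have := umin _ pu' u'0; rewrite uk u'd ler_nat; lia.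
  - move: hr'; rewrite hmn -/(oint m n) oint_norm mulrAC ler_pdivlMr ?ltr0n //.
    rewrite -[k%:R]/((Posz k)%:~R) -[4]/(4%:~R) -[3]/(3%:~R) -!intrM ler_int; lia.
  - apply: (@intr_inj C); rewrite [RHS]mulrNz -ws -(gram_det ow oz z0w wn0 b2) uk u'd -(hermC u' u) hmn.
    by rewrite -/(oint m n) [(oint m n)^* * _]mulrC oint_norm intrB intrM.
by move=> z pz z1; rewrite -[(Posz k)%:~R]/(k%:R) -uk; apply: umin.
Qed.

Lemma ev_oint m n : ev (zo (Z_of_int m) (Z_of_int n)) = oint m n.
Proof. by rewrite /oint /ev /zo /zr !Z_of_intK; ring. Qed.

Lemma vm_ev x y : x = y -> ev x = ev y. Proof. by move=> ->. Qed.

(** A vector of norm -1 splits off its orthogonal lattice, so its orbit is determined by a definite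
    binary form of determinant 1. There are two of these, with minimum 1 and 2. *)
Lemma norm1_orbit w : O3 w -> herm w w = -1 ->
  orbit2 (line (evV q4)) (line w) \/ orbit2 (line (evV q5)) (line w).
Proof.
move=> ow w1.
have z0w : herm (- w) w = 1 by rewrite hermNl w1 opprK.
have w1' : herm w w = (-1)%:~R by rewrite w1 mulrN1z.
have [u [u' [k [d [m [n [bs [uu u'u' u'u] [k0 kd mnk D] _]]]]]]] :=
  definite_basis ow (O3N ow) z0w w1' (erefl : (-1 : int) < 0).
have [pu pu' _] := bs.
have uu' : herm u u' = oint m (- n) by rewrite -hermC u'u oint_conj.
have wu := herm_eq0C pu.2; have wu' := herm_eq0C pu'.2.
have wE t1 t2 : line w = line (ev (zz 1) *: w + ev (zz 0) *: t1 + ev (zz 0) *: t2).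
  by rewrite !ev_zz -[zr C 1]/(1 : C) -[zr C 0]/(0 : C) scale1r !scale0r !addr0.
have k2 : k = 1 \/ k = 2 by nia.
case: k2 => kE; subst k.
  left; have [m0 n0] : m = 0 /\ n = 0 by nia.
  have d1 : d = 1 by nia.
  rewrite (wE u u').
  apply: (@orbit_frame_ok q4 (zv (-1) 0 1 0 0 0)%bZ (zv 0 0 (-1) 0 (-1) 0)%bZ
   ((zv 1 0 1 0 (-1) 0), (zv 0 0 1 0 (-1) 0), (zv (-1) 0 (-1) 0 0 0))%bZ) ; first by vm_compute.
  - exact: ow.
  - exact: pu.1.
  - exact: pu'.1.
  - by rewrite w1; transitivity (ev (zz (-1))); [rewrite ev_zz|apply: vm_ev; vm_compute].
  - by rewrite uu; transitivity (ev (zz 1)); [rewrite ev_zz|apply: vm_ev; vm_compute].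
  - by rewrite u'u' d1; transitivity (ev (zz 1)); [rewrite ev_zz|apply: vm_ev; vm_compute].
  - by rewrite wu; transitivity (ev (zz 0)); [rewrite ev_zz|apply: vm_ev; vm_compute].
  - by rewrite wu'; transitivity (ev (zz 0)); [rewrite ev_zz|apply: vm_ev; vm_compute].
  - rewrite uu' m0 n0 oppr0; transitivity (ev (zz 0)); last by apply: vm_ev; vm_compute.
    rewrite ev_zz.
    by rewrite /oint mul0r addr0.
right; have d2 : d = 2 by nia.
(* The product of the basis vectors has norm 3. Exchanging the two vectors conjugates it and
   replacing one by its negative changes its sign, so one frame covers the four values. *)
have mn : (m = 1 \/ m = -1) /\ (n = 1 \/ n = -1) by apply: norm_eq3; lia.
have frame t t' : O3 t -> O3 t' -> herm w t = 0 -> herm w t' = 0 -> herm t t = 2 ->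
    herm t' t' = 2 -> herm t t' = oint 1 (-1) -> orbit2 (line (evV q5)) (line w).
  move=> ot ot' wt wt' tt t't' tt'; rewrite (wE t t').
  apply: (@orbit_frame_ok q5 (zv (-3) 0 0 1 0 1)%bZ (zv (-2) (-2) (-2) 1 (-1) 1)%bZ
   ((zv 0 1 1 1 2 (-1)), (zv (-1) 0 0 1 0 0), (zv 0 (-1) (-2) (-1) (-1) 1))%bZ) => //.
  - by rewrite w1; transitivity (ev (zz (-1))); [rewrite ev_zz|apply: vm_ev; vm_compute].
  - by rewrite tt; transitivity (ev (zz 2%bZ)); [rewrite ev_zz|apply: vm_ev; vm_compute].
  - by rewrite t't'; transitivity (ev (zz 2%bZ)); [rewrite ev_zz|apply: vm_ev; vm_compute].
  - by rewrite wt; transitivity (ev (zz 0)); [rewrite ev_zz|apply: vm_ev; vm_compute].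
  - by rewrite wt'; transitivity (ev (zz 0)); [rewrite ev_zz|apply: vm_ev; vm_compute].
  - by rewrite tt' -ev_oint; apply: vm_ev; vm_compute.
rewrite d2 in u'u'.
case: mn => -[] mE [] nE; subst m n.
- exact: frame pu.1 pu'.1 wu wu' uu u'u' uu'.
- by apply: frame pu'.1 pu.1 wu' wu u'u' uu u'u.
- apply: (frame u' (- u)) => //; first exact: pu'.1.
  + by apply: O3N; exact: pu.1.
  + by rewrite hermNr wu oppr0.
  + by rewrite hermNl hermNr opprK.
  + by rewrite hermNr u'u /oint; ring.
- apply: (frame u (- u')) => //; first exact: pu.1.
  + by apply: O3N; exact: pu'.1.
  + by rewrite hermNr wu' oppr0.
  + by rewrite hermNl hermNr opprK.
  + by rewrite hermNr uu' /oint; ring.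
Qed.

End NegativeLines.

Lemma norm_eq2 (m n : int) : m * m + 2 * (n * n) = 2 -> m = 0 /\ n * n = 1.
Proof.
move=> h; have hm : m * m <= 3 by nia.
have hn : n * n <= 3 by nia.
by case: (small_int hm) h => [->|[->|->]]; case: (small_int hn) => [->|[->|->]]; lia.
Qed.

Ltac evz n := lazymatch goal with |- _ = ev ?K _ => transitivity (ev K (zz n)) end;
  [rewrite ev_zz | by apply: vm_ev; vm_compute].

(** * Primitive vectors of norm -2 *)

Section NormTwo.
Variable C : numClosedFieldType.
Implicit Types (u v w z : 'cV[C]_3) (A : 'M[C]_3).
Notation a := (alpha C).
Notation O3 := (@O3 C).
Notation ev := (@ev C).
Notation evV := (@evV C).
Notation oint := (@oint C).

Lemma alpha_not_unit (x : C) : O2 x -> a * x <> 1.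
Proof.
move=> [m [n ->]] h.
have {}h : oint (- (2 * n)) m = oint 1 0.
  rewrite /oint mul0r addr0 -[RHS]h mulrNz intrM.
  by have := alphaE C; set b := alpha C => b2; ring: b2.
by have [] := oint_inj h; lia.
Qed.

(** Here the lattice need not be the sum of O_2 [w] and its complement. The frame is (z2, u, u'),
    with [z2] a normalised form of [z0], and its Gram matrix takes two values. *)
Lemma norm2_orbit w z0 : O3 w -> O3 z0 -> herm z0 w = 1 -> herm w w = - 2 ->
  orbit2 (line (evV q1)) (line w) \/ orbit2 (line (evV q2)) (line w).
Proof.
move=> ow oz0 z0w w2.
have w2' : herm w w = (-2)%:~R by rewrite w2 mulrNz.
have [u [u' [k [d [m [n [bs [uu u'u' u'u] [k0 kd mnk D] _]]]]]]] :=
  definite_basis ow oz0 z0w w2' (erefl : (-2 : int) < 0).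
have [pu pu' _] := bs; have [ ou uw] := pu; have [ ou' u'w] := pu'.
have uu' : herm u u' = oint m (- n) by rewrite -hermC u'u oint_conj.
have wu := herm_eq0C uw; have wu' := herm_eq0C u'w.
have k2 : k = 1 \/ k = 2 by nia.
case: k2 => kE; subst k; last first.
  (* The product of the basis vectors is alpha up to sign. Pairing [w] with both shows that its
     coordinates are divisible by alpha, as is -2 = alpha^2, against [herm z0 w = 1]. *)
  exfalso; have d2 : d = 2 by lia.
  have [m0 n1] : m = 0 /\ n * n = 1 by apply: norm_eq2; lia.
  have [x [y [Ox Oy wE]]] := basis_coord ow oz0 z0w bs.
  have e1 := congr1 (fun t => herm t u) wE; have e2 := congr1 (fun t => herm t u') wE.
  rewrite !hermlin wu w2 uu u'u m0 in e1; rewrite !hermlin wu' w2 u'u' uu' m0 d2 in e2.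
  have f1 : O2 (herm z0 u) by apply: O2_herm.
  have f2 : O2 (herm z0 u') by apply: O2_herm.
  have aa := alphaE C; have nn : n%:~R * n%:~R = 1 :> C by rewrite -intrM n1.
  have yE : y = a * (n%:~R * (x - herm z0 u)).
    apply: (mulfI (_ : n%:~R * a != 0)); first by rewrite mulf_neq0 ?alpha_neq0 // intr_eq0; nia.
    apply/eqP; rewrite -subr_eq0; apply/eqP; rewrite /oint in e1.
    have -> : n%:~R * a * (a * (n%:~R * (x - herm z0 u))) =
      (a * a) * (n%:~R * n%:~R) * (x - herm z0 u) by ring.
    rewrite aa nn [RHS]e1; ring.
  have xE : x = a * (n%:~R * (herm z0 u' - y)).
    apply: (mulfI (_ : n%:~R * a != 0)); first by rewrite mulf_neq0 ?alpha_neq0 // intr_eq0; nia.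
    apply/eqP; rewrite -subr_eq0; apply/eqP; rewrite /oint mulrNz in e2.
    have -> : n%:~R * a * (a * (n%:~R * (herm z0 u' - y))) =
      (a * a) * (n%:~R * n%:~R) * (herm z0 u' - y) by ring.
    rewrite aa nn -[RHS]oppr0 [X in _ = - X]e2; ring.
  have : herm z0 w = a * - (a^* * 0 + herm z0 (a *: z0 + (n%:~R * (herm z0 u' - y)) *: u + (n%:~R * (x - herm z0 u)) *: u')).
    have -> : w = a *: (a *: z0 + (n%:~R * (herm z0 u' - y)) *: u + (n%:~R * (x - herm z0 u)) *: u').
      by rewrite !scalerDr !scalerA -xE -yE aa [LHS]wE w2.
    by rewrite hermZr alpha_conj; ring.
  rewrite z0w => /esym; apply: alpha_not_unit; apply: O2N; rewrite mulr0 add0r.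
  apply: O2_herm => //; apply: O3D; first apply: O3D; apply: O3Z => //; first exact: O2a.
    by apply: O2M; [exact: O2z|exact: O2B].
  by apply: O2M; [exact: O2z|exact: O2B].
have [m0 n0] : m = 0 /\ n = 0 by nia.
have d2 : d = 2 by nia.
rewrite m0 n0 /oint mul0r addr0 in u'u; rewrite m0 n0 oppr0 /oint mul0r addr0 in uu'.
have {}u'u' : herm u' u' = 2 by rewrite u'u' d2.
(* As [u] has norm 1, [z0] can be made orthogonal to it; as [u'] has norm 2, the product with [u']
   can then be reduced modulo 2. *)
pose z1 := z0 - herm z0 u *: u.
have oz1 : O3 z1 by apply: O3B => //; apply: O3Z => //; apply: O2_herm.
have z1w : herm z1 w = 1 by rewrite !hermlin z0w uw mulr0 subr0.
have z1u : herm z1 u = 0 by rewrite !hermlin uu mulr1 subrr.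
clearbody z1.
have [p [q hpq]] : O2 (herm z1 u') by apply: O2_herm.
pose r := oint (p %/ 2)%Z (q %/ 2)%Z; pose z2 := z1 - r *: u'.
have Or : O2 r by exact: O2_oint.
have oz2 : O3 z2 by apply: O3B => //; apply: O3Z.
have z2w : herm z2 w = 1 by rewrite !hermlin z1w u'w mulr0 subr0.
have z2u : herm z2 u = 0 by rewrite !hermlin z1u u'u mulr0 subr0.
have z2u' : herm z2 u' = oint (p %% 2)%Z (q %% 2)%Z.
  rewrite !hermlin hpq u'u' /r /oint {1}(divz_eq p 2) {1}(divz_eq q 2) !(intrD, intrM); ring.
have p2 : (p %% 2)%Z = 0 \/ (p %% 2)%Z = 1.
  have : 0 <= (p %% 2)%Z by apply: modz_ge0.
  have : (p %% 2)%Z < 2 by apply: ltz_pmod.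
  by lia.
have q2 : (q %% 2)%Z = 0 \/ (q %% 2)%Z = 1.
  have : 0 <= (q %% 2)%Z by apply: modz_ge0.
  have : (q %% 2)%Z < 2 by apply: ltz_pmod.
  by lia.
move: z2u' p2 q2; move: (p %% 2)%Z (q %% 2)%Z => p' q' z2u' p2 q2.
clearbody z2; clear r Or.
have [x [y [_ _ wE]]] := basis_coord ow oz2 z2w bs.
have x0 : x = 0.
  by have := congr1 (fun t => herm t u) wE; rewrite !hermlin wu z2u uu u'u !mulr0 mulr1 add0r addr0.
have yE : y = oint p' q'.
  have := congr1 (fun t => herm t u') wE; rewrite !hermlin wu' z2u' w2 u'u' x0 mul0r addr0 => e.
  apply: (mulIf (_ : 2 != 0 :> C)); first by rewrite pnatr_eq0.
  by apply/eqP; rewrite -subr_eq0; apply/eqP; rewrite [RHS]e; ring.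
have [c hc] := herm_int oz2.
(* Expanding [herm z2 w = 1] forces p' to be odd and determines the norm [c] of [z2]; the two values
   of q' give the two orbits. *)
have hcc : p' * p' + 2 * (q' * q') = 1 + 2 * c.
  have e : herm z2 w = - 2 * herm z2 z2 + (oint p' q')^* * oint p' q'.
    rewrite [in LHS]wE x0 yE scale0r addr0 !hermlin w2 z2u'.
    by have -> : (- 2)^* = - 2 :> C by apply/CrealP; rewrite realN realn.
  apply: (@intr_inj C); rewrite -oint_norm intrD intrM -hc.
  rewrite z2w in e; apply/eqP; rewrite -subr_eq0; apply/eqP.
  have -> : 1%:~R = 1 :> C by [].
  by rewrite [X in X + 2%:~R * _]e; ring.
have wE' : w = ev (zz (-2)%bZ) *: z2 + ev (zz 0) *: u + ev (zo 1 (Z_of_int q')) *: u'.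
  rewrite [LHS]wE w2 x0 scale0r yE !ev_zz scale0r; congr (_ + _ *: _).
  by rewrite -[zo 1 _]/(zo (Z_of_int 1) _) ev_oint; congr oint; lia.
have p1 : p' = 1 by lia.
rewrite p1 in z2u'; rewrite (congr1 (@line C) wE').
case: q2 => qE; [left|right]; subst q'.
  have c0 : c = 0 by lia.
  apply: (@orbit_frame_ok _ (zv (-1) 0 0 0 0 0)%bZ (zv 0 0 (-1) 0 0 0)%bZ (zv (-1) 0 0 0 (-1) 0)%bZ
   ((zv (-1) 0 0 0 1 0), (zv 0 0 (-1) 0 0 0), (zv 0 0 0 0 (-1) 0))%bZ) => //.
  - by evz 0%bZ; rewrite hc c0.
  - by evz 1%bZ.
  - by evz 2%bZ.
  - by evz 0%bZ.
  - by rewrite z2u' -ev_oint; apply: vm_ev; vm_compute.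
  - by evz 0%bZ.
have c1 : c = 1 by lia.
apply: (@orbit_frame_ok _ (zv 0 0 (-1) 0 (-1) 0)%bZ (zv (-1) 0 1 0 0 0)%bZ (zv (-1) 0 0 1 0 1)%bZ
   ((zv 0 (-1) 0 (-1) (-1) 1), (zv 0 0 1 0 (-1) 0), (zv (-1) 0 (-1) 0 1 0))%bZ) => //.
- by evz 1%bZ; rewrite hc c1.
- by evz 1%bZ.
- by evz 2%bZ.
- by evz 0%bZ.
- by rewrite z2u' -ev_oint; apply: vm_ev; vm_compute.
- by evz 0%bZ.
Qed.

End NormTwo.

Lemma mod3_centered (p : int) : exists p1 p2 : int, p = 3 * p1 + p2 /\ (p2 = -1 \/ p2 = 0 \/ p2 = 1).
Proof.
exists ((p + 1) %/ 3)%Z, (((p + 1) %% 3)%Z - 1).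
have h := divz_eq (p + 1) 3; have h2 : 0 <= ((p + 1) %% 3)%Z by apply: modz_ge0.
have h3 : ((p + 1) %% 3)%Z < 3 by apply: ltz_pmod.
by split; lia.
Qed.

(** * Vectors of norm -3 fixed by an element of order 3 *)

Section OrderThree.
Variable C : numClosedFieldType.
Implicit Types (u v w z : 'cV[C]_3) (A : 'M[C]_3).
Notation a := (alpha C).
Notation O3 := (@O3 C).
Notation ev := (@ev C).
Notation evV := (@evV C).
Notation oint := (@oint C).

Lemma basis_change w u u' x y : O2 x -> O2 y -> y * y^* = 1 -> lattice_basis w u u' ->
  lattice_basis w u (x *: u + y *: u').
Proof.
move=> Ox Oy y1 [pu pu' hb]; split=> //.
  split; first by apply: O3D; apply: O3Z => //; [exact: pu.1|exact: pu'.1].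
  by rewrite !hermlin pu.2 pu'.2 !mulr0 addr0.
move=> z /hb[x1 [y1' [ox oy ->]]].
exists (x1 - y1' * y^* * x), (y1' * y^*); split.
- by apply: O2B => //; apply: O2M => //; apply: O2M => //; apply: O2C.
- by apply: O2M => //; apply: O2C.
rewrite scalerDr !scalerA -!mulrA [y^* * y]mulrC y1 mulr1 scalerBl addrA.
by rewrite mulrA subrK.
Qed.

Lemma unitaryO_perp A w z : unitaryO A -> A *m w = w -> perp_lattice w z -> perp_lattice w (A *m z).
Proof.
move=> [hA oA] Aw [ oz zw]; split; first exact: O3_mulmx.
by rewrite -Aw herm_unitary.
Qed.

Lemma order3_herm A z : unitaryO A -> z + A *m z + A *m (A *m z) = 0 ->
  herm z (A *m z) + herm (A *m z) z = - herm z z.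
Proof.
move=> [hA _] /(congr1 (fun t => herm t (A *m z))).
rewrite !hermDl !(herm_unitary _ _ hA) herm0l => h.
by apply/eqP; rewrite -subr_eq0; apply/eqP; rewrite -[RHS]h; ring.
Qed.

(** The relation 1 + A + A^2 = 0 on the complement of [w] makes the minimum [k] even. Then [u] and
    its image form a basis with the Gram matrix of the root lattice A_2, and [z0] is normalised
    modulo 3. *)
Lemma norm3_orbit A w z0 : O3 w -> O3 z0 -> herm z0 w = 1 -> herm w w = - 3 ->
  unitaryO A -> A *m w = w ->
  (forall z, herm z w = 0 -> z + A *m z + A *m (A *m z) = 0) ->
  orbit2 (line (evV q3)) (line w).
Proof.
move=> ow oz0 z0w w3 uA Aw hA3.
have w3' : herm w w = (-3)%:~R by rewrite w3 mulrNz.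
have [u [u' [k [d [m [n [bs [uu u'u' u'u] [k0 kd mnk D] _]]]]]]] :=
  definite_basis ow oz0 z0w w3' (erefl : (-3 : int) < 0).
have [pu pu' hb] := bs; have [ ou uw] := pu; have pAu := unitaryO_perp uA Aw pu.
have wu := herm_eq0C uw.
have [p [q hpq]] : O2 (herm u (A *m u)) by apply: O2_herm => //; exact: pAu.1.
rewrite -/(oint p q) in hpq.
have hqp : herm (A *m u) u = oint p (- q) by rewrite -hermC hpq oint_conj.
have k2p : 2 * p = - k.
  apply: (@intr_inj C); rewrite [RHS]mulrNz -uu -(order3_herm uA (hA3 _ uw)) hpq hqp.
  by rewrite /oint intrM mulrNz; ring.
have k2 : k = 2 by nia.
have p1 : p = -1 by lia.
have AuAu : herm (A *m u) (A *m u) = 2 by rewrite (herm_unitary _ _ uA.1) uu k2.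
rewrite k2 in uu; rewrite p1 in hpq hqp => {k2p mnk D kd k0 k2 p1 k p}.
have [x [y [Ox Oy AuE]]] := hb _ pAu.
have [l yl _] := O2_norm Oy.
(* The Gram determinant 4 - (1 + 2 q^2) of [u] and its image is 3 |y|^2. *)
have hql : 3 - 2 * (q * q) = 3 * l%:Z.
  apply: (@intr_inj C); rewrite intrB !intrM.
  rewrite -[(l%:Z)%:~R]/(l%:R : C) -yl.
  have w0 : herm w w != 0 by rewrite w3' intr_eq0.
  have e : herm u (A *m u) * herm (A *m u) u = 1 + 2 * (q%:~R * q%:~R).
    by rewrite hpq hqp -oint_conj oint_norm intrD !intrM mulrNN mulr1.
  have := gram_line ow oz0 z0w w0 bs AuE; rewrite e w3 AuAu uu opprK => <-.
  by rewrite -[2%:~R]/(2 : C); ring.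
have [q0 l1] : q = 0 /\ l = 1%N by nia.
rewrite l1 in yl; rewrite q0 oppr0 in hpq hqp => {l q q0 l1 hql}.
have {bs} := basis_change Ox Oy yl bs; rewrite -AuE => bs {hb AuE x y Ox Oy yl u' pu' u'u' u'u d m n}.
have aE : oint (-1) 0 = -1 by rewrite /oint mul0r addr0 mulrNz.
rewrite aE in hpq hqp; move: (A *m u) bs pAu AuAu hpq hqp => t bs [ ot tw] tt ut tu.
have wt := herm_eq0C tw.
pose g := herm z0 t; pose z1 := z0 + g *: u.
have Og : O2 g by apply: O2_herm.
have oz1 : O3 z1 by apply: O3D => //; apply: O3Z.
have z1w : herm z1 w = 1 by rewrite !hermlin z0w uw mulr0 addr0.
have z1t : herm z1 t = 0 by rewrite !hermlin ut /g; ring.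
clearbody z1.
have [p [q hpq]] : O2 (herm z1 u) by apply: O2_herm.
have [p1 [p2 [pE hp2]]] := mod3_centered p.
have [q1 [q2 [qE hq2]]] := mod3_centered q.
(* The vector 2 u + t is orthogonal to [t] and has product 3 with [u], so its multiples reduce <z1,
   u> modulo 3. *)
pose r := oint p1 q1; pose z2 := z1 - r *: (2 *: u + t).
have Or : O2 r by exact: O2_oint.
have oz2 : O3 z2.
  apply: O3B => //; apply: O3Z => //; apply: O3D => //; apply: O3Z => //; exact: (O2z _ 2).
have z2w : herm z2 w = 1 by rewrite !hermlin z1w uw tw !mulr0 addr0 mulr0 subr0.
have z2t : herm z2 t = 0 by rewrite !hermlin z1t ut tt; ring.
have z2u : herm z2 u = oint p2 q2.
  rewrite !hermlin hpq uu tu pE qE /r /oint !(intrD, intrM); ring.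
clearbody z2; clear r Or p q hpq pE qE p1 q1 z1 oz1 z1w z1t g Og.
have w0 : herm w w != 0 by rewrite w3' intr_eq0.
have [x [y [_ _ wE]]] := basis_coord ow oz2 z2w bs.
have e1 := congr1 (fun s => herm s u) wE; have e2 := congr1 (fun s => herm s t) wE.
rewrite !hermlin wu w3 z2u uu tu in e1; rewrite !hermlin wt w3 z2t ut tt in e2.
have xE : x = 2 * y.
  by apply/eqP; rewrite -subr_eq0; apply/eqP; rewrite -[RHS]oppr0 [X in _ = - X]e2; ring.
have yE : y = oint p2 q2.
  apply: (mulfI (_ : 3 != 0 :> C)); first by rewrite pnatr_eq0.
  by apply/eqP; rewrite -subr_eq0; apply/eqP; rewrite [RHS]e1 xE; ring.
have [c hc] := herm_int oz2.
have hcc : 2 * (p2 * p2 + 2 * (q2 * q2)) = 1 + 3 * c.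
  have e : herm z2 w = - 3 * herm z2 z2 + 2 * ((oint p2 q2)^* * oint p2 q2).
    rewrite [in LHS]wE xE yE !hermlin w3 z2u z2t.
    have -> : (- 3)^* = - 3 :> C by apply/CrealP; rewrite realN realn.
    by rewrite rmorphM /= (CrealP (realn _ 2)); ring.
  apply: (@intr_inj C); rewrite [in LHS]intrM -oint_norm [in RHS]intrD intrM -hc.
  rewrite z2w in e; apply/eqP; rewrite -subr_eq0; apply/eqP.
  have -> : 1%:~R = 1 :> C by [].
  by rewrite [X in _ - (X + _)]e -[2%:~R]/(2 : C) -[3%:~R]/(3 : C); ring.
have frame s : O3 s -> herm s s = 1 -> herm s u = a -> herm s t = 0 ->
    orbit2 (line (evV q3)) (line (-3 *: s + (2 * a) *: u + a *: t)).
  move=> os ss su st.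
  have -> : -3 *: s + (2 * a) *: u + a *: t =
     ev (zz (-3)%bZ) *: s + ev (zo 0 2)%bZ *: u + ev (zo 0 1)%bZ *: t.
    rewrite ev_zz -[zo 0 2]/(zo (Z_of_int 0) (Z_of_int 2)) -[zo 0 1]/(zo (Z_of_int 0) (Z_of_int 1)).
    by rewrite !ev_oint /oint !add0r mul1r.
  apply: (@orbit_frame_ok _ (zv 2 0 1 0 0 (-1))%bZ (zv (-1) (-1) 0 0 (-1) 0)%bZ (zv 1 0 0 (-1) 0 0)%bZ
   ((zv 0 (-1) (-1) 0 (-2) 1), (zv (-2) 0 0 1 1 2), (zv (-1) 0 0 1 1 1))%bZ) => //.
  - by evz 1%bZ; rewrite ss.
  - by evz 2%bZ.
  - by evz 2%bZ.
  - rewrite su; transitivity (oint 0 1); first by rewrite /oint add0r mul1r.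
    by rewrite -ev_oint; apply: vm_ev; vm_compute.
  - by evz 0%bZ.
  - by evz (-1)%bZ.
have c1 : c = 1 /\ p2 = 0 /\ (q2 = 1 \/ q2 = -1) by nia.
case: c1 => c1 [p20 q21]; subst c p2.
rewrite wE xE yE w3.
case: q21 => q2E; subst q2.
  have oE : oint 0 1 = a by rewrite /oint add0r mul1r.
  by rewrite oE; apply: frame => //; rewrite z2u oE.
have oE : oint 0 (-1) = - a by rewrite /oint add0r mulNr mul1r.
rewrite oE; rewrite oE in z2u.
have -> : -3 *: z2 + (2 * - a) *: u + - a *: t = (-1) *: (-3 *: - z2 + (2 * a) *: u + a *: t).
  by apply/matrixP => i j; rewrite !mxE; ring.
rewrite lineZ ?oppr_eq0 ?oner_eq0 //; apply: frame; first exact: O3N.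
- by rewrite !hermlin opprK hc.
- by rewrite hermNl z2u opprK.
- by rewrite hermNl z2t oppr0.
Qed.

End OrderThree.

(** * Elements of order 3 and 4 *)

Section Majorant.
Variable C : numClosedFieldType.
Implicit Types (u v w z : 'cV[C]_3) (A D : 'M[C]_3).
Notation a := (alpha C).
Notation O3 := (@O3 C).
Notation ev := (@ev C).
Notation evV := (@evV C).
Notation oint := (@oint C).

(* [herm z (D *m z) / (2 * a)] is a positive definite form on the lattice;
   its discriminant, computed from [D ^ 2 = - kappa], bounds its minimum. *)
Lemma majorant_min D w z0 (s kappa : int) : O3 w -> O3 z0 -> herm z0 w = 1 ->
  herm w w = s%:~R -> 0 < s -> 0 < kappa ->
  (forall z, perp_lattice w z -> perp_lattice w (D *m z)) ->
  (forall y z, herm y w = 0 -> herm z w = 0 -> herm (D *m y) z = - herm y (D *m z)) ->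
  (forall z, herm z w = 0 -> D *m (D *m z) = (- kappa%:~R) *: z) ->
  (forall z, perp_lattice w z -> z != 0 ->
    exists2 k : nat, (0 < k)%N & herm z (D *m z) = 2 * k%:R * a) ->
  exists u u' (k : int), [/\ lattice_basis w u u', (forall x, O3 (x *: u) -> O2 x),
    herm u (D *m u) = 2 * k%:~R * a, 0 < k & 2 * (k * k) <= s * kappa].
Proof.
move=> ow oz z0w ws s0 kap0 Dperp Dskew Dsq Dpos.
have wn0 : herm w w != 0 by rewrite ws intr_eq0; lia.
have a0 := alpha_neq0 C; have aa := alphaE C; have ac := alpha_conj C.
have n20 : 2 != 0 :> C by rewrite pnatr_eq0.
have [||u [pu u0 uprim umin]] := @min_vector C w z0 ow oz z0w (fun z => herm z (D *m z) / (2 * a)).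
- move=> z pz z1; have [k k0 hk] := Dpos z pz z1; exists k => //.
  by rewrite hk; field; rewrite ?a0 ?n20.
- by move=> x z; rewrite -scalemxAr hermZl hermZr !mulrA.
have [u1 b1] := basis_exists ow oz z0w wn0 pu u0 uprim.
have [k k0 uk] := Dpos u pu u0.
have pu1 : perp_lattice w u1 by case: b1.
have kn : k%:R != 0 :> C by rewrite pnatr_eq0 -lt0n.
have pDu := Dperp _ pu.
have [||r Or hr] := @O2_round C (herm u1 (D *m u) / (2 * k%:R * a)) (4 * k%:Z).
- by lia.
- rewrite intrM -[k%:~R]/(k%:R) [X in O2 X](_ : _ = - a * herm u1 (D *m u)).
    by apply: O2M; [apply/O2N/O2a|apply: O2_herm; [exact: pu1.1|exact: pDu.1]].
  by field: aa; rewrite ?a0 ?n20 ?kn.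
have b2 := basis_shift (O2N Or) b1; set u' := u1 + - r *: u in b2.
have [_ pu' hb] := b2; have pDu' := Dperp _ pu'.
have [m [n hmn]] : O2 (herm u' (D *m u)) by apply: O2_herm; [exact: pu'.1|exact: pDu.1].
have hE : herm u' (D *m u) = (herm u1 (D *m u) / (2 * k%:R * a) - r) * (2 * k%:R * a).
  by rewrite /u' !hermlin uk; field; rewrite ?a0 ?n20 ?kn.
have hr' : herm u' (D *m u) * (herm u' (D *m u))^* <= 3 / 4 * (8 * (k%:R * k%:R)).
  rewrite hE rmorphM /= mulrACA.
  have -> : 2 * k%:R * a * (2 * k%:R * a)^* = 8 * (k%:R * k%:R).
    have -> : (2 * k%:R * a)^* = - (2 * k%:R * a).
      have cM (x y : C) : (x * y)^* = x^* * y^* by rewrite rmorphM.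
      by rewrite (cM _ a) (cM 2) ac (CrealP (realn _ k)) (CrealP (realn _ 2)) mulrN.
    ring: aa.
  by rewrite ler_pM2r // !mulr_gt0 // ltr0n.
have u'0 : u' != 0.
  apply: contraNneq (wn0) => u'0; have := gram_det ow oz z0w wn0 b2.
  by rewrite u'0 !(herm0l, herm0r) mulr0 mul0r subrr => /esym/eqP; rewrite oppr_eq0.
have [l l0 ul] := Dpos u' pu' u'0.
exists u, u', (Posz k); split=> //.
have kl : (k <= l)%N.
  have e (t : C) : 2 * t * a / (2 * a) = t by field; rewrite ?a0.
  by have := umin _ pu' u'0; rewrite uk ul !e ler_nat.
have [p [q [Op Oq DuE]]] := hb _ pDu; have [p' [q' [Op' Oq' Du'E]]] := hb _ pDu'.
have gd := gram_det ow oz z0w wn0 b2.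
(* This is the determinant of [D] on the lattice. From D^2 = -kappa it has modulus kappa, so the
   discriminant of the new form is s kappa up to sign. *)
pose del := p * q' - q * p'.
have h1 : herm u (D *m u) * herm u' (D *m u') - herm u (D *m u') * herm u' (D *m u)
   = - herm w w * del^*.
  by rewrite -gd DuE Du'E !hermlin /del rmorphB !rmorphM /=; ring.
have h2 : herm (D *m u) (D *m u) * herm (D *m u') (D *m u') -
   herm (D *m u) (D *m u') * herm (D *m u') (D *m u) = - herm w w * (del * del^*).
  by rewrite -gd DuE Du'E !hermlin /del rmorphB !rmorphM /=; ring.
have kr : (- kappa%:~R)^* = - kappa%:~R :> C by apply/CrealP; rewrite realN realz.
have {}h2 : del * del^* = kappa%:~R * kappa%:~R.
  apply: (mulfI (_ : - herm w w != 0)); first by rewrite oppr_eq0.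
  have g x y : perp_lattice w x -> perp_lattice w y ->
      herm (D *m x) (D *m y) = kappa%:~R * herm x y.
    move=> px py; rewrite (Dskew _ _ px.2 (Dperp _ py).2) Dsq ?py.2 // hermZr kr.
    by rewrite mulNr opprK.
  by rewrite -h2 -gd !g //; ring.
have h3 : herm u (D *m u') = - oint m (- n).
  by rewrite -oint_conj /oint -hmn hermC Dskew ?opprK ?pu.2 ?pu'.2.
have h4 : s%:~R * del^* = (8 * (k%:Z * l%:Z) - (m * m + 2 * (n * n)))%:~R :> C.
  rewrite h3 uk ul hmn -/(oint m n) mulNr opprK -oint_conj [(oint m n)^* * _]mulrC oint_norm ws in h1.
  rewrite intrB -[LHS]opprK -mulNr -h1 [(8 * _)%:~R]intrM [(k%:Z * _)%:~R]intrM.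
  rewrite -[k%:~R]/(k%:R) -[l%:~R]/(l%:R); ring: aa.
pose E := (8 * (k%:Z * l%:Z) - (m * m + 2 * (n * n))).
have h5 : E * E = s * kappa * (s * kappa).
  have h : s%:~R * del^* = s%:~R * del.
    transitivity (s%:~R * del^*)^*; last by rewrite rmorphM /= conjCK (CrealP (realz _ _)).
    by rewrite h4; apply/esym/CrealP; rewrite realz.
  apply: (@intr_inj C); rewrite intrM -h4 {1}h mulrACA h2 !intrM; ring.
have h6 : E <= s * kappa.
  have : 0 < s * kappa by rewrite mulr_gt0.
  by move: (s * kappa) h5 => t h5 t0; nia.
have h7 : m * m + 2 * (n * n) <= 6 * (k%:Z * k%:Z).
  move: hr'; rewrite hmn -/(oint m n) oint_norm mulrAC ler_pdivlMr ?ltr0n //.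
  rewrite -[k%:R]/(k%:Z%:~R) -[4]/(4%:~R) -[3]/(3%:~R) -[8]/(8%:~R) -!intrM ler_int; lia.
have : k%:Z * k%:Z <= k%:Z * l%:Z by nia.
by move: h6; rewrite /E; lia.
Qed.

(** For z = b v + y the opposite eigenvalues compensate the opposite signs of the form: <z, D z> = i
    rho (<y,y> - |b|^2 <v,v>). It is i times a positive real number and lies in O_2, hence is a
    positive integral multiple of alpha. *)
Lemma eigen_form_pos D v w (rho : C) : 0 < rho -> (forall i j, O2 (D i j)) ->
  herm v v < 0 -> herm v w = 0 -> D *m v = ('i * rho) *: v ->
  (forall y, herm y v = 0 -> herm y w = 0 -> D *m y = - ('i * rho) *: y) ->
  forall z, perp_lattice w z -> z != 0 -> exists2 k : nat, (0 < k)%N & herm z (D *m z) = k%:R * a.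
Proof.
move=> rho0 oD v0 vw Dv Dy z [ oz zw] z1; have vv := ltr0_neq0 v0.
pose b := herm z v / herm v v; pose y := z - b *: v.
have yv : herm y v = 0 by rewrite !hermlin mulfVK // subrr.
have yw : herm y w = 0 by rewrite !hermlin zw vw mulr0 subr0.
have zE : z = b *: v + y by rewrite addrC subrK.
clearbody b y; have ic := conjCi C; have rr := CrealP (ger0_real (ltW rho0)).
have hE : herm z (D *m z) = 'i * (rho * (herm y y - b * b^* * herm v v)).
  rewrite zE mulmxDr -scalemxAr Dv Dy // !hermlin yv (herm_eq0C yv).
  by rewrite [(- _)^*]rmorphN /= (rmorphM _ 'i) /= ic rr; ring.
have Hp : 0 < rho * (herm y y - b * b^* * herm v v).
  rewrite pmulr_rgt0 //.
  have hb : 0 <= - (b * b^* * herm v v) by rewrite oppr_ge0 mulr_ge0_le0 ?mul_conjC_ge0 // ltW.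
  have [y0|y0] := eqVneq y 0; last by rewrite ltr_pwDl // (herm_perp_gt0 v0).
  rewrite y0 herm0l add0r oppr_gt0 pmulr_rlt0 // lt0r mul_conjC_eq0 mul_conjC_ge0 andbT.
  by apply: contraNneq z1 => b0; rewrite zE b0 y0 scale0r addr0.
have [m [n hmn]] : O2 (herm z (D *m z)) by apply: O2_herm => //; exact: O3_mulmx.
have c1 : (herm z (D *m z))^* = - herm z (D *m z).
  by rewrite hE (rmorphM _ 'i) /= ic (CrealP (ger0_real (ltW Hp))) mulNr.
have m0 : m = 0.
  have : oint m (- n) = oint (- m) (- n).
    by rewrite -oint_conj /oint -hmn c1 hmn mulrNz mulrNz; ring.
  by move=> /oint_inj[h _]; lia.
have nn : 0 < n.
  rewrite -(ltr0z C); have : 0 < n%:~R * sqrtC 2 :> C.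
    suff -> : n%:~R * sqrtC 2 = rho * (herm y y - b * b^* * herm v v) by [].
    apply: (mulfI (neq0Ci C)); rewrite -hE hmn m0 add0r /alpha; ring.
  by rewrite pmulr_lgt0 // s2_gt0.
exists `|n|%N; first lia.
by rewrite hmn m0 add0r -[_%:R]/((Posz _)%:~R) gez0_abs // ltW.
Qed.

Lemma alpha_ndvd3 (x : C) : O2 x -> a * x <> 3.
Proof.
move=> Ox h; apply: (@alpha_not_unit C (x + a)); first by apply: O2D => //; exact: O2a.
by rewrite mulrDr h alphaE; ring.
Qed.

Lemma norm_eq2_alpha (y : C) : O2 y -> y * y^* = 2 -> exists2 e : C, O2 e & e * e = 1 /\ y = a * e.
Proof.
move=> [m [n yE]]; rewrite -/(oint m n) in yE; rewrite yE oint_norm => h.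
have {}h : m * m + 2 * (n * n) = 2 by apply: (@intr_inj C).
have [-> n1] := norm_eq2 h; exists n%:~R; first exact: O2z.
by rewrite -intrM n1 /oint add0r mulrC.
Qed.

(** The residue field of alpha has two elements, as alpha^2 = -2. *)
Lemma mod_alpha (x : C) : O2 x -> exists2 y, O2 y & x = a * y \/ x = 1 + a * y.
Proof.
move=> [m [n ->]].
have h := divz_eq m 2; have h2 : 0 <= (m %% 2)%Z by apply: modz_ge0.
have h3 : (m %% 2)%Z < 2 by apply: ltz_pmod.
exists (oint n (- (m %/ 2)%Z)); first exact: O2_oint.
move: h h2 h3; move: (_ %/ _)%Z (_ %% _)%Z => q r h h2 h3.
have e : m%:~R + n%:~R * a = r%:~R + a * oint n (- q).
  have aa := alphaE C; rewrite h /oint intrD intrM mulrNz; ring: aa.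
have [r0|r1] : r = 0 \/ r = 1 by lia.
  by left; rewrite e r0 add0r.
by right; rewrite e r1.
Qed.

(** An element of norm 2 is alpha up to sign, so [t] is congruent to a multiple of [u] modulo alpha,
    and that multiple is 0 or 1. *)
Lemma alpha_neighbour w u u' t x y : lattice_basis w u u' -> O2 x -> O2 y -> y * y^* = 2 ->
  t = x *: u + y *: u' -> exists2 r, perp_lattice w r & t = a *: r \/ t = u + a *: r.
Proof.
move=> [pu pu' _] Ox Oy y2 tE; have [e Oe [_ yE]] := norm_eq2_alpha Oy y2.
have [x' Ox' xE] := mod_alpha Ox; exists (x' *: u + e *: u').
  split; first by apply: O3D; apply: O3Z => //; [exact: pu.1|exact: pu'.1].
  by rewrite !hermlin pu.2 pu'.2 !mulr0 addr0.
rewrite tE yE scalerDr !scalerA; case: xE => ->; [left|right] => //.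
by rewrite scalerDl scale1r addrA.
Qed.

End Majorant.

(** * Fixed points orthogonal to a positive eigenvector *)

Section OrderFour.
Variable C : numClosedFieldType.
Implicit Types (u v w z : 'cV[C]_3) (A D : 'M[C]_3).
Notation a := (alpha C).
Notation O3 := (@O3 C).
Notation ev := (@ev C).
Notation evV := (@evV C).
Notation oint := (@oint C).

Lemma ev_al : ev zal = a.
Proof. by rewrite /zal -[zo 0 1]/(zo (Z_of_int 0) (Z_of_int 1)) ev_oint /oint add0r mul1r. Qed.

(** Here and in [frame6], the first vector of the model frame is the polar vector of the reflection
    in the isotropy group of the point. *)
Lemma frame7 w u t : O3 w -> O3 u -> O3 t -> herm w w = 1 -> herm w u = 0 -> herm w t = 0 ->
  herm u u = 1 -> herm u t = a -> herm t t = 1 ->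
  orbit2 (line (evV q7)) (line (u - 'i *: t)).
Proof.
move=> ow ou ot ww wu wt uu ut tt.
have -> : u - 'i *: t = ev (0, 0, 0, 0)%bZ *: w + ev (zz 1) *: u + ev (0, 0, 0, -1)%bZ *: t.
  have e1 : ev (zz 1) = 1 by rewrite ev_zz.
  rewrite e1 [ev (0, 0, 0, 0)%bZ](ev_zz C 0) scale0r add0r scale1r.
  by congr (_ + _); rewrite -scaleNr /ev -?[zr C 1]/(1 : C) -?[zr C 0]/(0 : C) -?[zr C (-1)%bZ]/(- 1 : C); congr (_ *: _); ring.
apply: (@orbit_frame_ok _ (zv 0 1 1 0 1 0)%bZ (zv (-1) 0 1 0 0 0)%bZ (zv 1 0 (-1) (-1) (-1) 0)%bZ
   ((zv 1 0 1 0 0 (-1)), (zv 0 1 1 1 1 (-1)), (zv 1 0 1 0 (-1) (-1)))%bZ) => //.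
- by evz 1%bZ; rewrite ww.
- by evz 1%bZ; rewrite uu.
- by evz 1%bZ; rewrite tt.
- by evz 0%bZ.
- by evz 0%bZ.
- by rewrite ut -ev_al; apply: vm_ev; vm_compute.
Qed.

Lemma frame6 w u t : O3 w -> O3 u -> O3 t -> herm w w = 1 -> herm w u = 0 -> herm w t = 0 ->
  herm u u = 0 -> herm u t = -1 -> herm t t = 0 ->
  orbit2 (line (evV q6)) (line ((1 - 'i) *: u + sqrtC 2 *: t)).
Proof.
move=> ow ou ot ww wu wt uu ut tt.
have -> : (1 - 'i) *: u + sqrtC 2 *: t =
   ev (0, 0, 0, 0)%bZ *: w + ev (1, 0, 0, -1)%bZ *: u + ev (0, 0, 1, 0)%bZ *: t.
  rewrite [ev (0, 0, 0, 0)%bZ](ev_zz C 0) scale0r add0r.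
  by rewrite /ev -?[zr C 1]/(1 : C) -?[zr C 0]/(0 : C) -?[zr C (-1)%bZ]/(- 1 : C); congr (_ *: _ + _ *: _); ring.
apply: (@orbit_frame_ok _ (zv 0 1 1 0 0 0)%bZ (zv (-1) (-1) (-2) 0 0 1)%bZ (zv 1 (-1) 0 (-1) (-1) 0)%bZ
   ((zv 0 0 1 0 0 (-1)), (zv 1 0 0 (-1) (-1) (-1)), (zv 0 1 2 0 1 (-1)))%bZ) => //.
- by evz 1%bZ; rewrite ww.
- by evz 0%bZ; rewrite uu.
- by evz 0%bZ; rewrite tt.
- by evz 0%bZ.
- by evz 0%bZ.
- by evz (-1)%bZ; rewrite ut.
Qed.

(** On the complement of [w] one has A^2 = -1, and <z, A z> / alpha is a positive integer there. A
    minimal vector [u] has value 1; its norm n then satisfies n^2 <= 2, and n decides between the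
    two orbits. *)
Lemma order4_orbit A v w z0 (s : int) : unitaryO A -> O3 w -> O3 z0 -> herm z0 w = 1 ->
  A *m w = w -> herm w w = s%:~R -> 0 < s -> (exists t, s * t = 2) ->
  herm v v < 0 -> herm v w = 0 -> A *m v = 'i *: v ->
  (forall y, herm y v = 0 -> herm y w = 0 -> A *m y = - 'i *: y) ->
  orbit2 (line (evV q6)) (line v) \/ orbit2 (line (evV q7)) (line v).
Proof.
move=> uA ow oz0 z0w Aw ws s0 s2 v0 vw Av Ay.
have vv := ltr0_neq0 v0; have ii := i2E C; have ic := conjCi C.
have vy x : herm x v = 0 -> herm v x = 0 := @herm_eq0C _ _ _.
have split z : herm z w = 0 -> exists b y, [/\ z = b *: v + y, herm y v = 0 & herm y w = 0].
  move=> zw; exists (herm z v / herm v v), (z - (herm z v / herm v v) *: v).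
  by rewrite addrC subrK !hermlin mulfVK // subrr zw vw mulr0 subr0.
have Az b y : herm y v = 0 -> herm y w = 0 -> A *m (b *: v + y) = ('i * b) *: v + - 'i *: y.
  by move=> yv yw; rewrite mulmxDr -scalemxAr Av scalerA mulrC Ay.
have Asq z : herm z w = 0 -> A *m (A *m z) = - z.
  move=> /split[b [y [-> yv yw]]]; rewrite Az // Az ?hermZl ?yv ?yw ?mulr0 //.
  by rewrite !scalerA mulrA ii mulrNN ii mulN1r !scaleNr scale1r opprD.
have Aperp z : perp_lattice w z -> perp_lattice w (A *m z) by apply: unitaryO_perp.
have Askew y z : herm y w = 0 -> herm (A *m y) z = - herm y (A *m z).
  by move=> yw; rewrite -(herm_unitary (A *m y) z uA.1) Asq // hermNl.
have Apos z : perp_lattice w z -> z != 0 -> exists2 k : nat, (0 < k)%N & herm z (A *m z) = k%:R * a.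
  apply: (@eigen_form_pos C A v w 1 ltr01 uA.2 v0 vw); first by rewrite mulr1.
  by move=> y yv yw; rewrite mulr1; apply: Ay.
case: s2 => t s2; have {s2} [s1|s2] : s = 1 \/ s = 2.
  have t0 : 0 < t by nia.
  have : s <= 2 by nia.
  by lia.
  2: { exfalso; subst s.
  have ww2 : herm w w = 2 by rewrite ws.
  (* For s = 2 this vector is orthogonal to [w]. Skewness of [A] at it makes the trace of <z0, A z0>
     equal to 1, whereas traces from O_2 are even. *)
  pose e := z0 + z0 - w.
  have ew : herm e w = 0 by rewrite !hermlin z0w ww2; ring.
  have wz0 : herm w z0 = 1 by rewrite -hermC z0w rmorph1.
  have := Askew e e ew; rewrite mulmxBr mulmxDr Aw.
  have h1 : herm w (A *m z0) = 1 by rewrite -{1}Aw (herm_unitary _ _ uA.1).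
  have h2 : herm (A *m z0) w = 1 by rewrite -{1}Aw (herm_unitary _ _ uA.1).
  rewrite !hermlin wz0 z0w h1 h2 ww2 => h.
  have [m [n hmn]] : O2 (herm z0 (A *m z0)) by apply: O2_herm => //; exact: O3_mulmx uA.2 oz0.
  have {}h : herm z0 (A *m z0) + (herm z0 (A *m z0))^* = 1.
    rewrite hermC; apply: (mulfI (_ : 4 != 0 :> C)); first by rewrite pnatr_eq0.
    apply/eqP; rewrite -subr_eq0; apply/eqP; move/eqP: h; rewrite -subr_eq0 => /eqP h.
    by rewrite -[RHS]h; ring.
  move: h; rewrite hmn -/(oint m n) oint_conj => h.
  have : oint (2 * m) 0 = oint 1 0 by rewrite /oint mul0r !addr0 -[RHS]h /oint intrM mulrNz; ring.
  by move=> /oint_inj[h' _]; lia. }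
subst s; have ww : herm w w = 1 by rewrite ws.
have AA z : (A + A) *m z = A *m z + A *m z by rewrite mulmxDl.
(* The double of [A] is used because [majorant_min] works with even multiples of alpha; its square
   is -4, and the bound leaves k = 1. *)
have [|y z yw zw|z zw|z pz z1|u [u' [k [bs uprim uAu k0 kk]]]] :=
   @majorant_min C (A + A) w z0 1 4 ow oz0 z0w ws isT isT.
- move=> z pz; rewrite AA; have [h1 h2] := Aperp _ pz.
  by split; [exact: O3D|rewrite hermDl h2 addr0].
- by rewrite !AA hermDl hermDr Askew // opprD.
- rewrite !AA mulmxDr Asq //.
  by apply/matrixP => i j; rewrite !mxE -[4%:~R]/(4 : C); ring.
- by have [k k0 hk] := Apos z pz z1; exists k => //; rewrite AA hermDr hk; ring.
have k1 : k = 1 by nia.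
have {uAu} uAu : herm u (A *m u) = a.
  apply: (mulfI (_ : 2 != 0 :> C)); first by rewrite pnatr_eq0.
  by rewrite mulr_natl mulr2n -hermDr -AA uAu k1 mulr1.
have [pu pu' hb] := bs; have [ ou uw] := pu; have pAu := Aperp _ pu.
have Auu : herm (A *m u) u = - a by rewrite Askew // uAu.
have AuAu := herm_unitary u u uA.1.
have [n hn] := herm_int ou.
have [p [y [Op Oy AuE]]] := hb _ pAu.
have [l yl _] := O2_norm Oy.
have w0 : herm w w != 0 by rewrite ws intr_eq0.
have hnl : n * n + l%:Z = 2.
  have h := gram_line ow oz0 z0w w0 bs AuE; rewrite ww uAu Auu AuAu mulN1r in h.
  apply: (@intr_inj C); rewrite intrD intrM -[(l%:Z)%:~R]/(l%:R : C) -yl -hn.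
  have aa := alphaE C; rewrite -[X in _ + X]opprK -h -[2%:~R]/(2 : C); ring: aa.
(* The operator 1 - i A kills the eigenvalue -i and doubles [v], so it projects [z] onto the line of
   [v]. *)
have vline b c y' z : z = b *: v + y' -> herm y' v = 0 -> herm y' w = 0 -> b != 0 ->
    c != 0 -> line v = line (c *: (z - 'i *: (A *m z))).
  move=> -> h1 h2 b0 c0; rewrite Az // (_ : _ - _ = (2 * b) *: v).
    by rewrite scalerA lineZ // !mulf_neq0 // pnatr_eq0.
  by apply/matrixP => i j; rewrite !mxE; ring: ii.
(* If the component along [v] vanished, [z] would belong to the eigenvalue -i and have norm -i alpha
   = sqrt 2. *)
have bn0 z b y' : z = b *: v + y' -> herm y' v = 0 -> herm y' w = 0 ->
    herm z (A *m z) = a -> herm z z * herm z z != 2 -> b != 0.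
  move=> zE h1 h2 hz; apply: contraNneq => b0; rewrite zE b0 scale0r add0r.
  move: hz; rewrite zE b0 scale0r add0r Ay // hermZr rmorphN /= ic opprK => h.
  have h' : herm y' y' = - 'i * a by rewrite -h mulrA mulNr ii opprK mul1r.
  have aa := alphaE C; rewrite h' -subr_eq0; apply/eqP; ring: ii aa.
have case1 z : perp_lattice w z -> herm z z = 1 -> herm z (A *m z) = a ->
    orbit2 (line (evV q7)) (line v).
  move=> [ oz zw] zz zAz; have [b [y' [zE yv yw]]] := split z zw.
  have b0 : b != 0 by apply: (bn0 z b y') => //; rewrite zz mulr1 eq_sym -subr_eq0 addrK oner_eq0.
  rewrite (vline _ 1 _ _ zE yv yw b0 (oner_neq0 _)) scale1r.
  have [h1 h2] := Aperp _ (conj oz zw).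
  exact: (frame7 ow oz h1 ww (herm_eq0C zw) (herm_eq0C h2) zz zAz (etrans (herm_unitary z z uA.1) zz)).
have [n1|[n0|n1]] : n = -1 \/ n = 0 \/ n = 1 by apply: small_int; lia.
(* This vector has norm 3 n + 4 = 1 and the same product alpha with its image. *)
- right; apply: (case1 (u + a *: (A *m u))).
  + by apply: perpZD => //; exact: O2a.
  + rewrite !hermlin AuAu uAu Auu hn n1 alpha_conj mulrN1z.
    have aa := alphaE C; ring: aa.
  + rewrite mulmxDr -scalemxAr Asq // !hermlin AuAu uAu Auu hn n1 alpha_conj mulrN1z.
    have aa := alphaE C; ring: aa.
- left; rewrite n0 in hn.
  have l2 : l = 2%N by lia.
  (* The image of [u] is congruent to 0 or to [u] modulo alpha; the first would make [u] divisible
     by alpha. *)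
  rewrite l2 in yl; have [t1 ot1 [At1|At1]] := alpha_neighbour bs Op Oy yl AuE.
    exfalso; have := Asq u uw; rewrite At1 -scalemxAr => h.
    have Ox : O2 (a^-1 : C).
      apply: uprim; rewrite -[u]opprK -h scalerN scalerA mulVf ?alpha_neq0 // scale1r.
      by apply: O3N; exact: (Aperp _ ot1).1.
    by apply: (alpha_not_unit Ox); rewrite mulfV ?alpha_neq0.
  have t1u : herm t1 u = -1.
    apply: (mulfI (alpha_neq0 C)); rewrite mulrN1 -Auu At1 !hermlin hn.
    by rewrite -[0%:~R]/(0 : C) add0r.
  have ut1 : herm u t1 = -1 by rewrite -hermC t1u rmorphN rmorph1.
  have t1t1 : herm t1 t1 = 0.
    move: AuAu; rewrite At1 !hermlin hn t1u ut1 alpha_conj -[0%:~R]/(0 : C) => h.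
    apply: (mulfI (_ : 2 != 0 :> C)); first by rewrite pnatr_eq0.
    have aa := alphaE C; rewrite mulr0 -[RHS]h; ring: aa.
  have [b [y' [uE yv yw]]] := split u uw.
  have b0 : b != 0.
    by apply: (bn0 u b y') => //; rewrite hn mulr0 eq_sym pnatr_eq0.
  rewrite (vline _ 1 _ _ uE yv yw b0 (oner_neq0 _)) scale1r.
  have -> : u - 'i *: (A *m u) = (1 - 'i) *: u + sqrtC 2 *: t1.
    rewrite At1 scalerDr scalerBl scale1r opprD addrA; congr (_ + _).
    by rewrite scalerA -scaleNr /alpha mulrA ii mulN1r opprK.
  have hu : herm u u = 0 by rewrite hn.
  exact: (frame6 ow ou ot1.1 ww (herm_eq0C uw) (herm_eq0C ot1.2) hu ut1 t1t1).
right; apply: (case1 u) => //; by rewrite hn n1.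
Qed.

(** The same method with D = 2 A + 1, whose square is -3 on the complement of [w], ends in a
    contradiction: the minimal vector would fail to be primitive at alpha. *)
Lemma order3_no_isolated A v w z0 (s : int) c : unitaryO A -> O3 w -> O3 z0 -> herm z0 w = 1 ->
  A *m w = w -> herm w w = s%:~R -> 0 < s -> (exists t, s * t = 3) ->
  herm v v < 0 -> herm v w = 0 -> 2 * c + 1 = 'i * sqrtC 3 -> A *m v = c *: v ->
  (forall y, herm y v = 0 -> herm y w = 0 -> A *m y = (- 1 - c) *: y) -> False.
Proof.
move=> uA ow oz0 z0w Aw ws s0 s3 v0 vw cE Av Ay.
have vv := ltr0_neq0 v0; have aa := alphaE C.
have cc : c * c = - 1 - c.
  apply: (mulfI (_ : 4 != 0 :> C)); first by rewrite pnatr_eq0.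
  have e : (2 * c + 1) * (2 * c + 1) = - 3 by rewrite cE mulrACA i2E -expr2 sqrtCK mulN1r.
  apply/eqP; rewrite -subr_eq0; apply/eqP; move/eqP: e; rewrite -subr_eq0 => /eqP e.
  by rewrite -[RHS]e; ring.
have Asq z : herm z w = 0 -> A *m (A *m z) = - z - A *m z.
  move=> zw; pose b := herm z v / herm v v; pose y := z - b *: v.
  have yv : herm y v = 0 by rewrite !hermlin mulfVK // subrr.
  have yw : herm y w = 0 by rewrite !hermlin zw vw mulr0 subr0.
  have -> : z = b *: v + y by rewrite addrC subrK.
  clearbody b y; rewrite mulmxDr -scalemxAr Av (Ay y yv yw) mulmxDr -!scalemxAr Av (Ay y yv yw).
  apply/matrixP => i j; rewrite !mxE; ring: cc.
have Aperp z : perp_lattice w z -> perp_lattice w (A *m z) by apply: unitaryO_perp.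
have Askew y z : herm z w = 0 -> herm (A *m y) z = - herm y z - herm y (A *m z).
  move=> zw; rewrite -!(herm_unitary y _ uA.1) -hermNr -hermBr Asq //; congr herm.
  by apply/matrixP => i j; rewrite !mxE; ring.
pose D := A + A + 1%:M.
have DE z : D *m z = A *m z + A *m z + z by rewrite !mulmxDl mul1mx.
have [|y z yw zw|z zw|z pz z1|u [u' [k [bs uprim uDu k0 kk]]]] :=
   @majorant_min C D w z0 s 3 ow oz0 z0w ws s0 isT.
- move=> z pz; rewrite DE; have [h1 h2] := Aperp _ pz.
  split; first by apply: O3D; [exact: O3D|exact: pz.1].
  by rewrite !hermDl h2 pz.2 !addr0.
- by rewrite !DE !hermDl !hermDr Askew //; ring.
- rewrite !DE !mulmxDr Asq //.
  by apply/matrixP => i j; rewrite !mxE -[3%:~R]/(3 : C); ring.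
- have s30 : 0 < sqrtC 3 :> C by rewrite sqrtC_gt0 ltr0n.
  have oD i j : O2 (D i j).
    rewrite !mxE; apply: O2D; first by apply: O2D; exact: uA.2.
    by case: (i == j); [exact: O21|exact: O20].
  have [||k k0 hk] := @eigen_form_pos C D v w _ s30 oD v0 vw _ _ z pz z1.
  + by rewrite DE Av -cE; apply/matrixP => i j; rewrite !mxE; ring.
  + by move=> y yv yw; rewrite DE Ay // -cE; apply/matrixP => i j; rewrite !mxE; ring.
  have [m [n hmn]] : O2 (herm z (A *m z)).
    by apply: O2_herm; [exact: pz.1|exact: (Aperp _ pz).1].
  have [N hN] := herm_int pz.1.
  have h : oint 0 k%:Z = oint (2 * m + N) (2 * n).
    rewrite /oint add0r -[k%:~R]/(k%:R) -hk DE !hermDr hmn hN intrD !intrM; ring.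
  have [h1 h2] := oint_inj h; exists `|n|%N; first by lia.
  have kE : k = (2 * `|n|)%N by lia.
  by rewrite hk kE natrM.
have [pu pu' hb] := bs; have [ ou uw] := pu; have pAu := Aperp _ pu.
have AuAu := herm_unitary u u uA.1.
have [m [n hmn]] : O2 (herm u (A *m u)) by apply: O2_herm => //; exact: pAu.1.
have [N hN] := herm_int ou.
have [n1 N1] : n = k /\ N = - (2 * m).
  have h : oint 0 (2 * k) = oint (2 * m + N) (2 * n).
    rewrite /oint add0r !intrM -uDu DE !hermDr hmn hN intrD !intrM; ring.
  by have [] := oint_inj h; lia.
have [p [y [Op Oy AuE]]] := hb _ pAu.
have [l yl _] := O2_norm Oy.
have w0 : herm w w != 0 by rewrite ws intr_eq0; lia.
have hl : 3 * (m * m) + s * l%:Z = 2 * (k * k).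
  have h := gram_line ow oz0 z0w w0 bs AuE.
  rewrite ws AuAu -(hermC u (A *m u)) hmn -/(oint m n) oint_norm yl hN N1 n1 in h.
  have {}h : - (2 * m) * - (2 * m) - (m * m + 2 * (k * k)) = - (s * l%:Z).
    apply: (@intr_inj C); rewrite intrB intrM h mulrNz intrM; ring.
  by lia.
case: s3 => t s3; have s13 : s = 1 \/ s = 3.
  have t0 : 0 < t by nia.
  have s3' : s <= 3 by nia.
  have [->|[sE|->]] : s = 1 \/ s = 2 \/ s = 3 by lia.
  - by left.
  - by exfalso; lia.
  - by right.
(* For s = 3 the relation would make 2 k^2 divisible by 3, although k is 1 or 2. *)
case: s13 => sE; subst s; last first.
  have k2 : k = 1 \/ k = 2 by nia.
  by case: k2 => kE; subst k; lia.
have k1 : k = 1 by nia.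
have [m0 l2] : m = 0 /\ l = 2%N by nia.
rewrite l2 in yl; have a0 := alpha_neq0 C; have Asqu := Asq u uw.
(* If the image of [u] is 0 modulo alpha, then alpha divides [u]; if it is [u], then 1 + A + A^2 = 0
   makes alpha divide 3 [u]. Both contradict primitivity. *)
have [t1 ot1 [At1|At1]] := alpha_neighbour bs Op Oy yl AuE; have pt1 := Aperp _ ot1.
  rewrite At1 -scalemxAr in Asqu.
  have uE : u = a *: - (A *m t1 + t1).
    by rewrite scalerN scalerDr Asqu subrK opprK.
  have Ox : O2 (a^-1 : C).
    apply: uprim; rewrite uE scalerA mulVf // scale1r.
    by apply/O3N/O3D; [exact: pt1.1|exact: ot1.1].
  by apply: (alpha_not_unit Ox); rewrite mulfV.
rewrite At1 mulmxDr At1 -scalemxAr in Asqu.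
have uE : 3 *: u = a *: - (A *m t1 + t1 + t1).
  have -> : a *: - (A *m t1 + t1 + t1) = - (u + a *: t1 + a *: (A *m t1)) + u - a *: t1.
    by apply/matrixP => i j; rewrite !mxE; ring.
  by rewrite Asqu; apply/matrixP => i j; rewrite !mxE; ring.
have Ox : O2 (a^-1 * 3 : C).
  apply: uprim; rewrite -scalerA uE scalerA mulVf // scale1r.
  by apply/O3N/O3D; [apply: O3D; [exact: pt1.1|exact: ot1.1]|exact: ot1.1].
by apply: (alpha_ndvd3 Ox); rewrite mulrA mulfV // mul1r.
Qed.

End OrderFour.

(** * Eigenframes and traces *)

(** The second inequality is that of the deltoid for t = m + n alpha, where Re t^3 = m^3 - 6 m
    n^2. *)
Lemma trace_ints (m n : int) : m * m + 2 * (n * n) <= 9 ->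
  (m * m + 2 * (n * n)) * (m * m + 2 * (n * n)) - 8 * (m * (m * m) - 6 * (m * (n * n)))
    + 18 * (m * m + 2 * (n * n)) <= 27 ->
  (n = 0 /\ (m = 3 \/ m = -1 \/ m = 0 \/ m = 1 \/ m = 2)) \/ (m = -1 /\ n * n = 1).
Proof.
move=> h1 h2; have m1 : -3 <= m by nia.
have m2 : m <= 3 by nia.
have n1 : -2 <= n by nia.
have n2 : n <= 2 by nia.
have hm : m = -3 \/ m = -2 \/ m = -1 \/ m = 0 \/ m = 1 \/ m = 2 \/ m = 3 by lia.
have hn : n = -2 \/ n = -1 \/ n = 0 \/ n = 1 \/ n = 2 by lia.
clear m1 m2 n1 n2.
by case: hm => [|[|[|[|[|[|]]]]]] mE; case: hn => [|[|[|[|]]]] nE; subst; lia.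
Qed.

Section Frames.
Variable C : numClosedFieldType.
Implicit Types (p q r v w y z : 'cV[C]_3) (A B : 'M[C]_3).
Notation a := (alpha C).
Notation O3 := (@O3 C).
Notation oint := (@oint C).

Definition orth_frame v y z :=
  [/\ herm v v < 0, y != 0 & z != 0] /\ [/\ herm y v = 0, herm z v = 0 & herm z y = 0].

Definition eigen_frame A v y z c e f := [/\ A *m v = c *: v, A *m y = e *: y & A *m z = f *: z].

Lemma orth_frame_swap v y z : orth_frame v y z -> orth_frame v z y.
Proof. by move=> [[? ? ?] [? ? /herm_eq0C ?]]. Qed.

Lemma eigen_frame_mul A B v y z c e f c' e' f' : eigen_frame A v y z c e f ->
  eigen_frame B v y z c' e' f' -> eigen_frame (A *m B) v y z (c * c') (e * e') (f * f').
Proof.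
move=> [hv hy hz] [hv' hy' hz'].
by split; rewrite -mulmxA ?hv' ?hy' ?hz' -scalemxAr ?hv ?hy ?hz scalerA mulrC.
Qed.

Lemma orth_frame_det v y z : orth_frame v y z -> \det (cols v y z) != 0.
Proof.
move=> [[v0 y0 z0] [yv zv zy]]; apply/eqP => /cols_dep[x [x0 hx]].
have vn := ltr0_neq0 v0; have yn := lt0r_neq0 (herm_perp_gt0 v0 yv y0).
have zn := lt0r_neq0 (herm_perp_gt0 v0 zv z0).
have e1 := congr1 (fun t : 'cV[C]_3 => herm t v) hx; have e2 := congr1 (fun t : 'cV[C]_3 => herm t y) hx.
have e3 := congr1 (fun t : 'cV[C]_3 => herm t z) hx.
rewrite !hermlin yv zv herm0l !mulr0 !addr0 in e1.
rewrite !hermlin (herm_eq0C yv) zy herm0l !mulr0 addr0 add0r in e2.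
rewrite !hermlin (herm_eq0C zv) (herm_eq0C zy) herm0l !mulr0 !add0r in e3.
move/eqP: e1; move/eqP: e2; move/eqP: e3.
rewrite !mulf_eq0 (negbTE vn) (negbTE yn) (negbTE zn) !orbF => /eqP x2 /eqP x1 /eqP x00.
case/eqP: x0; apply/matrixP => i j; rewrite mxE ord1.
by case: i => [[|[|[|]]]] // ?; [rewrite -x00|rewrite -x1|rewrite -x2]; congr (x _ _); apply: val_inj.
Qed.

Lemma orth_frame_split v y z r : orth_frame v y z ->
  r = (herm r v / herm v v) *: v + (herm r y / herm y y) *: y + (herm r z / herm z z) *: z.
Proof.
move=> F; have [[v0 y0 z0] [yv zv zy]] := F.
have vn := ltr0_neq0 v0; have yn := lt0r_neq0 (herm_perp_gt0 v0 yv y0).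
have zn := lt0r_neq0 (herm_perp_gt0 v0 zv z0).
have vy := herm_eq0C yv; have vz := herm_eq0C zv; have yz := herm_eq0C zy.
have uP : cols v y z \in unitmx by rewrite unitmxE unitfE orth_frame_det.
have := mulKVmx uP r; rewrite cols_mul; move: (_ *m r) => x <-.
rewrite !hermlin yv zv zy vy vz yz !mulr0 !addr0 !add0r.
by rewrite !mulfK.
Qed.

Lemma orth_frame_perp v y z r : orth_frame v y z -> herm r v = 0 -> herm r y = 0 ->
  r = (herm r z / herm z z) *: z.
Proof. by move=> F rv ry; rewrite [LHS](orth_frame_split r F) rv ry !mul0r !scale0r !add0r. Qed.

Section Unitary.
Variable A : 'M[C]_3.
Hypothesis hA : adjoint A *m Jmx C *m A = Jmx C.

Lemma eigen_unit v c : herm v v != 0 -> A *m v = c *: v -> c * c^* = 1.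
Proof.
move=> v0 Av; have := herm_unitary v v hA; rewrite Av hermZl hermZr mulrA.
by rewrite -[RHS]mul1r => /(mulIf v0).
Qed.

Lemma eigen_perp v c r : A *m v = c *: v -> c * c^* = 1 -> herm r v = 0 -> herm (A *m r) v = 0.
Proof.
move=> Av c1 rv; have := herm_unitary r v hA; rewrite Av hermZr rv => /eqP.
rewrite mulf_eq0 => /orP[/eqP c0|/eqP //]; exfalso.
by move/eqP: c1; rewrite c0 mulr0 eq_sym oner_eq0.
Qed.

(** The complement of [v] is invariant and positive definite, so an eigenvector in it and the
    perpendicular of that eigenvector complete the frame. *)
Lemma eigen_frame_exists v c : herm v v < 0 -> A *m v = c *: v ->
  exists y z e f, orth_frame v y z /\ eigen_frame A v y z c e f.
Proof.
move=> v0 Av; have c1 := eigen_unit (ltr0_neq0 v0) Av.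
have [p [p0 pv _]] := exists_perp2 v v; have [q [q0 qv qp]] := exists_perp2 v p.
have F : orth_frame v p q by [].
pose b (i : 'I_2) := if i == 0 then p else q.
have bv i : herm (b i) v = 0 by rewrite /b; case: ifP.
pose M : 'M[C]_2 := \matrix_(i, j) (herm (A *m b i) (b j) / herm (b j) (b j)).
have Ab i : A *m b i = M i 0 *: p + M i 1 *: q.
  rewrite [LHS](orth_frame_split _ F) (eigen_perp Av c1 (bv i)) mul0r scale0r add0r.
  by rewrite !mxE.
(* Eigenvectors are rows here, so [M] holds the coordinates of the images of the basis in its
   rows. *)
have [//|e /eigenvalueP[x xM x0]] := @eigenvalue_closed C 2 M.
pose y := x 0 0 *: p + x 0 1 *: q.
have Ay : A *m y = e *: y.
  clearbody M; have x0E := congr1 (fun t : 'rV[C]_2 => t 0 0) xM.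
  have x1E := congr1 (fun t : 'rV[C]_2 => t 0 1) xM.
  have l1 : lift ord0 ord0 = 1 :> 'I_2 by apply: val_inj.
  rewrite !mxE !big_ord_recl !big_ord0 ?l1 !addr0 in x0E x1E.
  rewrite mulmxDr -!scalemxAr (Ab 0 : A *m p = _) (Ab 1 : A *m q = _).
  have -> : e *: y = (e * x 0 0) *: p + (e * x 0 1) *: q by rewrite /y scalerDr !scalerA.
  by rewrite -x0E -x1E !scalerDr !scalerDl !scalerA addrACA.
have y0 : y != 0.
  have pn := lt0r_neq0 (herm_perp_gt0 v0 pv p0); have qn := lt0r_neq0 (herm_perp_gt0 v0 qv q0).
  apply: contraNneq x0 => y0.
  have e1 := congr1 (fun t : 'cV[C]_3 => herm t p) y0; have e2 := congr1 (fun t : 'cV[C]_3 => herm t q) y0.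
  rewrite !hermlin qp herm0l mulr0 addr0 in e1; rewrite !hermlin (herm_eq0C qp) herm0l mulr0 add0r in e2.
  move/eqP: e1; move/eqP: e2; rewrite !mulf_eq0 (negbTE pn) (negbTE qn) !orbF => /eqP h1 /eqP h0.
  by apply/eqP/matrixP => i j; rewrite mxE ord1; case: j => [[|[|]]] // ?;
    [rewrite -h0|rewrite -h1]; congr (x _ _); apply: val_inj.
have yv : herm y v = 0 by rewrite !hermlin pv qv !mulr0 addr0.
have e1 := eigen_unit (lt0r_neq0 (herm_perp_gt0 v0 yv y0)) Ay.
have [z [z0 zv zy]] := exists_perp2 v y.
have F' : orth_frame v y z by [].
exists y, z, e, (herm (A *m z) z / herm z z); split=> //; split=> //.
exact: orth_frame_perp F' (eigen_perp Av c1 zv) (eigen_perp Ay e1 zy).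
Qed.

Lemma eigen_frame_trace v y z c e f : orth_frame v y z -> eigen_frame A v y z c e f ->
  \tr A = c + e + f /\ \det A = c * e * f.
Proof.
move=> F [Av Ay Az]; pose P := cols v y z.
have uP : P \in unitmx by rewrite unitmxE unitfE orth_frame_det.
pose D := diag_mx (\row_j nth 0 [:: c; e; f] j) : 'M[C]_3.
have AP : A *m P = P *m D.
  apply/matrixP => i j; rewrite mul_mx_diag !mxE.
  under eq_bigr do rewrite mxE.
  have h (t : 'cV[C]_3) : \sum_k A i k * t k 0 = (A *m t) i 0 by rewrite mxE.
  by case: j => [[|[|[|]]]] // ?; rewrite /= h ?Av ?Ay ?Az mxE mulrC.
have AE : A = P *m D *m invmx P by rewrite -AP mulmxK.
split; rewrite AE.
  by rewrite mxtrace_mulC mulKmx // mxtrace_diag !big_ord_recl big_ord0 !mxE /= addr0 addrA.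
rewrite !det_mulmx mulrC mulrA -det_mulmx mulVmx // det1 mul1r det_diag.
by rewrite !big_ord_recl big_ord0 !mxE /= mulr1 mulrA.
Qed.

End Unitary.

(* The discriminant of the characteristic polynomial of an element of SU(3) is
   minus the product of the squared distances between the eigenvalues. *)
Lemma unit_trace_disc (c e f : C) : c * c^* = 1 -> e * e^* = 1 -> f * f^* = 1 -> c * e * f = 1 ->
  let t := c + e + f in
  let d := (t * t^*) * (t * t^*) - 4 * (t * t * t + (t * t * t)^*) + 18 * (t * t^*) in
  [/\ t^* = e * f + c * f + c * e, t * t^* <= 9, d <= 27 & (c = e -> d = 27)].
Proof.
move=> c1 e1 f1 cef t d.
have cn : c != 0 by apply: contra_eq_neq c1 => ->; rewrite mul0r eq_sym oner_neq0.
have en : e != 0 by apply: contra_eq_neq e1 => ->; rewrite mul0r eq_sym oner_neq0.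
have fn : f != 0 by apply: contra_eq_neq f1 => ->; rewrite mul0r eq_sym oner_neq0.
have cC : c^* = e * f by apply: (mulfI cn); rewrite c1 -cef mulrA.
have eC : e^* = c * f by apply: (mulfI en); rewrite e1 -cef; ring.
have fC : f^* = c * e by apply: (mulfI fn); rewrite f1 -cef; ring.
have tC : t^* = e * f + c * f + c * e by rewrite /t !rmorphD /= cC eC fC.
have d1 := mul_conjC_ge0 (c - e); have d2 := mul_conjC_ge0 (c - f); have d3 := mul_conjC_ge0 (e - f).
rewrite !rmorphB /= cC eC fC in d1 d2 d3.
have h : c * e * f - 1 = 0 by rewrite cef subrr.
have dE : d = 27 - (c - e) * (e * f - c * f) * ((c - f) * (e * f - c * e)) * ((e - f) * (c * f - c * e)).
  by rewrite /d (rmorphM _ (t * t)) (rmorphM _ t) /= tC /t; ring: cef.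
split=> //.
- rewrite -subr_ge0 (_ : 9 - _ = (c - e) * (e * f - c * f) + (c - f) * (e * f - c * e) + (e - f) * (c * f - c * e)).
    by rewrite !addr_ge0.
  apply/eqP; rewrite -subr_eq0; apply/eqP.
  by rewrite tC /t -[RHS](mulr0 (- 9)) -h; ring.
- by rewrite dE -subr_ge0 opprB addrC subrK; do 2![apply: mulr_ge0 => //].
- by move=> ce; rewrite dE ce subrr !mul0r subr0.
Qed.

(** A double eigenvalue places the trace on the deltoid itself, where only the values 3 and -1 are
    left. *)
Lemma unitaryO_trace A v y z c e f : unitaryO A -> \det A = 1 -> orth_frame v y z ->
  eigen_frame A v y z c e f -> c * e * f = 1 /\
  exists m n : int, [/\ c + e + f = oint m n, e * f + c * f + c * e = oint m (- n),
  (c = e -> n = 0 /\ (m = 3 \/ m = -1)) &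
  ((n = 0 /\ (m = 3 \/ m = -1 \/ m = 0 \/ m = 1 \/ m = 2)) \/ (m = -1 /\ n * n = 1))].
Proof.
move=> [hA oA] dA F EF; have [trA detA] := eigen_frame_trace F EF.
have [[v0 y0 z0] [yv zv _]] := F; have [Av Ay Az] := EF.
have cef : c * e * f = 1 by rewrite -detA.
have [m [n tE]] : O2 (c + e + f) by rewrite -trA; apply: O2_sum.
rewrite -/(oint m n) in tE; split=> //; exists m, n.
have [] := unit_trace_disc (eigen_unit hA (ltr0_neq0 v0) Av)
  (eigen_unit hA (lt0r_neq0 (herm_perp_gt0 v0 yv y0)) Ay)
  (eigen_unit hA (lt0r_neq0 (herm_perp_gt0 v0 zv z0)) Az) cef.
have aa := alphaE C.
have t3 : oint m n * oint m n * oint m n = oint (m * (m * m) - 6 * (m * (n * n))) (3 * (m * m * n) - 2 * (n * (n * n))).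
  by rewrite /oint !(intrB, intrM); ring: aa.
have e4 : 4 * (oint m n * oint m n * oint m n + (oint m n * oint m n * oint m n)^*) =
   (8 * (m * (m * m) - 6 * (m * (n * n))))%:~R.
  rewrite t3 oint_conj /oint mulrNz [(8 * _)%:~R]intrM; ring.
rewrite tE e4 oint_norm -[9]/(9%:~R) -[18]/(18%:~R) -[27]/(27%:~R) -!intrM -intrB -intrD !ler_int.
rewrite oint_conj => <- h1 h2 h3; have h4 := trace_ints h1 h2; split=> // /h3 /intr_inj h5.
by case: h4 => [[n0 [|[|[|[|]]]] mE]|[mE nn]]; subst m; rewrite ?n0 ?nn in h5 *; split=> //; lia.
Qed.

(** As [B] is k times the projector onto [p] and integral, one of its columns is a lattice vector
    along [p]. At [z0] with [herm z0 w = 1] it gives B z0 = (k / s) w, so k / s is the conjugate of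
    <z0, B z0> and lies in O_2. *)
Lemma rational_eigenline B p (k : int) : (forall i j, O2 (B i j)) -> herm p p != 0 -> k != 0 ->
  (forall r, B *m r = (k%:~R * (herm r p / herm p p)) *: p) ->
  exists w z0 g s, [/\ O3 w, O3 z0, herm z0 w = 1, g != 0 & p = g *: w] /\
    [/\ herm w w = s%:~R, herm w w != 0 & exists t, s * t = k].
Proof.
move=> oB pp k0 hB; have kn : k%:~R != 0 :> C by rewrite intr_eq0.
have p0 : p != 0 by apply: contraNneq pp => ->; rewrite herm0l.
have [j hj] : exists j, herm (delta_mx j 0) p != 0.
  apply: contrapT => h; case/eqP: p0; apply: herm_nondeg => z; rewrite (vec_delta z).
  have hd j : herm (delta_mx j 0) p = 0 by apply/eqP/negPn/negP => hj; apply: h; exists j.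
  by rewrite !big_ord_recl big_ord0 !hermlin herm0l !hd !mulr0 !addr0.
set l := k%:~R * (herm (delta_mx j 0) p / herm p p) : C.
have l0 : l != 0 by rewrite !mulf_neq0 // invr_eq0.
have ow1 : O3 (l *: p) by rewrite -hB; apply: O3_mulmx => //; exact: O3_delta.
have [g [w [z0 [ ow oz0 z0w lp]]]] : exists g w' z0, [/\ O3 w', O3 z0, herm z0 w' = 1 & l *: p = g *: w'].
  by apply: primitive_vector ow1 _; rewrite scaler_eq0 negb_or l0.
have pE : p = (l^-1 * g) *: w by rewrite -scalerA -lp scalerA mulVf // scale1r.
have g0 : l^-1 * g != 0 by apply: contraNneq p0 => h; rewrite pE h scale0r.
have [s ws] := herm_int ow.
have w0 : herm w w != 0.
  by apply: contraNneq pp => h; rewrite pE hermZl hermZr h !mulr0.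
exists w, z0, (l^-1 * g), s; split=> //; split=> //.
have Bz : B *m z0 = (k%:~R / s%:~R) *: w.
  rewrite hB pE !hermZl !hermZr z0w -ws scalerA; congr (_ *: _).
  by move: (l^-1 * g) g0 => x x0; field; rewrite w0 conjC_eq0 x0.
have [m [n hmn]] : O2 (k%:~R / s%:~R : C).
  have -> : k%:~R / s%:~R = (herm z0 (B *m z0))^*.
    by rewrite Bz hermZr z0w mulr1 conjCK.
  by apply/O2C/O2_herm => //; exact: O3_mulmx.
exists m; have : oint (s * m) (s * n) = oint k 0.
  rewrite ws in w0; have -> : oint k 0 = s%:~R * (k%:~R / s%:~R).
    by rewrite /oint mul0r addr0 mulrC divfK.
  by rewrite hmn /oint !intrM; ring.
by case/oint_inj.
Qed.

End Frames.

(** * Classification by the order of an isotropy element *)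

Section Classification.
Variable C : numClosedFieldType.
Implicit Types (p q r v w y z : 'cV[C]_3) (A B : 'M[C]_3).
Notation a := (alpha C).
Notation O3 := (@O3 C).
Notation oint := (@oint C).

Definition classified v :=
  exists2 q, q \in [:: q1; q2; q3; q4; q5; q6; q7] & orbit2 (line (evV C q)) (line v).

Lemma frame_proj B v y z (k : C) r : orth_frame v y z -> eigen_frame B v y z k 0 0 ->
  B *m r = (k * (herm r v / herm v v)) *: v.
Proof.
move=> F [Bv By Bz]; rewrite {1}(orth_frame_split r F) !mulmxDr -!scalemxAr Bv By Bz.
by rewrite !scale0r !scaler0 !addr0 scalerA mulrC.
Qed.

Lemma frame_proj_mid B v y z (k : C) r : orth_frame v y z -> eigen_frame B v y z 0 k 0 ->
  B *m r = (k * (herm r y / herm y y)) *: y.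
Proof.
move=> F [Bv By Bz]; rewrite {1}(orth_frame_split r F) !mulmxDr -!scalemxAr Bv By Bz.
by rewrite !scale0r !scaler0 addr0 add0r scalerA mulrC.
Qed.

Lemma eigen_frame1 v y z : eigen_frame 1%:M v y z 1 1 1.
Proof. by split; rewrite mul1mx scale1r. Qed.

Lemma eigen_frame_add A B v y z c e f c' e' f' : eigen_frame A v y z c e f ->
  eigen_frame B v y z c' e' f' -> eigen_frame (A + B) v y z (c + c') (e + e') (f + f').
Proof.
by move=> [hv hy hz] [hv' hy' hz']; split; rewrite mulmxDl scalerDl ?hv ?hy ?hz ?hv' ?hy' ?hz'.
Qed.

Lemma eigen_frame_eq A v y z c e f c' e' f' : eigen_frame A v y z c e f ->
  c = c' -> e = e' -> f = f' -> eigen_frame A v y z c' e' f'.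
Proof. by move=> ? <- <- <-. Qed.

Lemma O2_mxD A B : (forall i j, O2 (A i j)) -> (forall i j, O2 (B i j)) -> forall i j, O2 ((A + B) i j).
Proof. by move=> hA hB i j; rewrite mxE; apply: O2D. Qed.

Lemma dvd_int2 (s t : int) : s < 0 -> s * t = 2 -> s = -1 \/ s = -2.
Proof.
move=> s0 st; have t0 : t < 0 by nia.
have h : -2 <= s by nia.
lia.
Qed.

Lemma dvd_int3 (s t : int) : s < 0 -> s * t = 3 -> s = -1 \/ s = -3.
Proof.
move=> s0 st; have t0 : t < 0 by nia.
have h : -3 <= s by nia.
have [->|[sE|->]] : s = -1 \/ s = -2 \/ s = -3 by lia.
- by left.
- by exfalso; lia.
- by right.
Qed.

Lemma norm1_classified w : O3 w -> herm w w = -1 -> classified w.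
Proof. by move=> ow /(norm1_orbit ow)[h|h]; [exists q4|exists q5]. Qed.

Lemma classifiedZ g w : g != 0 -> classified w -> classified (g *: w).
Proof. by move=> g0; rewrite /classified lineZ. Qed.

Lemma neg_scale g w : herm (g *: w) (g *: w) < 0 -> herm w w < 0.
Proof.
rewrite hermZl hermZr mulrA; have [->|g0] := eqVneq g 0; first by rewrite !mul0r ltxx.
by rewrite pmulr_rlt0 // lt0r mul_conjC_eq0 g0 mul_conjC_ge0.
Qed.

Lemma order2_classified A v y z : unitaryO A -> orth_frame v y z ->
  eigen_frame A v y z 1 (-1) (-1) -> classified v.
Proof.
move=> uA F EF; have [[v0 _ _] _] := F.
have oB i j : O2 ((A + 1%:M) i j) by apply: O2_mxD; [exact: uA.2|exact: (unitaryO1 C).2].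
have EB : eigen_frame (A + 1%:M) v y z 2%:~R 0 0.
  by apply: eigen_frame_eq (eigen_frame_add EF (eigen_frame1 v y z)) _ _ _; rewrite ?addNr.
have [w [z0 [g [s [[ ow oz0 z0w g0 vE] [ws _ [t st]]]]]]] :=
  rational_eigenline oB (ltr0_neq0 v0) (isT : (2 : int) != 0) (fun r => frame_proj r F EB).
rewrite vE in v0 *; have w0 := neg_scale v0; apply: classifiedZ => //.
have s0 : s < 0 by rewrite -(ltrz0 C) -ws.
case: (dvd_int2 s0 st) => sE; rewrite {}sE mulrNz in ws; first exact: norm1_classified.
by case: (norm2_orbit ow oz0 z0w ws) => h; [exists q1|exists q2].
Qed.

Lemma order3_classified A v y z e f : unitaryO A -> orth_frame v y z ->
  eigen_frame A v y z 1 e f -> e * e + e + 1 = 0 -> f * f + f + 1 = 0 -> classified v.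
Proof.
move=> uA F EF e1 f1; have [[v0 _ _] _] := F.
have oB i j : O2 ((A *m A + A + 1%:M) i j).
  apply: O2_mxD; last exact: (unitaryO1 C).2.
  by apply: O2_mxD; [apply: (unitaryOM uA uA).2|exact: uA.2].
have EB : eigen_frame (A *m A + A + 1%:M) v y z 3%:~R 0 0.
  apply: eigen_frame_eq (eigen_frame_add (eigen_frame_add (eigen_frame_mul EF EF) EF) (eigen_frame1 v y z)) _ _ _ => //.
  by rewrite mulr1 -addrA.
have hB r := frame_proj r F EB.
have [w [z0 [g [s [[ ow oz0 z0w g0 vE] [ws w0' [t st]]]]]]] :=
  rational_eigenline oB (ltr0_neq0 v0) (isT : (3 : int) != 0) hB.
have Aw : A *m w = w.
  by have [Av _ _] := EF; move: Av; rewrite vE scale1r -scalemxAr => /(scalerI g0).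
have hw r : herm r w = 0 -> r + A *m r + A *m (A *m r) = 0.
  move=> rw; have := hB r; rewrite vE hermZr rw mulr0 mul0r mulr0 scale0r => <-.
  by rewrite !mulmxDl mul1mx -mulmxA [RHS]addrC -addrA; congr (_ + _); exact: addrC.
rewrite vE in v0 *; have w0 := neg_scale v0; apply: classifiedZ => //.
have s0 : s < 0 by rewrite -(ltrz0 C) -ws.
case: (dvd_int3 s0 st) => sE; rewrite {}sE mulrNz in ws; first exact: norm1_classified.
by exists q3 => //; apply: norm3_orbit ow oz0 z0w ws uA Aw hw.
Qed.

Lemma order4_classified A v y z c : unitaryO A -> orth_frame v y z ->
  eigen_frame A v y z c 1 (- c) -> c * c = -1 -> classified v.
Proof.
(* The other value c = -i is exchanged for i by passing to A^3. *)
move=> uA F EF cc; wlog cE : A c uA EF cc / c = 'i.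
  move=> hw; have ii := i2E C.
  have /eqP : (c - 'i) * (c + 'i) = 0 by rewrite mulrDr !mulrBl cc ii (mulrC c); ring.
  rewrite mulf_eq0 => /orP[|] /eqP h; first by apply: (hw A c) => //; apply: subr0_eq.
  apply: (hw (A *m A *m A) (- c)).
  - exact: unitaryOM (unitaryOM uA uA) uA.
  - apply: eigen_frame_eq (eigen_frame_mul (eigen_frame_mul EF EF) EF) _ _ _; rewrite ?mulr1 ?mulrNN ?cc //; ring.
  - by rewrite mulrNN.
  - by apply/eqP; rewrite eq_sym -addr_eq0 addrC h.
subst c; have [[v0 y0 z0] [yv zv zy]] := F; have [Av Ay Az] := EF.
have yy := lt0r_neq0 (herm_perp_gt0 v0 yv y0).
have oB i j : O2 ((A *m A + 1%:M) i j).
  by apply: O2_mxD; [apply: (unitaryOM uA uA).2|exact: (unitaryO1 C).2].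
have EB : eigen_frame (A *m A + 1%:M) v y z 0 2%:~R 0.
  apply: eigen_frame_eq (eigen_frame_add (eigen_frame_mul EF EF) (eigen_frame1 v y z)) _ _ _.
  - by rewrite cc addNr.
  - by rewrite mulr1.
  - by rewrite mulrNN cc addNr.
have [w [x [g [s [[ ow ox xw g0 yE] [ws w0 [t st]]]]]]] :=
  rational_eigenline oB yy (isT : (2 : int) != 0) (fun r => frame_proj_mid r F EB).
have Aw : A *m w = w.
  by move: Ay; rewrite yE scale1r -scalemxAr => /(scalerI g0).
have hyw r : herm r w = 0 -> herm r y = 0 by rewrite yE hermZr => ->; rewrite mulr0.
have wv : herm w v = 0.
  by move/eqP: yv; rewrite yE hermZl mulf_eq0 (negbTE g0) => /eqP.
have wn0 : w != 0 by apply: contraNneq y0 => w1; rewrite yE w1 scaler0.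
have s0 : 0 < s by rewrite -(ltr0z C) -ws (herm_perp_gt0 v0 wv wn0).
have hr r : herm r v = 0 -> herm r w = 0 -> A *m r = - 'i *: r.
  move=> rv rw; rewrite (orth_frame_perp F rv (hyw r rw)) -scalemxAr Az !scalerA.
  by congr (_ *: _); rewrite mulrC.
have [h|h] := order4_orbit uA ow ox xw Aw ws s0 (ex_intro _ t st) v0 (herm_eq0C wv) Av hr.
  by exists q6.
by exists q7.
Qed.

Lemma order3_frame_absurd A v y z c : unitaryO A -> orth_frame v y z ->
  eigen_frame A v y z c 1 (- 1 - c) -> c * c + c + 1 = 0 -> False.
Proof.
(* Squaring [A] exchanges the two primitive cube roots of unity, so [c] may be taken in the upper
   half plane. *)
move=> uA F EF cc; wlog cE : A c uA EF cc / 2 * c + 1 = 'i * sqrtC 3.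
  move=> hw; have ii : ('i * sqrtC 3) * ('i * sqrtC 3) = -3 :> C.
    by rewrite mulrACA i2E -expr2 sqrtCK mulN1r.
  have c2 : c * c = - 1 - c by apply/eqP; rewrite -subr_eq0; apply/eqP; rewrite -[RHS]cc; ring.
  have /eqP : (2 * c + 1 - 'i * sqrtC 3) * (2 * c + 1 + 'i * sqrtC 3) = 0.
    move: ('i * sqrtC 3) ii => x ii.
    have -> : (2 * c + 1 - x) * (2 * c + 1 + x) = 4 * (c * c) + 4 * c + 1 - x * x by ring.
    by rewrite ii c2; ring.
  rewrite mulf_eq0 => /orP[|] /eqP h; first by apply: (hw A c) => //; apply: subr0_eq.
  apply: (hw (A *m A) (- 1 - c)).
  - exact: (unitaryOM uA uA).
  - apply: eigen_frame_eq (eigen_frame_mul EF EF) _ _ _; rewrite ?mulr1 //.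
    ring: c2.
  - ring: c2.
  - by apply/eqP; rewrite -subr_eq0; apply/eqP; rewrite -[RHS]oppr0 -h; ring.
have [[v0 y0 z0] [yv zv zy]] := F; have [Av Ay Az] := EF.
have yy := lt0r_neq0 (herm_perp_gt0 v0 yv y0).
have oB i j : O2 ((A *m A + A + 1%:M) i j).
  apply: O2_mxD; last exact: (unitaryO1 C).2.
  by apply: O2_mxD; [apply: (unitaryOM uA uA).2|exact: uA.2].
have EB : eigen_frame (A *m A + A + 1%:M) v y z 0 3%:~R 0.
  apply: eigen_frame_eq (eigen_frame_add (eigen_frame_add (eigen_frame_mul EF EF) EF) (eigen_frame1 v y z)) _ _ _ => //.
  - by rewrite mulr1 -addrA.
  - by rewrite -[RHS]cc; ring.
have [w [x [g [s [[ ow ox xw g0 yE] [ws w0 [t st]]]]]]] :=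
  rational_eigenline oB yy (isT : (3 : int) != 0) (fun r => frame_proj_mid r F EB).
have Aw : A *m w = w.
  by move: Ay; rewrite yE scale1r -scalemxAr => /(scalerI g0).
have hyw r : herm r w = 0 -> herm r y = 0 by rewrite yE hermZr => ->; rewrite mulr0.
have wv : herm w v = 0.
  by move/eqP: yv; rewrite yE hermZl mulf_eq0 (negbTE g0) => /eqP.
have wn0 : w != 0 by apply: contraNneq y0 => w1; rewrite yE w1 scaler0.
have s0 : 0 < s by rewrite -(ltr0z C) -ws (herm_perp_gt0 v0 wv wn0).
apply: (order3_no_isolated uA ow ox xw Aw ws s0 (ex_intro _ t st) v0 (herm_eq0C wv) cE Av).
move=> r rv rw; rewrite (orth_frame_perp F rv (hyw r rw)) -scalemxAr Az !scalerA; congr (_ *: _).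
by rewrite mulrC.
Qed.

End Classification.

(** * Reduction to elements of order 2, 3 and 4 *)

Section SimpleEigenvalue.
Variable C : numClosedFieldType.
Implicit Types (p q r v w y z : 'cV[C]_3) (A B : 'M[C]_3).
Notation a := (alpha C).
Notation oint := (@oint C).

Lemma mulf_sub0 (x y : C) : x * y = 0 -> x = 0 \/ y = 0.
Proof. by move/eqP; rewrite mulf_eq0 => /orP[/eqP|/eqP]; [left|right]. Qed.

(** The characteristic polynomial x^3 - t x^2 + conj(t) x - 1 factors explicitly for each admissible
    trace t. According to the factor that vanishes at [c], a power of [A] is taken that has order 2,
    3 or 4 and still has a simple eigenvalue at [v]. *)
Lemma simple_eigenvalue_classified A v c : unitaryO A -> herm v v < 0 -> A *m v = c *: v ->
  (forall r, herm r v = 0 -> A *m r = c *: r -> r = 0) -> classified v.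
Proof.
move=> uA v0 Av csimple; wlog dA : A c uA Av csimple / \det A = 1.
  move=> hw; have [dA|dA] := unitaryO_det uA; first exact: (hw A c).
  apply: (hw (- A) (- c)); first exact: unitaryON.
  - by rewrite mulNmx Av scaleNr.
  - by move=> r rv; rewrite mulNmx scaleNr => /oppr_inj; apply: csimple.
  - by rewrite -scaleN1r detZ dA !exprS expr0; ring.
have [y [z [e [f [F EF]]]]] := eigen_frame_exists uA.1 v0 Av.
have [_ Ay Az] := EF; have [[_ y0 z0] [yv zv _]] := F.
have ec : e <> c by move=> ec; case/eqP: y0; apply: csimple => //; rewrite Ay ec.
have fc : f <> c by move=> fc; case/eqP: z0; apply: csimple => //; rewrite Az fc.
have [S3 [m [n [S1 S2 _ hmn]]]] := unitaryO_trace uA dA F EF.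
have P (t t' : C) : oint m n = t -> oint m (- n) = t' ->
   c * c * c - t * (c * c) + t' * c - 1 = 0.
  by move=> <- <-; rewrite -S1 -S2 -S3; ring.
(* Reorders the frame so that a known root [k] of the remaining quadratic belongs to the second
   vector. *)
have sw k : (e - k) * (f - k) = 0 -> exists y' z' f', [/\ orth_frame v y' z',
   eigen_frame A v y' z' c k f' & c + k + f' = oint m n].
  case/mulf_sub0 => /subr0_eq h.
    by exists y, z, f; split; rewrite -?S1 -?h.
  exists z, y, e; split; first exact: orth_frame_swap.
    by split; rewrite ?Az ?h.
  by rewrite -S1 -h; ring.
have sq0 (x : C) : x * x = 0 -> x = 0 by case/mulf_sub0.
have E2 := eigen_frame_mul EF EF; have uA2 := unitaryOM uA uA.
case: hmn => [[n0 hm]|[mE nn]]; last first.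
  (* The eigenvalues are -1 and two primitive eighth roots of unity. The fourth power is used if c =
     -1, the square otherwise. *)
  pose b : C := n%:~R * a.
  have bb : b * b = - 2 by rewrite /b mulrACA alphaE -intrM nn mul1r.
  have tE : oint m n = -1 + b by rewrite /oint mE mulrN1z.
  have tE' : oint m (- n) = -1 - b by rewrite /oint mE mulrN1z mulrNz mulNr.
  rewrite tE in S1; rewrite tE' in S2.
  have : (c + 1) * (c * c - b * c - 1) = 0 by rewrite -[RHS](P _ _ tE tE'); ring.
  clearbody b; case/mulf_sub0 => h.
    have {h}cE : c = -1 by apply/eqP; rewrite -addr_eq0; apply/eqP.
    subst c; have S1' : f = b - e by rewrite -[RHS](addrK (-1 : C)) -{1}(subrK (-1) b) -?S1; apply/eqP; rewrite -subr_eq0; apply/eqP; rewrite -(subrr (-1 + b)) -{1}S1; ring.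
    subst f; have ee : e * e = b * e + 1.
      by apply/eqP; rewrite -subr_eq0; apply/eqP; rewrite -[RHS](subrr 1) -{1}S3; ring.
    apply: (order2_classified (unitaryOM uA2 uA2) F (eigen_frame_eq (eigen_frame_mul E2 E2) _ _ _)).
    - by rewrite !mulrNN !mulr1.
    - ring: ee bb.
    - ring: ee bb.
  have cc : c * c = b * c + 1 by apply/eqP; rewrite -subr_eq0 opprD addrA h.
  have [|y' [z' [f' [F' EF' tr]]]] := sw (-1).
    have e1 : e * f = -1 - b - c * (-1 + b - c) by rewrite -S1 -S2; ring.
    have e2 : e + f = -1 + b - c by rewrite -S1; ring.
    have -> : (e - -1) * (f - -1) = e * f + (e + f) + 1 by ring.
    by rewrite e1 e2; ring: cc.
  rewrite tE in tr; have f'E : f' = b - c.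
    by apply/eqP; rewrite -subr_eq0; apply/eqP; rewrite -(subrr (-1 + b)) -{1}tr; ring.
  apply: (order4_classified uA2 F' (eigen_frame_eq (eigen_frame_mul EF' EF') erefl _ _)).
  - by rewrite mulrNN mulr1.
  - by rewrite f'E; ring: cc bb.
  - ring: cc bb.
have tE : oint m n = m%:~R by rewrite n0 /oint mul0r addr0.
have tE' : oint m (- n) = m%:~R by rewrite n0 /oint oppr0 mul0r addr0.
have {}P := P _ _ tE tE'; rewrite tE in S1 sw; rewrite tE' in S2.
have e1 : e * f = m%:~R - c * (m%:~R - c) by rewrite -{1}S2 -S1; ring.
have e2 : e + f = m%:~R - c by rewrite -S1; ring.
have key k : (e - k) * (f - k) = m%:~R - c * (m%:~R - c) - k * (m%:~R - c) + k * k.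
  by rewrite -e1 -e2; ring.
have ee : e * e = (m%:~R - c) * e - (m%:~R - c * (m%:~R - c)) by rewrite -e1 -e2; ring.
have fE : f = m%:~R - c - e by rewrite -e2; ring.
have ffE : f * f = (m%:~R - c) * f - (m%:~R - c * (m%:~R - c)) by rewrite -e1 -e2; ring.
case: hm => [mE|[mE|[mE|[mE|mE]]]]; rewrite {}mE ?mulrN1z -?[3%:~R]/(3 : C) -?[2%:~R]/(2 : C)
   -?[1%:~R]/(1 : C) -?[0%:~R]/(0 : C) {S1 S2 tE tE' e1 e2} in P sw key ee fE ffE.
(* Trace 3: all eigenvalues are 1, so none is simple. *)
- exfalso; have c1 : c = 1.
    apply: subr0_eq; have : (c - 1) * ((c - 1) * (c - 1)) = 0 by rewrite -[RHS]P; ring.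
    by case/mulf_sub0 => // /sq0.
  by apply: ec; rewrite c1; apply/subr0_eq/sq0; rewrite c1 in ee; ring: ee.
(* Trace -1: the eigenvalues are 1, -1, -1, and only 1 is simple. *)
- have : (c - 1) * ((c + 1) * (c + 1)) = 0 by rewrite -[RHS]P; ring.
  case/mulf_sub0 => [/subr0_eq c1|/sq0 c1].
    rewrite c1 in ee fE; have eE : e = -1.
      by apply/eqP; rewrite -addr_eq0; apply/eqP/sq0; ring: ee.
    rewrite eE in fE EF; apply: (order2_classified uA F (eigen_frame_eq EF c1 erefl _)).
    by rewrite fE; ring.
  exfalso; have {}c1 : c = -1 by apply/eqP; rewrite -addr_eq0 c1.
  have : (e - -1) * (f - -1) = 0 by rewrite key c1; ring.
  by case/mulf_sub0 => /subr0_eq h; [apply: ec|apply: fc]; rewrite h c1.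
(* Trace 0: the eigenvalues are the three cube roots of unity. *)
- have : (c - 1) * (c * c + c + 1) = 0 by rewrite -[RHS]P; ring.
  case/mulf_sub0 => [/subr0_eq c1|c1].
    rewrite c1 in ee ffE EF; apply: (order3_classified uA F EF).
      by rewrite ee; ring.
    by rewrite ffE; ring.
  exfalso; have [|y' [z' [f' [F' EF' tr]]]] := sw 1; first by rewrite key -[RHS]c1; ring.
  apply: (order3_frame_absurd uA F' (eigen_frame_eq EF' erefl erefl _) c1).
  by apply/eqP; rewrite -subr_eq0; apply/eqP; rewrite -[RHS]tr; ring.
(* Trace 1: the eigenvalues are 1, i, -i. *)
- have : (c - 1) * (c * c + 1) = 0 by rewrite -[RHS]P; ring.
  case/mulf_sub0 => [/subr0_eq c1|c1].
    rewrite c1 in ee ffE E2; apply: (order2_classified uA2 F (eigen_frame_eq E2 _ _ _)).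
    + by rewrite mulr1.
    + by rewrite ee; ring.
    + by rewrite ffE; ring.
  have [|y' [z' [f' [F' EF' tr]]]] := sw 1; first by rewrite key -[RHS]c1; ring.
  apply: (order4_classified uA F' (eigen_frame_eq EF' erefl erefl _)).
    by apply/eqP; rewrite -subr_eq0; apply/eqP; rewrite -(subrr 1) -{1}tr; ring.
  by apply/eqP; rewrite -addr_eq0; apply/eqP.
(* Trace 2: the eigenvalues are 1 and the primitive sixth roots of unity. The cube is used if c = 1,
   the square otherwise. *)
have : (c - 1) * (c * c - c + 1) = 0 by rewrite -[RHS]P; ring.
case/mulf_sub0 => [/subr0_eq c1|c1].
  rewrite c1 in ee ffE EF.
  apply: (order2_classified (unitaryOM uA2 uA) F
     (eigen_frame_eq (eigen_frame_mul (eigen_frame_mul EF EF) EF) _ _ _)).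
  - by rewrite !mulr1.
  - ring: ee.
  - ring: ffE.
have cc : c * c = c - 1 by apply/eqP; rewrite -subr_eq0 opprB addrA addrAC c1.
exfalso; have [|y' [z' [f' [F' EF' tr]]]] := sw 1; first by rewrite key; ring: cc.
have f'E : f' = 1 - c by apply/eqP; rewrite -subr_eq0; apply/eqP; rewrite -(subrr 2) -{1}tr; ring.
apply: (order3_frame_absurd uA2 F' (eigen_frame_eq (eigen_frame_mul EF' EF') erefl _ _)).
- by rewrite mulr1.
- by rewrite f'E; ring: cc.
- ring: cc.
Qed.

End SimpleEigenvalue.

(** * Isolated fixed points *)

Import numFieldNormedType.Exports.

Section Isolated.
Variable C : numClosedFieldType.
Implicit Types (p q r u v w y z : 'cV[C]_3) (A B : 'M[C]_3).
Notation oint := (@oint C).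

Lemma nbhs_line v u (P : 'cV[C]_3 -> Prop) (d : C) : 0 < d -> (\forall w \near v, P w) ->
  exists t : C, [/\ 0 < t, t <= d & P (v + t *: u)].
Proof.
move=> d0 /nbhs_ballP[e /= e0 he].
pose K := `|u 0 0| + `|u 1 0| + `|u 2 0|.
have K0 : 0 <= K by rewrite !addr_ge0.
have uK (i : 'I_3) : `|u i 0| <= K.
  case: i => [[|[|[|]]]] // p.
  - by rewrite (_ : Ordinal p = 0); [rewrite /K -addrA lerDl addr_ge0|apply: val_inj].
  - by rewrite (_ : Ordinal p = 1); [rewrite /K addrAC lerDr addr_ge0|apply: val_inj].
  - by rewrite (_ : Ordinal p = 2); [rewrite /K lerDr addr_ge0|apply: val_inj].
(* Chosen so that 1/T <= d and K/T < e. *)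
pose T := d^-1 + K / e + 1.
have h1 : 0 <= K / e by rewrite divr_ge0 // ltW.
have d1 : 0 < d^-1 by rewrite invr_gt0.
have T0 : 0 < T by rewrite ltr_pwDr // addr_ge0 // ltW.
have t0 : 0 < T^-1 by rewrite invr_gt0.
exists T^-1; split=> //.
  rewrite -[d]invrK lef_pV2 ?posrE // /T -addrA lerDl addr_ge0 //.
apply: he; split=> // i j; rewrite ord1 !mxE -ball_normE /=.
rewrite opprD addrA subrr add0r normrN normrM (gtr0_norm t0).
apply: le_lt_trans (_ : T^-1 * K < e); first by rewrite ler_pM2l.
by rewrite mulrC ltr_pdivrMr // mulrC -ltr_pdivrMr // /T addrAC ltrDr addr_gt0.
Qed.

(** With a double eigenvalue the trace is 3 or -1. The first leaves only the identity, the second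
    the eigenvalues -1, -1, 1. *)
Lemma multiple_eigenvalue A v c r : unitaryO A -> \det A = 1 -> herm v v < 0 -> A *m v = c *: v ->
  r != 0 -> herm r v = 0 -> A *m r = c *: r -> c = 1 /\ A = 1%:M \/ c = -1.
Proof.
move=> uA dA v0 Av r0 rv Ar.
have c1 := eigen_unit uA.1 (ltr0_neq0 v0) Av.
have [z [z0 zv zr]] := exists_perp2 v r; have F : orth_frame v r z by [].
pose f := herm (A *m z) z / herm z z.
have EF : eigen_frame A v r z c c f.
  split=> //; apply: (orth_frame_perp F); [exact: (eigen_perp uA.1 Av c1 zv)|exact: (eigen_perp uA.1 Ar c1 zr)].
have [S3 [m [n [S1 S2 /(_ erefl)[n0 hm] _]]]] := unitaryO_trace uA dA F EF.
rewrite n0 oppr0 /oint mul0r addr0 in S1 S2.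
have P : c * c * c - m%:~R * (c * c) + m%:~R * c - 1 = 0 by rewrite -{2}S2 -S1 -S3; ring.
have fE : f = m%:~R - c - c by rewrite -S1; ring.
case: hm => mE; rewrite {}mE ?mulrN1z -?[3%:~R]/(3 : C) in P fE {S1 S2}.
  have c11 : c = 1.
    apply: subr0_eq; have : (c - 1) * ((c - 1) * (c - 1)) = 0 by rewrite -[RHS]P; ring.
    by case/mulf_sub0 => // /mulf_sub0[].
  left; split=> //; have [_ _ Az] := EF.
  have f1 : f = 1 by rewrite fE c11; ring.
  have hA (x : 'cV[C]_3) : A *m x = x.
    rewrite (orth_frame_split x F) !mulmxDr -!scalemxAr.
    by rewrite Av Ar Az f1 c11 !scale1r.
  apply/matrixP => i j; have := hA (delta_mx j 0).
  by rewrite -colE => /matrixP/(_ i 0); rewrite !mxE eqxx andbT.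
right; have : (c - 1) * ((c + 1) * (c + 1)) = 0 by rewrite -[RHS]P; ring.
case/mulf_sub0 => [/subr0_eq c11|/mulf_sub0 h].
  exfalso; move: S3; rewrite fE c11; move/eqP.
  have -> : 1 * 1 * (-1 - 1 - 1) = - 3 :> C by ring.
  by rewrite -subr_eq0 -opprD oppr_eq0 -[1]/(1%:R) -natrD pnatr_eq0.
by apply/eqP; rewrite -addr_eq0; case: h => ->.
Qed.

(** With determinant 1, an element fixes [v] or sends it to [- v]. In the first case it is the
    identity; hence the product of two elements of the second kind is the identity, and a common
    eigenvector [u] can be taken from any one of them. *)
Lemma isotropy_fixes_neighbour v : herm v v < 0 ->
  (forall A c, unitaryO A -> A *m v = c *: v -> exists r, [/\ r != 0, herm r v = 0 & A *m r = c *: r]) ->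
  exists u, [/\ u != 0, herm u v = 0 & forall A c, unitaryO A -> A *m v = c *: v -> A *m u = c *: u].
Proof.
move=> v0 hmul; have vn := herm_ltr0_neq0 v0.
have h1 A : unitaryO A -> \det A = 1 -> A *m v = v -> A = 1%:M.
  move=> uA dA Av; have Av1 : A *m v = 1 *: v by rewrite scale1r.
  have [r [r0 rv Ar]] := hmul A 1 uA Av1.
  have [[//]|/eqP] := multiple_eigenvalue uA dA v0 Av1 r0 rv Ar.
  by rewrite -subr_eq0 opprK paddr_eq0 ?ler01 // oner_eq0.
have h2 A c : unitaryO A -> \det A = 1 -> A *m v = c *: v -> c = 1 \/ c = -1.
  move=> uA dA Av; have [r [r0 rv Ar]] := hmul A c uA Av.
  by case: (multiple_eigenvalue uA dA v0 Av r0 rv Ar) => [[]|]; [left|right].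
suff [u [u0 uv hu]] : exists u, [/\ u != 0, herm u v = 0 &
    forall A, unitaryO A -> \det A = 1 -> A *m v = - v -> A *m u = - u].
  exists u; split=> // A c uA Av.
  wlog dA : A c uA Av / \det A = 1.
    move=> hw; have [dA|dA] := unitaryO_det uA; first exact: (hw A c).
    have := hw (- A) (- c) (unitaryON uA); rewrite !mulNmx Av !scaleNr => /(_ erefl) h.
    by apply: oppr_inj; apply: h; rewrite -scaleN1r detZ dA !exprS expr0; ring.
  have [c1|c1] := h2 A c uA dA Av; rewrite c1 ?scaleN1r ?scale1r in Av *.
    by rewrite (h1 A uA dA Av) mul1mx.
  exact: hu.
have [[A0 [uA0 dA0 A0v]]|no] := pselect (exists A, [/\ unitaryO A, \det A = 1 & A *m v = - v]).
  have [|r [r0 rv Ar]] := hmul A0 (-1) uA0; first by rewrite scaleN1r.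
  exists r; split=> // A uA dA Av.
  have AA0 : A *m A0 = 1%:M.
    apply: h1; first exact: unitaryOM.
      by rewrite det_mulmx dA dA0 mulr1.
    by rewrite -mulmxA A0v mulmxN Av opprK.
  have := congr1 (fun M => M *m r) AA0; rewrite -mulmxA Ar mul1mx scaleN1r mulmxN => h.
  by rewrite -[LHS]opprK h.
have [u [u0 uv _]] := exists_perp2 v v; exists u; split=> // A uA dA Av.
by exfalso; apply: no; exists A.
Qed.

Lemma isolated_classified (x : line_point C) : H2 x -> isolated_fixed_point x ->
  exists2 v, x = line v & classified v.
Proof.
move=> [v1 v10 ->] [v vE hv]; exists v => //.
have [k k0 vk] := line_eq (herm_ltr0_neq0 v10) (esym vE).
have v0 : herm v v < 0.
  by rewrite vk hermZl hermZr mulrA pmulr_rlt0 // lt0r mul_conjC_eq0 k0 mul_conjC_ge0.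
have vn := herm_ltr0_neq0 v0; rewrite vE in hv.
have [[A [c [uA Av cs]]]|no] := pselect (exists A c, [/\ unitaryO A, A *m v = c *: v &
    forall r, herm r v = 0 -> A *m r = c *: r -> r = 0]).
  exact: simple_eigenvalue_classified uA v0 Av cs.
exfalso; have [|u [u0 uv hu]] := isotropy_fixes_neighbour v0.
  move=> A c uA Av; apply: contrapT => hr; apply: no; exists A, c; split=> // r rv Ar.
  by apply: contrapT => /eqP r0; apply: hr; exists r.
have [e e0 he] := neg_add_small v0 uv.
(* The line of v + t u is fixed by the whole isotropy group and can be taken arbitrarily close to
   [x], against isolation. *)
have [t [t0 te ht]] := nbhs_line u e0 hv.
have wneg : herm (v + t *: u) (v + t *: u) < 0 by apply: he; rewrite te ltW.
have : line (v + t *: u) = line v.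
  apply: ht; first by exists (v + t *: u).
  move=> g [/Gamma2P[A uA ->]]; rewrite !act_cls ?unitaryO_unit // => /(line_eq vn)[c c0 Av].
  by rewrite mulmxDr -scalemxAr (hu A c uA Av) Av scalerA (mulrC t) -scalerA -scalerDr lineZ.
move=> /(line_eq vn)[c _ h].
have := congr1 (fun z => herm z u) h; rewrite !hermlin (herm_eq0C uv) mulr0 add0r.
move/eqP; rewrite mulf_eq0 (gt_eqF t0) /= => /eqP uu.
by have := herm_perp_gt0 v0 uv u0; rewrite uu ltxx.
Qed.

End Isolated.

(** * Disjointness of the seven orbits *)

Section SevenOrbits.
Variable C : numClosedFieldType.

Definition points : seq zvec := [:: q1; q2; q3; q4; q5; q6; q7].
Definition counts : seq (nat * nat * nat) := [:: (1, 0, 1); (0, 1, 1); (0, 0, 3); (0, 2, 2);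
  (0, 0, 12); (1, 0, 0); (0, 1, 0)]%N.

Lemma point_counts i (j := nth (0, 0, 0)%N counts i) : (i < 7)%N ->
  mirror_counts (isotropy (line (evV C (nth q1 points i)))) j.1.1 j.1.2 j.2.
Proof.
have h1 : mirror_counts (isotropy (line (evV C q1))) 1 0 1.
  by rewrite -vec_q1; have [_ []] := point1 C.
have h2 : mirror_counts (isotropy (line (evV C q2))) 0 1 1.
  by rewrite -vec_q2; have [_ []] := point2 C.
have h3 : mirror_counts (isotropy (line (evV C q3))) 0 0 3.
  by rewrite -vec_q3; have [_ []] := point3 C.
have h4 : mirror_counts (isotropy (line (evV C q4))) 0 2 2.
  by rewrite -vec_q4; have [_ []] := point4 C.
have h5 : mirror_counts (isotropy (line (evV C q5))) 0 0 12.
  by rewrite -vec_q5; have [_ []] := point5 C.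
have h6 : mirror_counts (isotropy (line (evV C q6))) 1 0 0.
  by have [] := point6 C.
have h7 : mirror_counts (isotropy (line (evV C q7))) 0 1 0.
  by have [] := point7 C.
by case: i @j => [|[|[|[|[|[|[|]]]]]]].
Qed.

Lemma points_orbit_inj (v : 'cV[C]_3) i j : (i < 7)%N -> (j < 7)%N ->
  orbit2 (line (evV C (nth q1 points i))) (line v) ->
  orbit2 (line (evV C (nth q1 points j))) (line v) -> i = j.
Proof.
move=> hi hj oi oj; have := mirror_counts_inj oi oj (point_counts hi) (point_counts hj).
have u : uniq counts by [].
move=> [e1 e2 e3]; apply/eqP; rewrite -(@nth_uniq _ (0, 0, 0)%N counts i j hi hj u).
move: e1 e2 e3; case: (nth _ counts i) => [[a1 a2] a3]; case: (nth _ counts j) => [[b1 b2] b3] /=.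
by move=> -> -> ->.
Qed.

Lemma isolated_orbit (x : line_point C) : H2 x -> isolated_fixed_point x ->
  exists! k : 'I_7, orbit2 (line (evV C (nth q1 points k))) x.
Proof.
move=> h1 h2; have [v -> [q qp oq]] := isolated_classified h1 h2.
have hk : (index q points < 7)%N by rewrite -[7%N]/(size points) index_mem.
exists (Ordinal hk); split; first by rewrite /= nth_index.
by move=> l ol; apply/val_inj/(@points_orbit_inj v) => //=; rewrite nth_index.
Qed.

End SevenOrbits.

Theorem mainTheorem8 (R : realType) :
  let C : numClosedFieldType := R[i] in
  let a : C := alpha C in
  let refl (x y z : C) : PGL C 3 := reflection (vec3 x y z) in
  let RG (G : set (PGL C 3)) : set (PGL C 3) := reflection_subgroup G in
  let M6 : PGL C 3 := cls (mx_of_rows 3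
    [:: [:: 1 - a; - 2; a];
        [:: - a; - 1; 0];
        [:: - 1; a; 1]]) in
  let M7 : PGL C 3 := cls (mx_of_rows 3
    [:: [:: 1; 2; - 2 - 2 * a];
        [:: - a; - 1 - 2 * a; - 2 + 2 * a];
        [:: - 1 - a; - 2 - a; - 1 + 2 * a]]) in
  let p1 : line_point C := line (vec3 1 0 (- 1)) in
  let p2 : line_point C := line (vec3 (- 1 - a) a a) in
  let p3 : line_point C := line (vec3 (- 2 - a) (- 1) a) in
  let p4 : line_point C := line (vec3 1 (- 1) (- 1)) in
  let p5 : line_point C := line (vec3 (- 2 - a) (- 1 + a) a) in
  exists p6 p7 : line_point C,
    [/\ H2 `&` [set x | act M6 x = x] = [set p6],
        H2 `&` [set x | act M7 x = x] = [set p7]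
      & forall x : line_point C, H2 x -> isolated_fixed_point x ->
          exists! k : 'I_7,
            orbit2 (nth p1 [:: p1; p2; p3; p4; p5; p6; p7] k) x]
    /\
    (let G := isotropy p1 in
     let A := refl 0 1 0 in let B := refl 1 0 1 in
     H2 p1 /\
     [/\ RG G = G, G #= `I_4, G = generated [set A; B],
         has_braid_length A B 2 & mirror_counts G 1 0 1])
    /\
    (let G := isotropy p2 in
     let A := refl 1 (- 1) 0 in let B := refl 1 (- a) (- a) in
     H2 p2 /\
     [/\ RG G = G, G #= `I_4, G = generated [set A; B],
         has_braid_length A B 2 & mirror_counts G 0 1 1])
    /\
    (let G := isotropy p3 in
     let A := refl 1 (- a) 0 in let B := refl (1 + a) 0 1 in
     H2 p3 /\
     [/\ RG G = G, G #= `I_6, G = generated [set A; B],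
         has_braid_length A B 3 & mirror_counts G 0 0 3])
    /\
    (let G := isotropy p4 in
     let A := refl 0 1 1 in let B := refl 1 0 1 in
     H2 p4 /\
     [/\ RG G = G, G #= `I_8, G = generated [set A; B],
         has_braid_length A B 4 & mirror_counts G 0 2 2])
    /\
    (let G := isotropy p5 in
     let A := refl 0 a 1 in
     let B := refl (1 + a) 2 (1 - a) in
     let D := refl (1 + a) (2 - a) (- a) in
     [/\ H2 p5, RG G = G, G #= `I_48 & isomorphic_groups G (G12 C)] /\
     [/\ G = generated [set A; B; D],
         has_braid_length A B 6, has_braid_length A D 6,
         has_braid_length B D 6 & mirror_counts G 0 0 12])
    /\
    (let G := isotropy p6 in
     [/\ G = generated [set M6], G #= `I_8, RG G #= `I_2,
         RG G = generated [set refl a 1 0] & mirror_counts G 1 0 0])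
    /\
    (let G := isotropy p7 in
     [/\ G = generated [set M7], G #= `I_4, RG G #= `I_2,
         RG G = generated [set refl a 1 1] & mirror_counts G 0 1 0])
    /\
    (forall v : 'cV[C]_3, (p6 = line v \/ p7 = line v) ->
       ~ (forall i, Qalpha C (v i 0))).
Proof.
move=> C a refl RG M6 M7 p1 p2 p3 p4 p5.
exists (line (evV C q6)), (line (evV C q7)); split.
  split; [exact: fixed6|exact: fixed7|move=> x hx ix].
  have [k [hk uk]] := isolated_orbit hx ix.
  have pE (l : 'I_7) : nth p1 [:: p1; p2; p3; p4; p5; line (evV C q6); line (evV C q7)] l =
      line (evV C (nth q1 points l)).
    rewrite /p1 /p2 /p3 /p4 /p5 vec_q1 vec_q2 vec_q3 vec_q4 vec_q5.
    by case: l => [[|[|[|[|[|[|[|]]]]]]]].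
  by exists k; split=> [|l]; rewrite pE //; apply: uk.
split; first exact: (point1 C).
split; first exact: (point2 C).
split; first exact: (point3 C).
split; first exact: (point4 C).
split.
  have [[h1 h2 h3] h4] := point5 C; split; last exact: h4.
  split; [exact: h1|exact: h2|exact: h3|].
  by rewrite /p5 vec_q5 iso5; exact: group5_iso.
split; first exact: (point6 C).
split; first exact: (point7 C).
by move=> v; exact: irrational67.
Qed.
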